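(* Let $u$, $\theta$ and $\psi$ be inner functions with $\psi$ nonconstant and $K_\theta\neq\{0\}$, and define $$\eta(z)=\begin{cases} z\,(\theta\circ\psi)(z)\,(u\circ\psi)(z)/\psi(z), & \theta(0)=0\text{ or }u(0)=0,\\ (\theta\circ\psi)(z)\,(u\circ\psi)(z), & \theta(0)\neq0,\ u(0)\neq0\text{ and }\psi(0)=0,\\ z\,(\theta\circ\psi)(z)\,(u\circ\psi)(z), & \theta(0)\neq0,\ u(0)\neq0\text{ and }\psi(0)\neq0.\end{cases}$$ Then $\eta$ is inner and the composition operator $C_\psi:uK_\theta\to K_\eta$ is well-defined and bounded. Moreover, $K_\eta$ is the smallest model space containing $C_\psi(uK_\theta)$.
   Context: $\mathbb{D}$ is the open unit disc and $H^2$ the Hardy space of $\mathbb{D}$. An inner function is a bounded analytic function on $\mathbb{D}$ with boundary values of modulus $1$ a.e. on the unit circle. For an inner function $\theta$, the model space is $K_\theta=H^2\ominus\theta H^2$. $C_\psi f=f\circ\psi$, and $uK_\theta=\{uf:f\in K_\theta\}$ with the $H^2$ norm. ''Smallest (minimal) model space containing a set $E$'' means: $E\subseteq K_\eta$, and $\eta$ divides (in the sense of inner functions) every inner function $v$ such that $E\subseteq K_v$; equivalently $K_\eta\subseteq K_v$ for all such $v$. *)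

(* Defs.v *)
From HB Require Import structures.
From mathcomp Require Import all_boot all_order all_algebra.
From mathcomp Require Import complex.
From mathcomp Require Import all_classical all_reals all_analysis.

Set Implicit Arguments.
Unset Strict Implicit.
Unset Printing Implicit Defensive.

Import Order.TTheory GRing.Theory Num.Theory.
Import numFieldNormedType.Exports.

Local Open Scope classical_set_scope.
Local Open Scope complex_scope.
Local Open Scope ring_scope.

(* R[i] does not directly carry a topology; packed as a numClosedFieldType
   it receives the one of numFieldNormedType. *)
Definition Cplx (R : realType) : numClosedFieldType := R[i].

(* The modulus as an element of R (the library's `|z| lives in R[i]). *)
Definition cmod {R : realType} (z : Cplx R) : R := ComplexField.Normc.normc z.

Definition disc (R : realType) : set (Cplx R) := [set z | cmod z < 1].

(* Functions on the disc are represented by total functions; only their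
   values on the disc matter. *)

Definition taylor_expansion {R : realType} (f : Cplx R -> Cplx R)
    (a : nat -> Cplx R) : Prop :=
  forall z, disc z -> series (fun n => a n * z ^+ n) @ \oo --> f z.

Definition analytic {R : realType} (f : Cplx R -> Cplx R) : Prop :=
  exists a, taylor_expansion f a.

(* The sequence of Taylor coefficients at 0, which is unique when f is
   analytic on the disc. *)
Definition taylor_coef {R : realType} (f : Cplx R -> Cplx R) : nat -> Cplx R :=
  get [set a | taylor_expansion f a].

Definition H2 (R : realType) : set (Cplx R -> Cplx R) :=
  [set f | analytic f /\
           cvgn (series (fun n => cmod (taylor_coef f n) ^+ 2))].

Definition H2dot {R : realType} (f g : Cplx R -> Cplx R) : Cplx R :=
  limn (series (fun n => taylor_coef f n * (taylor_coef g n)^*)).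

Definition H2norm {R : realType} (f : Cplx R -> Cplx R) : R :=
  Num.sqrt (limn (series (fun n => cmod (taylor_coef f n) ^+ 2))).

(* Boundary values are radial limits. *)
Definition inner {R : realType} (f : Cplx R -> Cplx R) : Prop :=
  [/\ analytic f,
      exists M : R, forall z, disc z -> cmod (f z) <= M &
      {ae (@lebesgue_measure R), forall t : R, 0 <= t <= 2 * pi ->
        exists2 l : Cplx R, cmod l = 1 &
          f (r%:C * (cos t +i* sin t)) @[r --> (1 : R)^'-] --> l}].

Definition nonconstant {R : realType} (f : Cplx R -> Cplx R) : Prop :=
  ~ exists c, forall z, disc z -> f z = c.

Definition model_space {R : realType} (theta : Cplx R -> Cplx R) :
    set (Cplx R -> Cplx R) :=
  [set f | H2 f /\
           forall g, H2 g -> H2dot f (fun z => theta z * g z) = 0].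

Definition nontrivial_space {R : realType} (E : set (Cplx R -> Cplx R)) :
    Prop :=
  exists2 f, E f & exists2 z, disc z & f z != 0.

Definition mul_space {R : realType} (u : Cplx R -> Cplx R)
    (E : set (Cplx R -> Cplx R)) : set (Cplx R -> Cplx R) :=
  [set (fun z => u z * f z) | f in E].

Definition comp_op {R : realType} (psi f : Cplx R -> Cplx R) :
    Cplx R -> Cplx R := f \o psi.

Definition inner_divides {R : realType} (eta v : Cplx R -> Cplx R) : Prop :=
  exists2 w, inner w & forall z, disc z -> v z = eta z * w z.

Definition smallest_model_space {R : realType} (eta : Cplx R -> Cplx R)
    (E : set (Cplx R -> Cplx R)) : Prop :=
  [/\ inner eta, E `<=` model_space eta &
      forall v, inner v -> E `<=` model_space v -> inner_divides eta v].

(* In the first case the formula is 0/0 at the zeros of psi, which are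
   removable singularities: the limit supplies the value there. *)
Definition eta_fun {R : realType} (u theta psi : Cplx R -> Cplx R) :
    Cplx R -> Cplx R :=
  let F := fun z => theta (psi z) * u (psi z) in
  if (theta 0 == 0) || (u 0 == 0) then
    fun z => if psi z == 0 then lim (w * F w / psi w @[w --> z^'])
             else z * F z / psi z
  else if psi 0 == 0 then F
  else fun z => z * F z.

(* Main.v *)
Require Import Defs.
From HB Require Import structures.
From mathcomp Require Import all_boot all_order all_algebra.
From mathcomp Require Import complex ring lra.
From mathcomp Require Import all_classical all_reals all_analysis measurable_realfun.

(** Inner functions are exactly the analytic [phi] such that multiplication by
    [phi] is an isometry of H^2 ([iso]): dominated convergence on circles gives
    one direction; conversely [|phi| <= 1] and [||phi|| = 1], and Fatou's
    theorem provides radial limits, which must have modulus 1.  With this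
    criterion products, quotients and compositions of inner functions are
    handled without boundary values.

    Put F = (theta u) o psi.  Boundedness is Littlewood's subordination
    theorem.  For the inclusion, g orthogonal to theta H^2 means that
    conj(theta) g lies in conj(z H^2) on the circle, so after composition
    psi (g o psi) is orthogonal to z (theta o psi) H^2; multiplying by u o psi
    and cancelling psi gives orthogonality to eta H^2 in each of the three
    cases.  For minimality, apply the hypothesis on v to the single element
    g = (theta - theta(0)) / z of K_theta: F - theta(0) (u o psi) is orthogonal
    to psi v H^2.  Since |theta(0)| < 1 this can be iterated to show that F
    itself is orthogonal to psi v H^2, which forces z F to divide psi v;
    cancelling psi gives eta | v. *)

Set Implicit Arguments.
Unset Strict Implicit.
Unset Printing Implicit Defensive.

Import Order.TTheory GRing.Theory Num.Theory.
Import numFieldNormedType.Exports.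

Local Open Scope classical_set_scope.
Local Open Scope ring_scope.

(** * The complex field in real coordinates *)

Section ComplexNumbers.
Context {R : realType}.
Notation C := (Cplx R).
Implicit Types (z w a b : C) (r x : R).

(** The obstacle is that conj(theta) g is not analytic, so polynomials stand in for it. As |theta| =
    1 on the circle, z^N conj(theta) is close to the polynomial whose coefficients are those of
    theta, conjugated and reversed ([trunc_unimodular]). Membership of g in K_theta then reads: for
    every e there are N and a polynomial p of degree below N with z^N g within e of theta p
    ([model_approx]). This form survives the substitution of psi: Littlewood's theorem controls the
    error and psi^N takes the place of z^N.

    Unless psi(0) = 0 the powers of psi are not orthogonal. The factor 1 - conj(a) psi with a =
    psi(0) repairs this; it yields both Littlewood's theorem and the fact that theta o psi is again
    an isometric multiplier.

    The three formulas for eta say one thing: psi eta is the least common multiple of psi and z F.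
    The inclusion uses that it is a multiple of z F, and minimality that it divides every psi v
    which z F divides ([eta_fun_spec]). *)

Definition re z : R := complex.Re z.
Definition im z : R := complex.Im z.
Definition cpx x y : C := Complex x y.
Definition rc x : C := cpx x 0.
Definition cj z : C := cpx (re z) (- im z).
Definition cdot a b : R := re a * re b + im a * im b.
Definition ci : C := cpx 0 1.

Lemma cpxE z : z = cpx (re z) (im z). Proof. by case: z. Qed.

Lemma cpx_eq z w : re z = re w -> im z = im w -> z = w.
Proof. by move=> h1 h2; rewrite (cpxE z) (cpxE w) h1 h2. Qed.

Lemma reD z w : re (z + w) = re z + re w. Proof. by case: z; case: w. Qed.
Lemma imD z w : im (z + w) = im z + im w. Proof. by case: z; case: w. Qed.
Lemma reN z : re (- z) = - re z. Proof. by case: z. Qed.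
Lemma imN z : im (- z) = - im z. Proof. by case: z. Qed.
Lemma reB z w : re (z - w) = re z - re w. Proof. by rewrite reD reN. Qed.
Lemma imB z w : im (z - w) = im z - im w. Proof. by rewrite imD imN. Qed.
Lemma reM z w : re (z * w) = re z * re w - im z * im w.
Proof. by case: z; case: w. Qed.
Lemma imM z w : im (z * w) = re z * im w + im z * re w.
Proof. by case: z => a b; case: w => c d; rewrite /im /re /= addrC; congr (_ + _); exact: mulrC. Qed.
Lemma re0 : re 0 = 0. Proof. by []. Qed.
Lemma im0 : im 0 = 0. Proof. by []. Qed.
Lemma re1 : re 1 = 1. Proof. by []. Qed.
Lemma im1 : im 1 = 0. Proof. by []. Qed.
Lemma re_cpx x y : re (cpx x y) = x. Proof. by []. Qed.
Lemma im_cpx x y : im (cpx x y) = y. Proof. by []. Qed.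
Lemma re_rc x : re (rc x) = x. Proof. by []. Qed.
Lemma im_rc x : im (rc x) = 0. Proof. by []. Qed.
Lemma re_cj z : re (cj z) = re z. Proof. by []. Qed.
Lemma im_cj z : im (cj z) = - im z. Proof. by []. Qed.
Lemma re_ci : re ci = 0. Proof. by []. Qed.
Lemma im_ci : im ci = 1. Proof. by []. Qed.

Definition reimE := (reD, imD, reN, imN, reM, imM, re0, im0, re1, im1,
  re_cpx, im_cpx, re_rc, im_rc, re_cj, im_cj, re_ci, im_ci).

Lemma re_sum n (f : nat -> C) : re (\sum_(k < n) f k) = \sum_(k < n) re (f k).
Proof. by elim: n => [|n ih]; rewrite ?big_ord0// !big_ord_recr/= reD ih. Qed.
Lemma im_sum n (f : nat -> C) : im (\sum_(k < n) f k) = \sum_(k < n) im (f k).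
Proof. by elim: n => [|n ih]; rewrite ?big_ord0// !big_ord_recr/= imD ih. Qed.

Lemma cmod_sq z : cmod z ^+ 2 = re z ^+ 2 + im z ^+ 2.
Proof. by case: z => a b; rewrite /cmod /= sqr_sqrtr// addr_ge0// sqr_ge0. Qed.
Lemma cmod_ge0 z : 0 <= cmod z.
Proof. by case: z => a b; exact: sqrtr_ge0. Qed.
Hint Resolve cmod_ge0 : core.
Lemma cmodM z w : cmod (z * w) = cmod z * cmod w.
Proof. exact: ComplexField.Normc.normcM. Qed.
Lemma cmod0 : cmod (0 : C) = 0. Proof. exact: ComplexField.Normc.normc0. Qed.
Lemma cmod1 : cmod (1 : C) = 1. Proof. exact: ComplexField.Normc.normc1. Qed.
Lemma cmodX z n : cmod (z ^+ n) = cmod z ^+ n.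
Proof. by elim: n => [|n ih]; rewrite ?expr0 ?cmod1// !exprS cmodM ih. Qed.
Lemma cmodN z : cmod (- z) = cmod z. Proof. exact: normcN. Qed.
Lemma cmodBC z w : cmod (z - w) = cmod (w - z).
Proof. by rewrite -cmodN opprB. Qed.
Lemma cmodD z w : cmod (z + w) <= cmod z + cmod w. Proof. exact: le_normcD. Qed.
Lemma cmodB z w : cmod (z - w) <= cmod z + cmod w.
Proof. by rewrite -(cmodN w); exact: cmodD. Qed.
Lemma cmodBD z w v : cmod (z - w) <= cmod (z - v) + cmod (v - w).
Proof. by rewrite (_ : z - w = (z - v) + (v - w)) ?cmodD// addrA subrK. Qed.

Lemma cmod_eq0 z : cmod z = 0 -> z = 0.
Proof. exact: ComplexField.Normc.eq0_normc. Qed.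
Lemma cmod_gt0 z : z != 0 -> 0 < cmod z.
Proof. by move=> z0; rewrite lt_def cmod_ge0 andbT; apply: contra z0 => /eqP/cmod_eq0 ->. Qed.
Lemma cmodV z : cmod (z^-1) = (cmod z)^-1.
Proof. exact: ComplexField.Normc.normcV. Qed.
Lemma cmod_rc x : cmod (rc x) = `|x|.
Proof. by rewrite /cmod /rc /cpx /= expr0n/= addr0 sqrtr_sqr. Qed.
Lemma cmod_cj z : cmod (cj z) = cmod z.
Proof. by apply/eqP; rewrite -(@eqrXn2 _ 2)// ?cmod_sq// !reimE sqrrN. Qed.
Lemma cmod_ci : cmod ci = 1.
Proof. by rewrite /cmod/= expr0n/= expr1n add0r sqrtr1. Qed.
Lemma normrE z : `|z| = rc (cmod z). Proof. by []. Qed.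
Lemma cmod_sum n (f : nat -> C) :
  cmod (\sum_(k < n) f k) <= \sum_(k < n) cmod (f k).
Proof.
elim: n => [|n ih]; rewrite ?big_ord0 ?cmod0// !big_ord_recr/=.
by apply: le_trans (cmodD _ _) _; rewrite lerD2r.
Qed.
Lemma abs_re_le z : `|re z| <= cmod z.
Proof. by rewrite -ler_sqr ?nnegrE// cmod_sq real_normK ?num_real// lerDl sqr_ge0. Qed.
Lemma abs_im_le z : `|im z| <= cmod z.
Proof. by rewrite -ler_sqr ?nnegrE// cmod_sq real_normK ?num_real// lerDr sqr_ge0. Qed.
Lemma cmod_le z : cmod z <= `|re z| + `|im z|.
Proof.
rewrite -ler_sqr ?nnegrE ?addr_ge0// cmod_sq sqrrD !real_normK ?num_real//.
by rewrite -addrA lerD2l lerDr mulrn_wge0// mulr_ge0.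
Qed.
Lemma cmod_lt_disc z : disc z = (cmod z < 1). Proof. by []. Qed.
Lemma rcM x y : rc (x * y) = rc x * rc y.
Proof. by apply: cpx_eq; rewrite !reimE; ring. Qed.
Lemma rc_real x : rc x = (x%:C)%C. Proof. by []. Qed.

Lemma cdotC a b : cdot a b = cdot b a. Proof. by rewrite /cdot; ring. Qed.
Lemma cdotDl a b c : cdot (a + b) c = cdot a c + cdot b c.
Proof. by rewrite /cdot !reimE; ring. Qed.
Lemma cdotZl c a b : cdot (c * a) b = cdot a (cj c * b).
Proof. by rewrite /cdot !reimE; ring. Qed.
Lemma cdotrl x a b : cdot (rc x * a) b = x * cdot a b.
Proof. by rewrite /cdot !reimE; ring. Qed.
Lemma cdot_sq a : cdot a a = cmod a ^+ 2. Proof. by rewrite cmod_sq /cdot. Qed.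
Lemma cdot_le a b : `|cdot a b| <= (cmod a ^+ 2 + cmod b ^+ 2) / 2.
Proof.
rewrite ler_norml !cmod_sq /cdot.
have h1 := sqr_ge0 (re a - re b); have h2 := sqr_ge0 (im a - im b).
have h3 := sqr_ge0 (re a + re b); have h4 := sqr_ge0 (im a + im b).
by apply/andP; split; nra.
Qed.

Lemma ge0_rc x : (0 : C) < rc x <-> 0 < x.
Proof. by rewrite rc_real ltcR. Qed.

(** The order of [R[i]] makes every positive element real, so complex epsilons reduce to real
    ones. *)
Lemma gt0_rcP (e : C) : 0 < e -> exists2 x, 0 < x & e = rc x.
Proof.
case: e => a b; rewrite ltcE/= => /andP[/eqP -> a0].
by exists a.
Qed.

Lemma cvgCP {T} {F : set_system T} {FF : Filter F} (f : T -> C) l :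
  f @ F --> l <-> forall e, 0 < e -> \near F, cmod (l - f F) < e.
Proof.
split=> [/cvgrPdist_lt h e e0|h].
  have /h : (0 : C) < rc e by apply/ge0_rc.
  by apply: filterS => t; rewrite normrE !rc_real ltcR.
apply/cvgrPdist_lt => e /gt0_rcP[x x0 ->].
by apply: filterS (h _ x0) => t; rewrite normrE !rc_real ltcR.
Qed.

Lemma cvg_reim {T} {F : set_system T} {FF : Filter F} (f : T -> C) l :
  (re \o f) @ F --> re l -> (im \o f) @ F --> im l -> f @ F --> l.
Proof.
move=> /cvgrPdist_lt h1 /cvgrPdist_lt h2; apply/cvgCP => e e0.
have e2 : 0 < e / 2 by rewrite divr_gt0.
near=> t.
apply: le_lt_trans (cmod_le _) _; rewrite reB imB (splitr e) ltrD//.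
- by near: t; apply: h1.
- by near: t; apply: h2.
Unshelve. all: by end_near. Qed.

Lemma cvg_re {T} {F : set_system T} {FF : Filter F} (f : T -> C) l :
  f @ F --> l -> (re \o f) @ F --> re l.
Proof.
move=> /cvgCP h; apply/cvgrPdist_lt => e /h; apply: filterS => t.
by apply: le_lt_trans; rewrite /= -reB abs_re_le.
Qed.

Lemma cvg_im {T} {F : set_system T} {FF : Filter F} (f : T -> C) l :
  f @ F --> l -> (im \o f) @ F --> im l.
Proof.
move=> /cvgCP h; apply/cvgrPdist_lt => e /h; apply: filterS => t.
by apply: le_lt_trans; rewrite /= -imB abs_im_le.
Qed.

Lemma cvg_cmod {T} {F : set_system T} {FF : Filter F} (f : T -> C) l :
  f @ F --> l -> (cmod \o f) @ F --> cmod l.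
Proof.
move=> /cvgCP h; apply/cvgrPdist_lt => e /h; apply: filterS => t /=.
apply: le_lt_trans; rewrite ler_norml.
have := cmodD (l - f t) (f t); rewrite subrK => h1.
have := cmodB l (l - f t); rewrite opprB addrC subrK => h2.
by apply/andP; split; lra.
Qed.

Lemma cvgC_unique {T} {F : set_system T} {FF : ProperFilter F} (f : T -> C) a b :
  f @ F --> a -> f @ F --> b -> a = b.
Proof. by move=> ha hb; apply: cvg_unique ha hb; exact: norm_hausdorff. Qed.

Lemma cvgC_cauchy (u : nat -> C) :
  (forall e, 0 < e -> exists N, forall n, (N <= n)%N -> cmod (u N - u n) < e) ->
  exists l : C, u @ \oo --> l.
Proof.
move=> h.
have key (p : C -> R) : (forall z w, p (z - w) = p z - p w) ->
    (forall z, `|p z| <= cmod z) -> cvgn (p \o u).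
  move=> pB pl; apply/cauchy_cvgP/cauchy_exP => e e0.
  have [N HN] := h _ e0; exists (p (u N)); exists N => // n /= Nn.
  by rewrite /ball /= -pB; apply: le_lt_trans (pl _) _; exact: HN.
have h1 := key re reB abs_re_le; have h2 := key im imB abs_im_le.
exists (cpx (limn (re \o u)) (limn (im \o u))).
by apply: cvg_reim.
Qed.

End ComplexNumbers.
#[export] Hint Extern 0 (is_true (0 <= cmod _)) => apply: cmod_ge0 : core.
Arguments re : simpl never.
Arguments im : simpl never.
Arguments rc : simpl never.
Arguments cpx : simpl never.
Arguments cmod : simpl never.
Arguments cj : simpl never.
Arguments cdot : simpl never.
Arguments ci : simpl never.

(** * Series and power series *)

Section RealSeries.
Context {R : realType}.
Implicit Types (u v : nat -> R) (r x M : R).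

Lemma nneg_series_homo u : (forall n, 0 <= u n) ->
  {homo series u : n m / (n <= m)%N >-> n <= m}.
Proof. by move=> u0; apply: nondecreasing_series => n _ _. Qed.

Lemma nneg_series_cvg u M : (forall n, 0 <= u n) ->
  (forall n, series u n <= M) -> cvgn (series u).
Proof.
move=> u0 uM; apply: nondecreasing_is_cvgn; first exact: nneg_series_homo.
by exists M => _ [n _ <-].
Qed.

Lemma nneg_series_le_lim u n : (forall n, 0 <= u n) -> cvgn (series u) ->
  series u n <= limn (series u).
Proof. by move=> u0 cu; apply: nondecreasing_cvgn_le => //; exact: nneg_series_homo. Qed.

Lemma nneg_series_lim_le u M : cvgn (series u) ->
  (forall n, series u n <= M) -> limn (series u) <= M.
Proof. by move=> cu uM; apply: limr_le => //; apply: nearW. Qed.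

Lemma abs_series_cvg u : cvgn (series (fun n => `|u n|)) -> cvgn (series u).
Proof. by move=> h; apply: (@normed_cvg R R^o u). Qed.

Lemma series_dom_cvg u v : (forall n, `|u n| <= v n) -> cvgn (series v) ->
  cvgn (series u).
Proof.
move=> uv cv; apply: abs_series_cvg; apply: series_le_cvg cv => // n.
exact: le_trans (uv n).
Qed.

Lemma geo_cvg r M : 0 <= r < 1 -> cvgn (series (fun n => M * r ^+ n)).
Proof. by case/andP=> r0 r1; apply: is_cvg_geometric_series; rewrite ger0_norm. Qed.

Lemma series_lim_recl u : cvgn (series (fun n => u n.+1)) ->
  cvgn (series u) /\ limn (series u) = u 0%N + limn (series (fun n => u n.+1)).
Proof.
move=> h.
suff H : series u @ \oo --> u 0%N + limn (series (fun n => u n.+1)).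
  by split; [apply/cvg_ex; eexists; exact: H | exact: cvg_lim].
rewrite -cvg_shiftS.
have -> : (fun n => series u n.+1) = (fun n => u 0%N + series (fun n => u n.+1) n).
  by apply/funext => n; rewrite !seriesEnat/= big_nat_recl.
by apply: cvgD => //; exact: cvg_cst.
Qed.

Lemma series_finite u N : (forall n, (N <= n)%N -> u n = 0) ->
  cvgn (series u) /\ limn (series u) = \sum_(k < N) u k.
Proof.
move=> uN.
suff H : series u @ \oo --> \sum_(k < N) u k.
  by split; [apply/cvg_ex; eexists; exact: H | exact: cvg_lim].
apply: cvg_near_cst; exists N => // n /= Nn.
rewrite seriesEnat/= (big_cat_nat _ Nn)//= [X in _ + X]big_nat [X in _ + X]big1 ?addr0 ?big_mkord//.
by move=> i /andP[/uN ->].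
Qed.

Lemma cvg_tail0 u : cvgn (series u) ->
  forall e, 0 < e -> exists N, forall n, (N <= n)%N -> `|limn (series u) - series u n| < e.
Proof.
move=> cu e e0; have /cvgrPdist_lt/(_ _ e0)[N _ HN] := cu.
by exists N => n Nn; exact: HN.
Qed.

(* Locked, like [ana], [co], [hardy], [sqn] and [rd] below: the unifier must not
   unfold limits or the choice operator in [taylor_coef]. *)
Definition summ u : Prop := locked (fun u : nat -> R => cvgn (series u)) u.
Definition tot u : R := locked (fun u : nat -> R => limn (series u)) u.

Lemma summE u : summ u = cvgn (series u). Proof. by rewrite /summ -lock. Qed.
Lemma totE u : tot u = limn (series u). Proof. by rewrite /tot -lock. Qed.

Lemma summ_cvg u : summ u -> (fun N => \sum_(k < N) u k) @ \oo --> tot u.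
Proof.
rewrite summE totE => h; have -> : (fun N => \sum_(k < N) u k) = series u; last exact: h.
by apply/funext => N; rewrite seriesEnat/= big_mkord.
Qed.

Lemma eq_tot u v : (forall n, u n = v n) -> tot u = tot v.
Proof. by move=> h; have -> : u = v by apply/funext. Qed.

Lemma eq_summ u v : (forall n, u n = v n) -> summ u -> summ v.
Proof. by move=> h; have -> : u = v by apply/funext. Qed.

Lemma summ_dom u v : (forall n, `|u n| <= v n) -> summ v -> summ u.
Proof. by rewrite !summE; exact: series_dom_cvg. Qed.

Lemma summZ u x : summ u -> summ (fun n => x * u n).
Proof. rewrite !summE; exact: (@is_cvg_seriesZ _ u x). Qed.

Lemma summD u v : summ u -> summ v -> summ (fun n => u n + v n).
Proof. rewrite !summE; exact: (@is_cvg_seriesD _ u v). Qed.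

Lemma totZ u x : summ u -> tot (fun n => x * u n) = x * tot u.
Proof. rewrite ?summE !totE; exact: (@lim_seriesZ _ u x). Qed.

Lemma totD u v : summ u -> summ v -> tot (fun n => u n + v n) = tot u + tot v.
Proof. rewrite ?summE !totE; exact: (@lim_seriesD _ u v). Qed.

Lemma summ_nneg u M : (forall n, 0 <= u n) ->
  (forall N, \sum_(k < N) u k <= M) -> summ u.
Proof.
move=> u0 h; rewrite summE; apply: (nneg_series_cvg u0 (M := M)) => N.
by rewrite seriesEnat/= big_mkord.
Qed.

Lemma le_tot u N : (forall n, 0 <= u n) -> summ u -> \sum_(k < N) u k <= tot u.
Proof.
rewrite summE totE => u0 h; have := nneg_series_le_lim N u0 h.
by rewrite seriesEnat/= big_mkord.
Qed.

Lemma tot_le u M : summ u -> (forall N, \sum_(k < N) u k <= M) -> tot u <= M.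
Proof.
rewrite summE totE => su h; apply: nneg_series_lim_le => // N.
by rewrite seriesEnat/= big_mkord.
Qed.

Lemma tot_ge0 u : (forall n, 0 <= u n) -> summ u -> 0 <= tot u.
Proof. by move=> u0 /(le_tot 0 u0); rewrite big_ord0. Qed.

Lemma summ_recl u : summ (fun n => u n.+1) ->
  summ u /\ tot u = u 0%N + tot (fun n => u n.+1).
Proof. by rewrite !summE !totE; exact: series_lim_recl. Qed.

Lemma summ_finite u N : (forall n, (N <= n)%N -> u n = 0) ->
  summ u /\ tot u = \sum_(k < N) u k.
Proof. by rewrite summE totE; exact: series_finite. Qed.

End RealSeries.

Section PowerSeries.
Context {R : realType}.
Notation C := (Cplx R).
Implicit Types (f g : C -> C) (a b : nat -> C) (z w : C) (r x : R).

Definition psum a N z : C := \sum_(k < N) a k * z ^+ k.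

(* The radius of convergence is at least 1. *)
Definition radc a := forall r, 0 <= r < 1 -> exists M, forall n, cmod (a n) * r ^+ n <= M.

Lemma radc_cvg a r : radc a -> 0 <= r < 1 -> cvgn (series (fun n => cmod (a n) * r ^+ n)).
Proof.
(* Boundedness at the intermediate radius [s] gives geometric domination with ratio r/s at radius
   [r]. *)
move=> ha /andP[r0 r1]; pose s := (1 + r) / 2.
have s0 : 0 < s by rewrite /s; lra.
have s1 : s < 1 by rewrite /s; lra.
have rs : r < s by rewrite /s; lra.
have [|M HM] := ha s; first by rewrite ltW.
apply: (@series_dom_cvg _ _ (fun n => M * (r / s) ^+ n)); last first.
  by apply: geo_cvg; rewrite divr_ge0 ?(ltW s0)//= ltr_pdivrMr// mul1r.
move=> n; rewrite ger0_norm ?mulr_ge0 ?exprn_ge0//.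
have -> : cmod (a n) * r ^+ n = (cmod (a n) * s ^+ n) * (r / s) ^+ n.
  by rewrite -mulrA -exprMn [s * _]mulrC divfK ?gt_eqF.
by rewrite ler_wpM2r ?HM// exprn_ge0// divr_ge0// ltW.
Qed.

Lemma psum_series a z : (fun N => psum a N z) = series (fun n => a n * z ^+ n).
Proof. by apply/funext => n; rewrite /psum seriesEnat/= big_mkord. Qed.

Lemma re_series (u : nat -> C) : re \o series u = series (re \o u).
Proof. by apply/funext => n; rewrite /= !seriesEnat/= !big_mkord re_sum. Qed.

Lemma im_series (u : nat -> C) : im \o series u = series (im \o u).
Proof. by apply/funext => n; rewrite /= !seriesEnat/= !big_mkord im_sum. Qed.

Lemma seriesC_cvg (u : nat -> C) : cvgn (series (fun n => cmod (u n))) ->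
  exists l : C, series u @ \oo --> l.
Proof.
move=> h; exists (cpx (limn (series (re \o u))) (limn (series (im \o u)))).
apply: cvg_reim.
  by rewrite re_series; apply: (series_dom_cvg _ h) => n; exact: abs_re_le.
by rewrite im_series; apply: (series_dom_cvg _ h) => n; exact: abs_im_le.
Qed.

Lemma radc_taylor a : radc a -> exists f, taylor_expansion f a.
Proof.
move=> ha.
have h z : exists l : C, disc z -> series (fun n => a n * z ^+ n) @ \oo --> l.
  have [zD|zD] := pselect (disc z); last by exists 0.
  have [|l hl] := @seriesC_cvg (fun n => a n * z ^+ n).
    under eq_fun do rewrite cmodM cmodX.
    by apply: radc_cvg => //; rewrite cmod_ge0.
  by exists l.
have [f hf] := @choice _ _ _ h.
by exists f => z; exact: hf.
Qed.

Lemma taylor_radc f a : taylor_expansion f a -> radc a.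
Proof.
move=> h r /andP[r0 r1].
have rD : disc (rc r : C) by rewrite cmod_lt_disc cmod_rc ger0_norm.
have := h _ rD => H.
have /cvgCP/(_ 1 ltr01)[N _ HN] := H.
(* A term is the difference of two consecutive partial sums, both within 1 of the limit. *)
have key n : (N <= n)%N -> cmod (a n) * r ^+ n <= 2.
  move=> Nn; have h1 := HN _ Nn; have h2 := HN _ (leq_trans Nn (leqnSn n)).
  have -> : cmod (a n) * r ^+ n = cmod (a n * rc r ^+ n).
    by rewrite cmodM cmodX cmod_rc ger0_norm.
  have -> : a n * rc r ^+ n = (f (rc r) - series (fun n => a n * rc r ^+ n) n)
     - (f (rc r) - series (fun n => a n * rc r ^+ n) n.+1).
    by rewrite seriesSr; ring.
  apply: le_trans (cmodB _ _) _; rewrite /= in h1 h2; lra.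
exists (2 + \sum_(k < N) cmod (a k) * r ^+ k) => n.
have S0 m : 0 <= \sum_(k < m) cmod (a k) * r ^+ k.
  by apply: sumr_ge0 => k _; rewrite mulr_ge0// exprn_ge0.
have [Nn|nN] := leqP N n.
  by apply: le_trans (key _ Nn) _; rewrite lerDl.
rewrite (bigD1 (Ordinal nN))//= addrCA lerDl addr_ge0//.
by apply: sumr_ge0 => k _; rewrite mulr_ge0// exprn_ge0.
Qed.

Lemma taylor_cvgE f a z : taylor_expansion f a -> disc z -> (fun N => psum a N z) @ \oo --> f z.
Proof. by move=> h zD; rewrite psum_series; exact: h. Qed.

Lemma le_expn2 x y n : 0 <= x -> x <= y -> x ^+ n <= y ^+ n.
Proof. by move=> x0 xy; rewrite lerXn2r// nnegrE// (le_trans x0). Qed.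

Lemma psum_diff a r z N M : (N <= M)%N -> cmod z <= r ->
  cmod (psum a M z - psum a N z) <=
  series (fun n => cmod (a n) * r ^+ n) M - series (fun n => cmod (a n) * r ^+ n) N.
Proof.
move=> NM zr; rewrite !(congr1 (@^~ _) (psum_series a z)) !sub_series_geq//.
elim/big_ind2 : _ => //; first by rewrite cmod0.
  by move=> x1 x2 y1 y2 h1 h2; apply: le_trans (cmodD _ _) (lerD h1 h2).
move=> k _; rewrite cmodM cmodX ler_wpM2l// le_expn2//.
Qed.

Lemma taylor_unif f a r : taylor_expansion f a -> 0 <= r < 1 ->
  forall e, 0 < e -> exists N0, forall N z, (N0 <= N)%N -> cmod z <= r ->
    cmod (f z - psum a N z) <= e.
Proof.
move=> h /andP[r0 r1] e e0; have ha := taylor_radc h.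
have cv : cvgn (series (fun n => cmod (a n) * r ^+ n)) by apply: radc_cvg; rewrite ?r0.
have e2 : 0 < e / 2 by rewrite divr_gt0.
have [N0 HN] := cvg_tail0 cv e2.
exists N0 => N z NN zr.
have zD : disc z by apply: le_lt_trans r1.
(* [M] depends on [z], but the comparison of [psum a N] with the partial sum at [maxn M N] uses only
   the tail of the absolute series at radius [r]; this makes [N0] uniform. *)
have /cvgCP/(_ _ e2)[M _ HM] := taylor_cvgE h zD.
have h1 := HM _ (leq_maxl M N).
have h2 := psum_diff a (leq_maxr M N) zr.
have h3 := HN _ NN.
have h4 : series (fun n => cmod (a n) * r ^+ n) (maxn M N) <= limn (series (fun n => cmod (a n) * r ^+ n)).
  by apply: nneg_series_le_lim => // n; rewrite mulr_ge0// exprn_ge0.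
apply: le_trans (cmodBD _ _ (psum a (maxn M N) z)) _.
have := ler_norm (limn (series (fun n => cmod (a n) * r ^+ n)) - series (fun n => cmod (a n) * r ^+ n) N).
rewrite /= in h1; lra.
Qed.

End PowerSeries.

(** * Circle means and analytic functions *)

Section CircleMeans.
Context {R : realType}.
Notation C := (Cplx R).
Notation mu := (@lebesgue_measure R).
Implicit Types (f g : C -> C) (a b : nat -> C) (z w : C) (r x c t : R) (h : R -> R).

Definition arc c : set R := `[c, c + 2 * pi]%classic.

(* The starting point of the period is free so that the boundary point under study
   can be put in its middle. *)
Definition mean c h : R := (2 * pi)^-1 * Rintegral mu (arc c) h.

Lemma pi2_gt0 : 0 < 2 * pi :> R. Proof. by rewrite mulr_gt0// pi_gt0. Qed.

Lemma measurable_arc c : measurable (arc c : set (measurableTypeR R)). Proof. exact: measurable_itv. Qed.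
Hint Resolve measurable_arc : core.

Lemma mu_arc c : mu (arc c) = (2 * pi)%:E.
Proof.
rewrite /arc lebesgue_measure_itv/= lte_fin ltrDl pi2_gt0.
by rewrite -EFinB; congr EFin; ring.
Qed.

Lemma cont_integrable c h : continuous h -> mu.-integrable (arc c) (EFin \o h).
Proof.
move=> ch; apply: continuous_compact_integrable; first exact: segment_compact.
exact: continuous_subspaceT.
Qed.

Lemma contD h1 h2 : continuous h1 -> continuous h2 -> continuous (fun t => h1 t + h2 t).
Proof. by move=> c1 c2 t; apply: (@continuousD _ _ _ h1 h2); [exact: c1|exact: c2]. Qed.

Lemma contB h1 h2 : continuous h1 -> continuous h2 -> continuous (fun t => h1 t - h2 t).
Proof. by move=> c1 c2 t; apply: (@continuousB _ _ _ h1 h2); [exact: c1|exact: c2]. Qed.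

Lemma contM h1 h2 : continuous h1 -> continuous h2 -> continuous (fun t => h1 t * h2 t).
Proof. by move=> c1 c2 t; apply: (@continuousM _ _ h1 h2); [exact: c1|exact: c2]. Qed.

Lemma cont_cst x : continuous (fun _ : R => x).
Proof. by move=> t; exact: cvg_cst. Qed.

Lemma meanD c h1 h2 : continuous h1 -> continuous h2 ->
  mean c (fun t => h1 t + h2 t) = mean c h1 + mean c h2.
Proof.
move=> c1 c2; rewrite /mean (RintegralD (measurable_arc c)) ?mulrDr//.
  exact: cont_integrable c1.
exact: cont_integrable c2.
Qed.

Lemma meanB c h1 h2 : continuous h1 -> continuous h2 ->
  mean c (fun t => h1 t - h2 t) = mean c h1 - mean c h2.
Proof.
move=> c1 c2; rewrite /mean (RintegralB (measurable_arc c)) ?mulrBr//.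
  exact: cont_integrable c1.
exact: cont_integrable c2.
Qed.

Lemma meanZ c x h : continuous h -> mean c (fun t => x * h t) = x * mean c h.
Proof.
move=> ch; rewrite /mean (RintegralZl _ (measurable_arc c)) 1?mulrCA//.
exact: cont_integrable ch.
Qed.

Lemma mean_cst c x : mean c (fun=> x) = x.
Proof.
rewrite /mean (Rintegral_cst _ (measurable_arc c)) (congr1 fine (mu_arc c))/= mulrCA mulVf ?mulr1//.
by rewrite gt_eqF// pi2_gt0.
Qed.

Lemma mean_le c h1 h2 : continuous h1 -> continuous h2 ->
  (forall t, h1 t <= h2 t) -> mean c h1 <= mean c h2.
Proof.
move=> c1 c2 h; rewrite /mean ler_pM2l ?invr_gt0 ?pi2_gt0//.
apply: (le_Rintegral (measurable_arc c)) => //.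
  exact: cont_integrable c1.
exact: cont_integrable c2.
Qed.

Lemma mean_ext c h1 h2 : (forall t, h1 t = h2 t) -> mean c h1 = mean c h2.
Proof. by move=> h; congr mean; apply/funext. Qed.

Lemma mean_unif c h (u : nat -> R -> R) : continuous h -> (forall n, continuous (u n)) ->
  (forall e, 0 < e -> exists N0, forall n t, (N0 <= n)%N -> `|h t - u n t| <= e) ->
  (fun n => mean c (u n)) @ \oo --> mean c h.
Proof.
move=> ch cu H; apply/cvgrPdist_le => e e0.
have [N0 HN] := H _ e0; exists N0 => // n /= Nn.
rewrite ler_norml; apply/andP; split.
  rewrite lerNl opprB -meanB// -(mean_cst c e); apply: mean_le => //.
  - exact: contB (cu n) ch.
  - exact: cont_cst.
  - by move=> t; have := HN n t Nn; rewrite ler_norml; lra.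
rewrite -meanB// -(mean_cst c e); apply: mean_le => //.
- exact: contB ch (cu n).
- exact: cont_cst.
- by move=> t; have := HN n t Nn; rewrite ler_norml; lra.
Qed.

Lemma unif_continuous h (u : nat -> R -> R) : (forall n, continuous (u n)) ->
  (forall e, 0 < e -> exists N0, forall n t, (N0 <= n)%N -> `|h t - u n t| <= e) ->
  continuous h.
Proof.
move=> cu H t; apply/cvgrPdist_le => e e0.
have e3 : 0 < e / 3 by rewrite divr_gt0.
have [N0 HN] := H _ e3.
have /cvgrPdist_le/(_ _ e3) := cu N0 t.
apply: filterS => s hs.
have h1 := HN N0 t (leqnn _); have h2 := HN N0 s (leqnn _).
have -> : h t - h s = (h t - u N0 t) + (u N0 t - u N0 s) - (h s - u N0 s) by ring.
apply: le_trans (ler_normB _ _) _.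
have := ler_normD (h t - u N0 t) (u N0 t - u N0 s); lra.
Qed.

Definition expi t : C := cpx (cos t) (sin t).

Lemma cmod_expi t : cmod (expi t) = 1.
Proof. by apply/eqP; rewrite -(@eqrXn2 _ 2)// cmod_sq !reimE cos2Dsin2 expr1n. Qed.

Lemma expiX t n : expi t ^+ n = expi (n%:R * t).
Proof.
elim: n => [|n ih]; first by rewrite expr0 mul0r /expi cos0 sin0.
rewrite exprS ih -natr1 mulrDl mul1r [n%:R * t + t]addrC.
by apply: cpx_eq; rewrite !reimE ?cosD ?sinD; ring.
Qed.

Lemma expiDpi2 c : expi (c + 2 * pi) = expi c.
Proof.
rewrite (_ : 2 * pi = pi *+ 2); last by rewrite mulr_natl.
by rewrite /expi sinD2pi cosD2pi.
Qed.

Lemma cont_re_expi w n : continuous (fun t => re (w * expi t ^+ n)).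
Proof.
under eq_fun do rewrite expiX !reimE.
have cn : continuous (fun x : R => n%:R * x).
  by apply: contM; [exact: cont_cst | move=> t; exact: cvg_id].
apply: contB; apply: contM; try exact: cont_cst.
  by move=> t; apply: (continuous_comp (cn t)); exact: continuous_cos.
by move=> t; apply: (continuous_comp (cn t)); exact: continuous_sin.
Qed.

Lemma cont_im_expi w n : continuous (fun t => im (w * expi t ^+ n)).
Proof.
have -> : (fun t => im (w * expi t ^+ n)) = (fun t => re ((- ci * w) * expi t ^+ n)).
  by apply/funext => t; rewrite !reimE; ring.
exact: cont_re_expi.
Qed.

(** The antiderivative im (w e^(int)) / n is 2 pi-periodic. *)
Lemma mean_re_expi c w n : (0 < n)%N -> mean c (fun t => re (w * expi t ^+ n)) = 0.
Proof.
move=> n0; pose F t := n%:R^-1 * im (w * expi t ^+ n).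
have nR0 : n%:R != 0 :> R by rewrite pnatr_eq0 -lt0n.
have dF t : is_derive t 1 F (re (w * expi t ^+ n)).
  have -> : F = (fun t => n%:R^-1 * (re w * sin (n%:R * t) + im w * cos (n%:R * t))).
    by apply/funext => s; rewrite /F expiX !reimE.
  rewrite expiX !reimE.
  apply: is_derive_eq.
  by rewrite /GRing.scale/=; field.
rewrite /mean /Rintegral (@continuous_FTC2 _ _ F).
- rewrite /F !expiX.
  have -> : expi (n%:R * (c + 2 * pi)) = expi (n%:R * c) by rewrite -!expiX expiDpi2.
  by rewrite -EFinB subrr /= mulr0.
- by rewrite ltrDl pi2_gt0.
- by apply: continuous_subspaceT; exact: cont_re_expi.
- split.
  + by move=> x _; case: (dF x).
  + apply: cvg_at_right_filter; apply: differentiable_continuous; apply/derivable1_diffP.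
    by case: (dF c).
  + apply: cvg_at_left_filter; apply: differentiable_continuous; apply/derivable1_diffP.
    by case: (dF (c + 2 * pi)).
- by move=> x _; rewrite derive1E; exact: derive_val.
Qed.

Lemma cdotM_unit (a b w : C) : cmod w = 1 -> cdot (a * w) (b * w) = cdot a b.
Proof.
move=> h; have := cmod_sq w; rewrite h expr1n /cdot !reimE => E.
by rewrite -[RHS]mulr1 E; ring.
Qed.

Lemma cdot1r (a : C) : cdot 1 a = re a. Proof. by rewrite /cdot !reimE; ring. Qed.

Lemma mean_cdot_expi c (a b : C) k n : (k < n)%N ->
  mean c (fun t => cdot (a * expi t ^+ k) (b * expi t ^+ n)) = 0.
Proof.
move=> kn; rewrite -(@mean_re_expi c (cj a * b) (n - k)) ?subn_gt0//.
apply: mean_ext => t.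
have -> : b * expi t ^+ n = (b * expi t ^+ (n - k)) * expi t ^+ k.
  by rewrite -mulrA -exprD subnK// ltnW.
rewrite cdotM_unit ?cmodX ?cmod_expi ?expr1n//.
by rewrite -[a]mulr1 cdotZl cdot1r mulr1 mulrA.
Qed.

Lemma psum_circ a N r t : psum a N (rc r * expi t) = \sum_(k < N) (a k * rc r ^+ k) * expi t ^+ k.
Proof. by apply: eq_bigr => k _; rewrite exprMn mulrA. Qed.

Lemma cont_sum N (u : nat -> R -> R) : (forall k, continuous (u k)) ->
  continuous (fun t => \sum_(k < N) u k t).
Proof.
move=> cu; elim: N => [|N ih]; first by under eq_fun do rewrite big_ord0; exact: cont_cst.
by under eq_fun do rewrite big_ord_recr/=; apply: contD; [exact: ih|exact: cu].
Qed.

Lemma cont_re_psum a N r : continuous (fun t => re (psum a N (rc r * expi t))).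
Proof.
under eq_fun do rewrite psum_circ (re_sum _ (fun k => (a k * rc r ^+ k) * expi _ ^+ k)).
by apply: (@cont_sum N (fun k t => re ((a k * rc r ^+ k) * expi t ^+ k))) => k; exact: cont_re_expi.
Qed.

Lemma cont_im_psum a N r : continuous (fun t => im (psum a N (rc r * expi t))).
Proof.
under eq_fun do rewrite psum_circ (im_sum _ (fun k => (a k * rc r ^+ k) * expi _ ^+ k)).
by apply: (@cont_sum N (fun k t => im ((a k * rc r ^+ k) * expi t ^+ k))) => k; exact: cont_im_expi.
Qed.

Lemma mean_sum c N (u : nat -> R -> R) : (forall k, continuous (u k)) ->
  mean c (fun t => \sum_(k < N) u k t) = \sum_(k < N) mean c (u k).
Proof.
move=> cu; elim: N => [|N ih].
  by under eq_fun do rewrite big_ord0; rewrite mean_cst big_ord0.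
by under eq_fun do rewrite big_ord_recr/=; rewrite meanD ?ih ?big_ord_recr//; exact: cont_sum.
Qed.

Lemma cont_cmod2 (p : R -> C) : continuous (re \o p) -> continuous (im \o p) ->
  continuous (fun t => cmod (p t) ^+ 2).
Proof.
move=> c1 c2; under eq_fun do rewrite cmod_sq !expr2.
by apply: contD; apply: contM; (exact: c1 || exact: c2).
Qed.

Lemma cont_cdot (p q : R -> C) : continuous (re \o p) -> continuous (im \o p) ->
  continuous (re \o q) -> continuous (im \o q) ->
  continuous (fun t => cdot (p t) (q t)).
Proof.
move=> c1 c2 d1 d2; rewrite /cdot.
by apply: contD; apply: contM; (exact: c1 || exact: c2 || exact: d1 || exact: d2).
Qed.

Lemma cdot_suml n (p : nat -> C) (b : C) : cdot (\sum_(k < n) p k) b = \sum_(k < n) cdot (p k) b.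
Proof.
elim: n => [|n ih]; rewrite ?big_ord0 ?big_ord_recr/= ?cdotDl ?ih//.
by rewrite /cdot !reimE; ring.
Qed.

Lemma cmod_sqD z w : cmod (z + w) ^+ 2 = cmod z ^+ 2 + cmod w ^+ 2 + 2 * cdot z w.
Proof. by rewrite !cmod_sq /cdot !reimE; ring. Qed.

Lemma parseval_psum c a N r :
  mean c (fun t => cmod (psum a N (rc r * expi t)) ^+ 2) =
  \sum_(k < N) cmod (a k) ^+ 2 * r ^+ (2 * k).
Proof.
elim: N => [|N ih].
  by under eq_fun do rewrite /psum big_ord0 cmod0 expr0n/=; rewrite mean_cst big_ord0.
have E t : cmod (psum a N.+1 (rc r * expi t)) ^+ 2 =
   (cmod (psum a N (rc r * expi t)) ^+ 2 + cmod (a N) ^+ 2 * r ^+ (2 * N)) +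
   2 * \sum_(k < N) cdot ((a k * rc r ^+ k) * expi t ^+ k) ((a N * rc r ^+ N) * expi t ^+ N).
  rewrite !psum_circ big_ord_recr/= cmod_sqD; congr (_ + _ + _).
    by rewrite !cmodM !cmodX cmod_expi cmod_rc expr1n mulr1 exprMn -exprM mulnC [in RHS]exprM -[in RHS](real_normK (num_real r)) -exprM.
  by congr (_ * _); rewrite (cdot_suml _ (fun k => a k * rc r ^+ k * expi t ^+ k)).
under eq_fun do rewrite E.
have cc k : continuous (fun t => cdot ((a k * rc r ^+ k) * expi t ^+ k) ((a N * rc r ^+ N) * expi t ^+ N)).
  by apply: cont_cdot; [exact: cont_re_expi|exact: cont_im_expi|exact: cont_re_expi|exact: cont_im_expi].
have cs : continuous (fun t => \sum_(k < N) cdot ((a k * rc r ^+ k) * expi t ^+ k) ((a N * rc r ^+ N) * expi t ^+ N)).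
  exact: (@cont_sum N (fun k t => cdot ((a k * rc r ^+ k) * expi t ^+ k) ((a N * rc r ^+ N) * expi t ^+ N))).
have cp : continuous (fun t => cmod (psum a N (rc r * expi t)) ^+ 2).
  by apply: cont_cmod2; [exact: cont_re_psum|exact: cont_im_psum].
rewrite meanD; last 2 first.
- by apply: contD => //; exact: cont_cst.
- by apply: contM => //; exact: cont_cst.
rewrite meanD//; last exact: cont_cst.
rewrite mean_cst ih meanZ//.
rewrite (@mean_sum c N (fun k t => cdot ((a k * rc r ^+ k) * expi t ^+ k) ((a N * rc r ^+ N) * expi t ^+ N)))//.
rewrite [X in _ + 2 * X]big1 ?mulr0 ?addr0 ?big_ord_recr//= => k _.
by rewrite mean_cdot_expi.
Qed.

End CircleMeans.
#[export] Hint Resolve measurable_arc : core.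

(** * Analytic functions on the disc *)

Section Analytic.
Context {R : realType}.
Notation C := (Cplx R).
Implicit Types (f g : C -> C) (a b : nat -> C) (z w : C) (r x c t e B : R) (n k N : nat).

(* Locally uniform convergence on the disc. *)
Definition lucv (F : nat -> C -> C) f := forall r, 0 <= r < 1 -> forall e, 0 < e ->
  exists N0, forall N z, (N0 <= N)%N -> cmod z <= r -> cmod (f z - F N z) <= e.

Lemma taylor_lucv f a : taylor_expansion f a -> lucv (psum a) f.
Proof. by move=> h r r01; exact: taylor_unif. Qed.

Lemma le_disc z r : cmod z <= r -> r < 1 -> disc z.
Proof. by move=> h1 h2; rewrite cmod_lt_disc; exact: le_lt_trans h2. Qed.

Lemma cmod_circ r t : 0 <= r -> cmod (rc r * expi t) = r.
Proof. by move=> r0; rewrite cmodM cmod_expi cmod_rc mulr1 ger0_norm. Qed.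

Lemma circ_disc r t : 0 <= r < 1 -> disc (rc r * expi t).
Proof. by case/andP => r0 r1; rewrite cmod_lt_disc cmod_circ. Qed.

Lemma psum_bdd a N z : cmod z <= 1 -> cmod (psum a N z) <= \sum_(k < N) cmod (a k).
Proof.
move=> z1; apply: le_trans (cmod_sum _ (fun k => a k * z ^+ k)) _.
apply: ler_sum => k _; rewrite cmodM cmodX -[leRHS]mulr1 ler_wpM2l// exprn_ile1//.
Qed.

Lemma taylor_bdd f a r : taylor_expansion f a -> 0 <= r < 1 ->
  exists B, 0 <= B /\ forall z, cmod z <= r -> cmod (f z) <= B.
Proof.
move=> h r01; have [N HN] := taylor_lucv h r01 ltr01.
have [r0 r1] := andP r01.
exists (1 + \sum_(k < N) cmod (a k)); split.
  by rewrite addr_ge0// sumr_ge0.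
move=> z zr; have h1 := HN N z (leqnn _) zr.
have h2 := psum_bdd a N (le_trans zr (ltW r1)).
have := cmodD (f z - psum a N z) (psum a N z); rewrite subrK; lra.
Qed.

Lemma taylor_cont_re f a r : taylor_expansion f a -> 0 <= r < 1 ->
  continuous (fun t => re (f (rc r * expi t))).
Proof.
move=> h r01; apply: (@unif_continuous _ _ (fun N t => re (psum a N (rc r * expi t)))) => [N|e e0].
  exact: cont_re_psum.
have [N0 HN] := taylor_lucv h r01 e0; exists N0 => n t Nn.
have [r0 r1] := andP r01.
by rewrite -reB; apply: le_trans (abs_re_le _) _; apply: HN => //; rewrite cmod_circ.
Qed.

Lemma taylor_cont_im f a r : taylor_expansion f a -> 0 <= r < 1 ->
  continuous (fun t => im (f (rc r * expi t))).
Proof.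
move=> h r01; apply: (@unif_continuous _ _ (fun N t => im (psum a N (rc r * expi t)))) => [N|e e0].
  exact: cont_im_psum.
have [N0 HN] := taylor_lucv h r01 e0; exists N0 => n t Nn.
have [r0 r1] := andP r01.
by rewrite -imB; apply: le_trans (abs_im_le _) _; apply: HN => //; rewrite cmod_circ.
Qed.

Lemma taylor_cont_cmod2 f a r : taylor_expansion f a -> 0 <= r < 1 ->
  continuous (fun t => cmod (f (rc r * expi t)) ^+ 2).
Proof.
by move=> h r01; apply: cont_cmod2; [exact: taylor_cont_re h r01|exact: taylor_cont_im h r01].
Qed.

Lemma cmod_sqB_le z w B e : 0 <= e -> e <= 1 -> cmod z <= B -> cmod (z - w) <= e ->
  `|cmod z ^+ 2 - cmod w ^+ 2| <= e * (2 * B + 1).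
Proof.
move=> e0 e1 zB zw.
have h1 := cmodD (z - w) w; rewrite subrK in h1.
have h2 := cmodB z (z - w); rewrite opprB addrC subrK in h2.
rewrite subr_sqr normrM.
have h3 : `|cmod z - cmod w| <= e by rewrite ler_norml; apply/andP; split; lra.
have h4 : `|cmod z + cmod w| <= 2 * B + 1.
  by rewrite ger0_norm ?addr_ge0//; lra.
by apply: ler_pM.
Qed.

Lemma parseval f a r c : taylor_expansion f a -> 0 <= r < 1 ->
  series (fun n => cmod (a n) ^+ 2 * r ^+ (2 * n)) @ \oo -->
  mean c (fun t => cmod (f (rc r * expi t)) ^+ 2).
Proof.
move=> h r01; have [r0 r1] := andP r01.
have -> : series (fun n => cmod (a n) ^+ 2 * r ^+ (2 * n)) =
    (fun N => mean c (fun t => cmod (psum a N (rc r * expi t)) ^+ 2)).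
  by apply/funext => N; rewrite parseval_psum seriesEnat/= big_mkord.
apply: mean_unif; first exact: taylor_cont_cmod2 h r01.
  by move=> n; apply: cont_cmod2; [exact: cont_re_psum|exact: cont_im_psum].
move=> e e0; have [B [B0 HB]] := taylor_bdd h r01.
(* By [cmod_sqB_le], an error d <= 1 in [f] costs at most d (2 B + 1) in |f|^2. *)
pose d := Num.min 1 (e / (2 * B + 1)).
have B1 : 0 < 2 * B + 1 by lra.
have d0 : 0 < d by rewrite lt_min ltr01 divr_gt0.
have [N0 HN] := taylor_lucv h r01 d0; exists N0 => n t Nn.
have cr : cmod (rc r * expi t) <= r by rewrite cmod_circ.
have d1 : d <= 1 by rewrite ge_min lexx.
apply: le_trans (cmod_sqB_le (ltW d0) d1 (HB _ cr) (HN _ _ Nn cr)) _.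
by rewrite -ler_pdivlMr// ge_min lexx orbT.
Qed.

(** Cauchy's estimate without contour integrals: the square of the left side is one term of the
    Parseval sum, whose total is the mean of |f|^2 over the circle. *)
Lemma cauchy_est f a r B n : taylor_expansion f a -> 0 <= r < 1 ->
  (forall z, cmod z <= r -> cmod (f z) <= B) -> cmod (a n) * r ^+ n <= B.
Proof.
move=> h r01 HB; have [r0 r1] := andP r01.
have B0 : 0 <= B by apply: le_trans (HB 0 _) => //; rewrite cmod0.
rewrite -ler_sqr ?nnegrE ?mulr_ge0 ?exprn_ge0//.
have cv := @parseval f a r 0 h r01.
have u0 k : 0 <= cmod (a k) ^+ 2 * r ^+ (2 * k).
  by rewrite mulr_ge0 ?exprn_ge0.
have h1 : cmod (a n) ^+ 2 * r ^+ (2 * n) <= limn (series (fun n => cmod (a n) ^+ 2 * r ^+ (2 * n))).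
  apply: le_trans (nneg_series_le_lim n.+1 u0 _); last by apply/cvg_ex; eexists; exact: cv.
  by rewrite seriesSr lerDr seriesEnat/=; apply: sumr_ge0 => k _; exact: u0.
rewrite exprMn -exprM mulnC; apply: le_trans h1 _.
rewrite (cvg_lim _ cv)// -(mean_cst 0 (B ^+ 2)); apply: mean_le.
- exact: taylor_cont_cmod2 h r01.
- exact: cont_cst.
- by move=> t; rewrite le_expn2// HB// cmod_circ.
Qed.

Lemma taylorD f g a b : taylor_expansion f a -> taylor_expansion g b ->
  taylor_expansion (fun z => f z + g z) (fun n => a n + b n).
Proof.
move=> h1 h2 z zD.
have -> : series (fun n => (a n + b n) * z ^+ n) =
   (fun n => series (fun n => a n * z ^+ n) n + series (fun n => b n * z ^+ n) n).
  apply/funext => n; rewrite !seriesEnat/= -big_split/=; apply: eq_bigr => k _.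
  by rewrite mulrDl.
by apply: cvgD; [exact: h1|exact: h2].
Qed.

Lemma taylorZ f a w : taylor_expansion f a ->
  taylor_expansion (fun z => w * f z) (fun n => w * a n).
Proof.
move=> h1 z zD.
have -> : series (fun n => (w * a n) * z ^+ n) = (fun n => w * series (fun n => a n * z ^+ n) n).
  apply/funext => n; rewrite !seriesEnat/= mulr_sumr; apply: eq_bigr => k _.
  by rewrite mulrA.
by apply: cvgM; [exact: cvg_cst|exact: h1].
Qed.

Lemma taylorB f g a b : taylor_expansion f a -> taylor_expansion g b ->
  taylor_expansion (fun z => f z - g z) (fun n => a n - b n).
Proof.
move=> h1 /(@taylorZ _ _ (-1)) h2; have := taylorD h1 h2.
rewrite (_ : (fun z => f z + -1 * g z) = (fun z => f z - g z)); last first.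
  by apply/funext => z; rewrite mulN1r.
by rewrite (_ : (fun n => a n + -1 * b n) = (fun n => a n - b n))//; apply/funext => n; rewrite mulN1r.
Qed.

Lemma taylor_ext f g a : (forall z, disc z -> f z = g z) ->
  taylor_expansion f a -> taylor_expansion g a.
Proof. by move=> fg h z zD; rewrite -fg//; exact: h. Qed.

Lemma half01 : 0 <= (2^-1 : R) < 1. Proof. by apply/andP; split; lra. Qed.

(** [cauchy_est] with bound 0 for the zero function f - f, expanded by a - b. *)
Lemma taylor_unique f a b : taylor_expansion f a -> taylor_expansion f b -> a = b.
Proof.
move=> h1 h2; apply/funext => n; apply/eqP; rewrite -subr_eq0; apply/eqP.
apply: cmod_eq0; apply/eqP; rewrite eq_le cmod_ge0 andbT.
have h := taylorB h1 h2.
have /(_ _) := @cauchy_est _ _ 2^-1 0 n h half01.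
rewrite pmulr_lle0 ?exprn_gt0// ; apply => z _; by rewrite subrr cmod0.
Qed.

Lemma taylor_coefE f a : taylor_expansion f a -> taylor_coef f = a.
Proof.
move=> h; apply: (@taylor_unique f) => //.
by rewrite /taylor_coef; apply: (@getPex _ [set a | taylor_expansion f a]); exists a.
Qed.

Lemma taylor_coefP f : analytic f -> taylor_expansion f (taylor_coef f).
Proof. by move=> [a h]; rewrite (taylor_coefE h). Qed.

Lemma taylor_coef_ext f g : (forall z, disc z -> f z = g z) -> taylor_coef f = taylor_coef g.
Proof.
move=> fg; rewrite /taylor_coef.
have E : [set a | taylor_expansion f a] = [set a | taylor_expansion g a].
  by apply/seteqP; split => a /=; apply: taylor_ext => z /fg.
exact: (congr1 (fun S : set (nat -> C) => get S) E).
Qed.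

Definition ana f : Prop := locked (@analytic R) f.

Lemma ana_def f : analytic f = ana f. Proof. by rewrite /ana -lock. Qed.

Lemma ana_ex f : ana f -> exists a, taylor_expansion f a. Proof. by rewrite -ana_def. Qed.

Lemma anaI f a : taylor_expansion f a -> ana f.
Proof. by rewrite -ana_def; exists a. Qed.

Definition co f : nat -> C := locked (@taylor_coef R) f.

Lemma co_def f : taylor_coef f = co f. Proof. by rewrite /co -lock. Qed.

Lemma coE f a : taylor_expansion f a -> co f = a.
Proof. by rewrite -co_def; exact: taylor_coefE. Qed.

Lemma coP f : ana f -> taylor_expansion f (co f).
Proof. by rewrite -co_def -ana_def; exact: taylor_coefP. Qed.

Lemma co_ext f g : (forall z, disc z -> f z = g z) -> co f = co g.
Proof. by rewrite -!co_def; exact: taylor_coef_ext. Qed.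

Lemma analytic_ext f g : (forall z, disc z -> f z = g z) -> ana f -> ana g.
Proof. by move=> fg /ana_ex[a h]; apply: (@anaI _ a); exact: taylor_ext h. Qed.

Lemma taylor_lim_coef F (A : nat -> nat -> C) f a n : (forall N, taylor_expansion (F N) (A N)) ->
  taylor_expansion f a -> lucv F f -> (fun N => A N n) @ \oo --> a n.
Proof.
move=> hF hf hc; apply/cvgCP => e e0.
(* The factor 2^-n cancels the r^n that [cauchy_est] carries at radius 1/2. *)
have e2 : 0 < e / 2 * 2^-1 ^+ n by rewrite mulr_gt0 ?divr_gt0// exprn_gt0// invr_gt0.
have [N0 HN] := hc _ half01 _ e2; exists N0 => // N /= NN.
have := @cauchy_est _ _ 2^-1 (e / 2 * 2^-1 ^+ n) n (taylorB hf (hF N)) half01.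
rewrite ler_pM2r ?exprn_gt0// ?invr_gt0//; move=> H.
have : cmod (a n - A N n) <= e / 2 by apply: H => z; exact: HN.
lra.
Qed.

Lemma geo_sum_le x n : 0 <= x < 1 -> \sum_(k < n) x ^+ k <= (1 - x)^-1.
Proof.
case/andP=> x0 x1; have x1' : 0 < 1 - x by rewrite subr_gt0.
rewrite -(ler_pM2l x1') mulfV ?gt_eqF//.
have -> : (1 - x) * \sum_(k < n) x ^+ k = 1 - x ^+ n.
  by rewrite -[RHS]opprB subrX1 -mulNr opprB.
by rewrite lerBlDr lerDl exprn_ge0.
Qed.

(** By [cauchy_est] the coefficients of [F N] form a Cauchy sequence, with an estimate weighted by
    r^n that is uniform in the index n. Their limits are then shown to sum to [f]. *)
Lemma weierstrass F f : (forall N, ana (F N)) -> lucv F f -> ana f.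
Proof.
move=> /(_ _)/coP hF hc.
set A := fun N => co (F N).
have dif r e : 0 < r < 1 -> 0 < e -> exists N0, forall N M n, (N0 <= N)%N -> (N0 <= M)%N ->
    cmod (A N n - A M n) * r ^+ n <= e.
  case/andP=> r0 r1 e0; have r01 : 0 <= r < 1 by rewrite ltW.
  have e2 : 0 < e / 2 by rewrite divr_gt0.
  have [N0 HN] := hc _ r01 _ e2; exists N0 => N M n NN NM.
  apply: (cauchy_est _ (taylorB (hF N) (hF M)) r01) => z zr.
  have h1 := HN N z NN zr; have h2 := HN M z NM zr.
  have := cmodBD (F N z) (F M z) (f z); rewrite [cmod (F N z - f z)]cmodBC; lra.
have half01' : 0 < (2^-1 : R) < 1 by apply/andP; split; lra.
have ex n : exists l : C, (fun N => A N n) @ \oo --> l.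
  apply: cvgC_cauchy => e e0.
  have p0 : 0 < (2^-1 : R) ^+ n by rewrite exprn_gt0// invr_gt0.
  have e2 : 0 < e / 2 * 2^-1 ^+ n by rewrite mulr_gt0 ?divr_gt0.
  have [N0 HN] := dif _ _ half01' e2; exists N0 => N NN.
  have := HN N0 N n (leqnn _) NN; rewrite ler_pM2r//; lra.
have [a ha] := @choice _ _ _ ex.
have lim_dif r e : 0 < r < 1 -> 0 < e -> exists N0, forall N n, (N0 <= N)%N ->
    cmod (a n - A N n) * r ^+ n <= e.
  move=> r01 e0; have [N0 HN] := dif _ _ r01 e0; exists N0 => N n NN.
  have [r0 r1] := andP r01.
  have cl : (fun M => cmod (A M n - A N n) * r ^+ n) @ \oo --> cmod (a n - A N n) * r ^+ n.
    apply: cvgM; last exact: cvg_cst.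
    apply: (cvg_cmod (f := fun M => A M n - A N n)).
    by apply: cvgB; [exact: ha|exact: cvg_cst].
  rewrite -(cvg_lim _ cl)//; apply: limr_le; first by apply/cvg_ex; eexists; exact: cl.
  by exists N0 => // M /= NM; exact: HN.
apply: (@anaI _ a) => z zD; rewrite -psum_series; apply/cvgCP => e e0.
pose r := (1 + cmod z) / 2.
have z1 : cmod z < 1 by [].
have z0 := cmod_ge0 z.
have r01 : 0 < r < 1 by rewrite /r; apply/andP; split; lra.
have [r0 r1] := andP r01.
have zr : cmod z < r by rewrite /r; lra.
pose q := cmod z / r.
have q01 : 0 <= q < 1 by rewrite /q divr_ge0 ?(ltW r0)//= ltr_pdivrMr// mul1r.
have q1 : 0 < 1 - q by rewrite subr_gt0; case/andP: q01.
(* The coefficient errors at [z] are bounded by a geometric series of ratio q = |z|/r, whose sum is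
   at most 1/(1 - q); the factor 1 - q absorbs it. *)
have e3 : 0 < e / 4 * (1 - q) by rewrite mulr_gt0// divr_gt0.
have e4 : 0 < e / 4 by rewrite divr_gt0.
have [N1 H1] := lim_dif _ _ r01 e3.
have r01' : 0 <= r < 1 by rewrite ltW.
have [N2 H2] := hc _ r01' _ e4.
pose N := maxn N1 N2.
have h2 := H2 N z (leq_maxr _ _) (ltW zr).
have /cvgCP/(_ _ e4)[M _ HM] := taylor_cvgE (hF N) zD.
exists M => // K /= MK.
have h3 := HM _ MK.
have h1 : cmod (psum (A N) K z - psum a K z) <= e / 4.
  rewrite /psum -sumrB.
  under eq_bigr do rewrite -mulrBl.
  apply: le_trans (cmod_sum _ (fun k => (A N k - a k) * z ^+ k)) _.
  apply: (@le_trans _ _ (\sum_(k < K) (e / 4 * (1 - q)) * q ^+ k)).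
    apply: ler_sum => k _; rewrite cmodM cmodX cmodBC.
    have -> : cmod z ^+ k = r ^+ k * q ^+ k by rewrite -exprMn mulrC divfK// gt_eqF.
    rewrite mulrA ler_wpM2r ?exprn_ge0//; first by case/andP: q01.
    by apply: H1; rewrite leq_maxl.
  rewrite -mulr_sumr -mulrA ler_piMr ?(ltW e4)//.
  by rewrite mulrC -ler_pdivlMr// mul1r geo_sum_le.
have h4 := cmodBD (f z) (psum a K z) (F N z).
have h5 := cmodBD (F N z) (psum a K z) (psum (A N) K z).
rewrite /= in h3; lra.
Qed.

Lemma taylor_shift f a : taylor_expansion f a ->
  taylor_expansion (fun z => z * f z) (fun n => if n is k.+1 then a k else 0).
Proof.
move=> h z zD; rewrite -cvg_shiftS.
have -> : (fun n => series (fun n => (if n is k.+1 then a k else 0) * z ^+ n) n.+1) =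
    (fun n => z * series (fun n => a n * z ^+ n) n).
  apply/funext => n; rewrite !seriesEnat/= big_nat_recl//= mul0r add0r mulr_sumr.
  by apply: eq_bigr => k _; rewrite exprS mulrCA.
by apply: cvgM; [exact: cvg_cst|exact: h].
Qed.

Lemma taylor_psum a N : taylor_expansion (psum a N) (fun n => if (n < N)%N then a n else 0).
Proof.
move=> z zD; apply: cvg_near_cst; exists N => // n /= Nn.
rewrite /psum seriesEnat/= (big_cat_nat (n := N))//= [X in _ + X]big_nat [X in _ + X]big1 ?addr0.
  by rewrite big_mkord; apply: eq_bigr => k _; rewrite ltn_ord.
by move=> i /andP[Ni _]; rewrite ltnNge Ni mul0r.
Qed.

Lemma taylor_cst w : taylor_expansion (fun=> w) (fun n => if n is 0%N then w else 0).
Proof.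
have := @taylor_psum (fun=> w) 1.
rewrite (_ : psum _ 1 = fun=> w); last first.
  by apply/funext => z; rewrite /psum big_ord_recl big_ord0 expr0 mulr1 addr0.
by congr taylor_expansion; apply/funext => -[].
Qed.

Lemma taylor_unshift f a : taylor_expansion f a ->
  exists2 g, taylor_expansion g (fun n => a n.+1) & forall z, disc z -> f z = a 0%N + z * g z.
Proof.
move=> h; have ha := taylor_radc h.
have [|g hg] := @radc_taylor _ (fun n => a n.+1).
  (* The radius (1 + r)/2 is at least [r] and, unlike [r], never 0, so one power of it can be
     divided out. *)
  move=> r r01; have [M HM] := ha ((1 + r) / 2) ltac:(by case/andP: r01 => r0 r1; apply/andP; split; lra).
  have [r0 r1] := andP r01.
  have s0 : 0 < (1 + r) / 2 by lra.
  exists (M / ((1 + r) / 2)) => n; rewrite ler_pdivlMr//; apply: le_trans (HM n.+1).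
  rewrite exprSr mulrA ler_wpM2r ?ler_wpM2l ?le_expn2//; lra.
exists g => // z zD.
have h1 := taylorD (@taylor_cst (a 0%N)) (taylor_shift hg).
have e : (fun n => (if n is 0%N then a 0%N else 0) + (if n is k.+1 then a k.+1 else 0)) = a.
  by apply/funext => -[|n]; rewrite ?addr0 ?add0r.
rewrite e in h1.
exact: (cvgC_unique (h _ zD) (h1 _ zD)).
Qed.

Lemma taylor0 f a : taylor_expansion f a -> f 0 = a 0%N.
Proof.
by move=> /taylor_unshift[g _ /(_ 0)] ->; rewrite ?mul0r ?addr0// cmod_lt_disc cmod0.
Qed.

Lemma analyticD f g : ana f -> ana g -> ana (fun z => f z + g z).
Proof. by move=> /ana_ex[a h1] /ana_ex[b h2]; apply: anaI; exact: taylorD h1 h2. Qed.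
Lemma analyticB f g : ana f -> ana g -> ana (fun z => f z - g z).
Proof. by move=> /ana_ex[a h1] /ana_ex[b h2]; apply: anaI; exact: taylorB h1 h2. Qed.
Lemma analyticZ f w : ana f -> ana (fun z => w * f z).
Proof. by move=> /ana_ex[a h1]; apply: anaI; exact: taylorZ h1. Qed.
Lemma analytic_cst w : ana (fun=> w).
Proof. by apply: anaI; exact: taylor_cst. Qed.
Lemma analytic_psum a N : ana (psum a N).
Proof. by apply: anaI; exact: taylor_psum. Qed.
Lemma analytic_shift f : ana f -> ana (fun z => z * f z).
Proof. by move=> /ana_ex[a h]; apply: anaI; exact: taylor_shift h. Qed.
Lemma analytic_shiftn f n : ana f -> ana (fun z => z ^+ n * f z).
Proof.
move=> h; elim: n => [|n ih]; first by under eq_fun do rewrite expr0 mul1r.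
by under eq_fun do rewrite exprS -mulrA; exact: analytic_shift.
Qed.
Lemma analytic_sum N (F : nat -> C -> C) : (forall k, ana (F k)) ->
  ana (fun z => \sum_(k < N) F k z).
Proof.
move=> h; elim: N => [|N ih]; first by under eq_fun do rewrite big_ord0; exact: analytic_cst.
by under eq_fun do rewrite big_ord_recr/=; exact: (analyticD ih (h N)).
Qed.

Lemma analytic_psumM a N g : ana g -> ana (fun z => psum a N z * g z).
Proof.
move=> h; rewrite /psum; under eq_fun do rewrite mulr_suml.
apply: (@analytic_sum N (fun k z => a k * z ^+ k * g z)) => k.
by under eq_fun do rewrite -mulrA; apply/analyticZ/analytic_shiftn.
Qed.

Lemma lucvM F f g : lucv F f -> ana g -> lucv (fun N z => F N z * g z) (fun z => f z * g z).
Proof.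
move=> hF /ana_ex[b hg] r r01 e e0.
have [B [B0 HB]] := taylor_bdd hg r01.
have B1 : 0 < B + 1 by lra.
have e1 : 0 < e / (B + 1) by rewrite divr_gt0.
have [N0 HN] := hF _ r01 _ e1; exists N0 => N z NN zr.
rewrite -mulrBl cmodM; have := HB z zr; have := HN N z NN zr => h1 h2.
apply: (@le_trans _ _ (e / (B + 1) * (B + 1))); last by rewrite divfK// gt_eqF.
by apply: ler_pM => //; lra.
Qed.

(** No Cauchy product: a polynomial times [g] is a finite combination of shifts of [g], and
    [weierstrass] passes to the limit. *)
Lemma analyticM f g : ana f -> ana g -> ana (fun z => f z * g z).
Proof.
move=> /ana_ex[a h] hg; apply: weierstrass (lucvM (taylor_lucv h) hg) => N.
exact: analytic_psumM.
Qed.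

Lemma analyticX f n : ana f -> ana (fun z => f z ^+ n).
Proof.
move=> h; elim: n => [|n ih]; first by under eq_fun do rewrite expr0; exact: analytic_cst.
by under eq_fun do rewrite exprS; exact: analyticM.
Qed.

(** Closed discs must go into closed discs of radius below 1: this is what carries locally uniform
    convergence through composition. [iso_selfmap] and [mob_selfmap] provide it. *)
Definition selfmap (psi : C -> C) :=
  ana psi /\ forall r, 0 <= r < 1 -> exists2 s, 0 <= s < 1 & forall z, cmod z <= r -> cmod (psi z) <= s.

Lemma lucv_comp F f psi : selfmap psi -> lucv F f -> lucv (fun N z => F N (psi z)) (fun z => f (psi z)).
Proof.
move=> [_ hs] hF r r01 e e0; have [s s01 Hs] := hs _ r01.
by have [N0 HN] := hF _ s01 _ e0; exists N0 => N z NN zr; apply: HN => //; exact: Hs.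
Qed.

Lemma analytic_comp f psi : ana f -> selfmap psi -> ana (fun z => f (psi z)).
Proof.
move=> /ana_ex[a h] hs; apply: weierstrass (lucv_comp hs (taylor_lucv h)) => N.
apply: (@analytic_sum N (fun k z => a k * psi z ^+ k)) => k.
by apply/analyticZ/analyticX; case: hs.
Qed.

Lemma selfmap_disc psi z : selfmap psi -> disc z -> disc (psi z).
Proof.
move=> [_ h] zD; have [|s /andP[s0 s1] /(_ z (lexx _))] := h (cmod z).
  by rewrite cmod_ge0.
by move=> /le_lt_trans; apply.
Qed.

Lemma psum_cont a N : continuous (psum a N).
Proof.
move=> z; rewrite /psum; elim: N => [|N ih].
  by under eq_fun do rewrite big_ord0; exact: cst_continuous.
under eq_fun do rewrite big_ord_recr/=.
have h : continuous_at z (fun z : C => a N * z ^+ N).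
  apply: (@continuousM C C (fun=> a N) (fun z => z ^+ N)); first exact: cst_continuous.
  suff : continuous_at z (fun z : C => z ^+ N) by [].
  elim: {ih} N => [|N ih].
    by rewrite (_ : (fun z : C => z ^+ 0) = fun=> 1); [exact: cst_continuous|apply/funext => y; rewrite expr0].
  rewrite (_ : (fun z : C => z ^+ N.+1) = fun z => z * z ^+ N); last by apply/funext => y; rewrite exprS.
  exact: (@continuousM C C id (fun z => z ^+ N) z (@cvg_id _ _) ih).
exact: (@continuousD C C C (fun z => \sum_(k < N) a k * z ^+ k) (fun z => a N * z ^+ N) z ih h).
Qed.

Lemma lt_tri3 (A B1 B2 D1 D2 e : R) : 0 < e -> A <= B1 + D1 -> D1 <= D2 + B2 ->
  B1 <= e / 4 -> B2 <= e / 4 -> D2 < e / 4 -> A < e.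
Proof. move=> *; lra. Qed.

Lemma analytic_cont f z : ana f -> disc z -> f @ z --> f z.
Proof.
move=> /ana_ex[a h] zD; apply/(cvgCP (FF := nbhs_filter (z : C))) => e e0.
pose r := (1 + cmod z) / 2.
have z1 : cmod z < 1 by [].
have z0 := cmod_ge0 z.
have r01 : 0 <= r < 1 by rewrite /r; apply/andP; split; lra.
have d0 : 0 < (1 - cmod z) / 2 by lra.
have e4 : 0 < e / 4 by rewrite divr_gt0.
have [N HN] := taylor_lucv h r01 e4.
have /cvgCP/(_ _ e4) h1 := @psum_cont a N z.
have /cvgCP/(_ _ d0) h2 : id @ z --> z by exact: cvg_id.
have key (w : C) : cmod (z - w) < (1 - cmod z) / 2 ->
    cmod (psum a N z - psum a N w) < e / 4 -> cmod (f z - f w) < e.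
  move=> w1 w2.
  have w3 : cmod w <= r by have := cmodB z (z - w); rewrite opprB addrC subrK /r; lra.
  have w4 : cmod z <= r by rewrite /r; lra.
  have k1 := HN N z (leqnn _) w4.
  have k2 := HN N w (leqnn _) w3.
  apply: (lt_tri3 e0 (cmodBD (f z) (f w) (psum a N z)) (cmodBD _ _ (psum a N w)) k1 _ w2).
  by rewrite cmodBC.
exact: filterS2 key h2 h1.
Qed.

End Analytic.
#[global] Opaque ana taylor_expansion.

(** * The Hardy space and its isometric multipliers *)

Section HardySpace.
Context {R : realType}.
Notation C := (Cplx R).
Implicit Types (f g h : C -> C) (a b : nat -> C) (z w : C) (r x t e B : R) (n k N : nat).

(* [sqn] is the squared norm of H^2 and [rd] the real part of the inner product. *)
Definition sqs f n : R := locked (fun f n => cmod (co f n) ^+ 2) f n.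
Definition dts f g n : R := locked (fun f g n => cdot (co f n) (co g n)) f g n.
Definition sqn f : R := locked (fun f => tot (sqs f)) f.
Definition rd f g : R := locked (fun f g => tot (dts f g)) f g.

Lemma sqsE f n : sqs f n = cmod (co f n) ^+ 2. Proof. by rewrite /sqs -lock. Qed.
Lemma dtsE f g n : dts f g n = cdot (co f n) (co g n). Proof. by rewrite /dts -lock. Qed.
Lemma sqnE f : sqn f = tot (sqs f). Proof. by rewrite /sqn -lock. Qed.
Lemma rdE f g : rd f g = tot (dts f g). Proof. by rewrite /rd -lock. Qed.

Lemma sqs_ge0 f n : 0 <= sqs f n. Proof. by rewrite sqsE exprn_ge0. Qed.

Lemma coD f g n : ana f -> ana g ->
  co (fun z => f z + g z) n = co f n + co g n.
Proof. by move=> /coP h1 /coP h2; rewrite (coE (taylorD h1 h2)). Qed.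

Lemma coB f g n : ana f -> ana g ->
  co (fun z => f z - g z) n = co f n - co g n.
Proof. by move=> /coP h1 /coP h2; rewrite (coE (taylorB h1 h2)). Qed.

Lemma coZ f w n : ana f -> co (fun z => w * f z) n = w * co f n.
Proof. by move=> /coP h1; rewrite (coE (@taylorZ _ _ _ w h1)). Qed.

Lemma co_shift f n : ana f ->
  co (fun z => z * f z) n = if n is k.+1 then co f k else 0.
Proof. by move=> /coP h1; rewrite (coE (taylor_shift h1)). Qed.

Lemma co_psum a N n : co (psum a N) n = if (n < N)%N then a n else 0.
Proof. by rewrite (coE (@taylor_psum _ a N)). Qed.

Lemma co_cst w n : co (fun=> w) n = if n is 0%N then w else 0.
Proof. by rewrite (coE (@taylor_cst _ w)). Qed.

Lemma co0 f : ana f -> co f 0 = f 0.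
Proof. by move=> /coP/taylor0. Qed.

Lemma sqs_fun f : sqs f = (fun n => cmod (taylor_coef f n) ^+ 2).
Proof. by apply/funext => n; rewrite sqsE co_def. Qed.

Definition hardy f : Prop := locked (@H2 R) f.

Lemma hardy_def f : H2 f = hardy f. Proof. by rewrite /hardy -lock. Qed.

Lemma H2_analytic f : hardy f -> ana f.
Proof. by rewrite -hardy_def -ana_def => -[]. Qed.

Lemma H2_summ f : hardy f -> summ (sqs f).
Proof. by rewrite -hardy_def => -[_ h]; rewrite summE sqs_fun. Qed.

Lemma H2I f : ana f -> summ (sqs f) -> hardy f.
Proof. by rewrite -ana_def -hardy_def => h1 h2; split=> //; rewrite summE sqs_fun in h2. Qed.

Lemma H2normE f : H2norm f = Num.sqrt (sqn f).
Proof. by rewrite /H2norm sqnE totE sqs_fun. Qed.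

Lemma sqs_ext f g : (forall z, disc z -> f z = g z) -> sqs f = sqs g.
Proof. by move=> fg; apply/funext => n; rewrite !sqsE (co_ext fg). Qed.

Lemma dts_ext f f' g g' : (forall z, disc z -> f z = f' z) -> (forall z, disc z -> g z = g' z) ->
  dts f g = dts f' g'.
Proof. by move=> h1 h2; apply/funext => n; rewrite !dtsE (co_ext h1) (co_ext h2). Qed.

Lemma H2_ext f g : (forall z, disc z -> f z = g z) -> hardy f -> hardy g.
Proof.
move=> fg h; apply: H2I; first exact: analytic_ext fg (H2_analytic h).
by rewrite -(sqs_ext fg); exact: H2_summ.
Qed.

Lemma sqn_ext f g : (forall z, disc z -> f z = g z) -> sqn f = sqn g.
Proof. by move=> fg; rewrite !sqnE (sqs_ext fg). Qed.

Lemma rd_ext f f' g g' : (forall z, disc z -> f z = f' z) -> (forall z, disc z -> g z = g' z) ->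
  rd f g = rd f' g'.
Proof. by move=> h1 h2; rewrite !rdE (dts_ext h1 h2). Qed.

Lemma sq_cmodD z w : cmod (z + w) ^+ 2 <= 2 * cmod z ^+ 2 + 2 * cmod w ^+ 2.
Proof.
rewrite cmod_sqD; have /ler_normlP[_] := cdot_le z w.
by move: (cmod z ^+ 2) (cmod w ^+ 2) (cdot z w) => x y u; lra.
Qed.

Lemma H2D f g : hardy f -> hardy g -> hardy (fun z => f z + g z).
Proof.
move=> hf hg; have af := H2_analytic hf; have ag := H2_analytic hg.
apply: H2I; first exact: analyticD.
apply: (@summ_dom _ _ (fun n => 2 * sqs f n + 2 * sqs g n)).
  by move=> n; rewrite !sqsE coD// ger0_norm ?exprn_ge0// sq_cmodD.
by apply: summD; apply: summZ; apply: H2_summ.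
Qed.

Lemma sqsZ f w n : ana f -> sqs (fun z => w * f z) n = cmod w ^+ 2 * sqs f n.
Proof. by move=> af; rewrite !sqsE coZ// cmodM exprMn. Qed.

Lemma H2Z f w : hardy f -> hardy (fun z => w * f z).
Proof.
move=> hf; have af := H2_analytic hf; apply: H2I; first exact: analyticZ.
apply: (@eq_summ _ (fun n => cmod w ^+ 2 * sqs f n)); last exact/summZ/H2_summ.
by move=> n; rewrite sqsZ.
Qed.

Lemma H2B f g : hardy f -> hardy g -> hardy (fun z => f z - g z).
Proof.
move=> hf /(@H2Z _ (-1)) hg; apply: H2_ext (H2D hf hg) => z _.
by rewrite mulN1r.
Qed.

Lemma rd_summ f g : hardy f -> hardy g -> summ (dts f g).
Proof.
move=> /H2_summ hf /H2_summ hg.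
apply: (@summ_dom _ _ (fun n => 2^-1 * (sqs f n + sqs g n))).
  by move=> n; rewrite mulrC dtsE !sqsE; exact: cdot_le.
by apply: summZ; apply: summD.
Qed.

Lemma rdC f g : rd f g = rd g f.
Proof. by rewrite !rdE; apply: eq_tot => n; rewrite !dtsE cdotC. Qed.

Lemma rd_sq f : rd f f = sqn f.
Proof. by rewrite rdE sqnE; apply: eq_tot => n; rewrite dtsE sqsE cdot_sq. Qed.

Lemma rdDl f g h : hardy f -> hardy g -> hardy h -> rd (fun z => f z + g z) h = rd f h + rd g h.
Proof.
move=> hf hg hh; have af := H2_analytic hf; have ag := H2_analytic hg.
rewrite !rdE -totD; [|exact: rd_summ..].
by apply: eq_tot => n; rewrite !dtsE coD// cdotDl.
Qed.

Lemma rdZl f g w : hardy f -> hardy g -> rd (fun z => w * f z) g = rd f (fun z => cj w * g z).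
Proof.
move=> hf hg; have af := H2_analytic hf; have ag := H2_analytic hg.
by rewrite !rdE; apply: eq_tot => n; rewrite !dtsE !coZ// cdotZl.
Qed.

Lemma rdrl f g x : hardy f -> hardy g -> rd (fun z => rc x * f z) g = x * rd f g.
Proof.
move=> hf hg; have af := H2_analytic hf; rewrite !rdE -totZ; last exact: rd_summ.
by apply: eq_tot => n; rewrite !dtsE coZ// cdotrl.
Qed.

Lemma sqn_ge0 f : hardy f -> 0 <= sqn f.
Proof. by move=> /H2_summ h; rewrite sqnE; apply: tot_ge0 => // n; exact: sqs_ge0. Qed.

Lemma sqnZ f w : hardy f -> sqn (fun z => w * f z) = cmod w ^+ 2 * sqn f.
Proof.
move=> hf; have af := H2_analytic hf; rewrite !sqnE -totZ; last exact: H2_summ.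
by apply: eq_tot => n; rewrite sqsZ.
Qed.

Lemma rdrr f g x : hardy f -> hardy g -> rd f (fun z => rc x * g z) = x * rd f g.
Proof. by move=> hf hg; rewrite [LHS]rdC rdrl// [in LHS]rdC. Qed.

Lemma rcN1 : rc (-1) = -1 :> C. Proof. by apply: cpx_eq; rewrite !reimE ?oppr0. Qed.

Lemma rdBl f g h : hardy f -> hardy g -> hardy h -> rd (fun z => f z - g z) h = rd f h - rd g h.
Proof.
move=> hf hg hh; have hZ := H2Z (rc (-1)) hg.
have -> : rd f h - rd g h = rd f h + -1 * rd g h by rewrite mulN1r.
rewrite -(rdrl _ hg hh) -(rdDl hf hZ hh).
by apply: rd_ext => z _ //; rewrite rcN1 mulN1r.
Qed.

Lemma rdDr f g h : hardy f -> hardy g -> hardy h -> rd h (fun z => f z + g z) = rd h f + rd h g.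
Proof. by move=> hf hg hh; rewrite [LHS]rdC rdDl// (rdC f) (rdC g). Qed.

Lemma rdBr f g h : hardy f -> hardy g -> hardy h -> rd h (fun z => f z - g z) = rd h f - rd h g.
Proof. by move=> hf hg hh; rewrite [LHS]rdC rdBl// (rdC f) (rdC g). Qed.

Lemma sqnD f g : hardy f -> hardy g -> sqn (fun z => f z + g z) = sqn f + 2 * rd f g + sqn g.
Proof.
move=> hf hg; have hfg := H2D hf hg.
rewrite -[LHS]rd_sq rdDl// !rdDr// !rd_sq (rdC g f).
by move: (rd f g) (sqn f) (sqn g) => *; ring.
Qed.

Lemma sqnB f g : hardy f -> hardy g -> sqn (fun z => f z - g z) = sqn f - 2 * rd f g + sqn g.
Proof.
move=> hf hg; have hfg := H2B hf hg.
rewrite -[LHS]rd_sq rdBl// !rdBr// !rd_sq (rdC g f).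
by move: (rd f g) (sqn f) (sqn g) => *; ring.
Qed.

Lemma cauchy_schwarz f g : hardy f -> hardy g -> rd f g ^+ 2 <= sqn f * sqn g.
Proof.
move=> hf hg; have f0 := sqn_ge0 hf; have g0 := sqn_ge0 hg.
have key x : 0 <= sqn f - 2 * x * rd f g + x ^+ 2 * sqn g.
  have hZ := H2Z (rc x) hg.
  have := sqn_ge0 (H2B hf hZ).
  by rewrite sqnB// rdrr// sqnZ// cmod_rc real_normK ?num_real// mulrA.
move: (sqn f) (sqn g) (rd f g) f0 g0 key => u v q u0 v0 key.
have [v00|v00] := eqVneq v 0.
  rewrite v00 mulr0.
  (* With v = 0 the quadratic [key] is affine in x; if q is not 0, this x gives it the value -1. *)
  have := key ((u + 1) / (2 * q)); rewrite v00 mulr0 addr0.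
  have [->|d0] := eqVneq q 0; first by rewrite expr0n.
  have -> : 2 * ((u + 1) / (2 * q)) * q = u + 1 by field.
  lra.
have v1 : 0 < v by rewrite lt_def v00.
(* The minimiser of the quadratic. *)
have := key (q / v).
have -> : u - 2 * (q / v) * q + (q / v) ^+ 2 * v = (u * v - q ^+ 2) / v by field.
by rewrite pmulr_lge0 ?invr_gt0// subr_ge0.
Qed.

Lemma sqs_psum a N n : sqs (psum a N) n = if (n < N)%N then cmod (a n) ^+ 2 else 0.
Proof. by rewrite sqsE co_psum; case: ifP => // _; rewrite cmod0 expr0n. Qed.

Lemma H2_psum a N : hardy (psum a N).
Proof.
apply: H2I; first exact: analytic_psum.
have [|//] := @summ_finite _ (sqs (psum a N)) N.
by move=> n Nn; rewrite sqs_psum ltnNge Nn.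
Qed.

Lemma sqn_psum a N : sqn (psum a N) = \sum_(k < N) cmod (a k) ^+ 2.
Proof.
rewrite sqnE; have [|_ ->] := @summ_finite _ (sqs (psum a N)) N.
  by move=> n Nn; rewrite sqs_psum ltnNge Nn.
by apply: eq_bigr => k _; rewrite sqs_psum ltn_ord.
Qed.

Lemma psum1 w : psum (fun=> w) 1 = fun=> w.
Proof. by apply/funext => z; rewrite /psum big_ord_recl big_ord0 expr0 mulr1 addr0. Qed.

Lemma H2_cst w : hardy (fun=> w). Proof. by rewrite -psum1; exact: H2_psum. Qed.

Lemma sqn_cst w : sqn (fun=> w) = cmod w ^+ 2.
Proof. by rewrite -psum1 sqn_psum big_ord_recl big_ord0 addr0. Qed.

Lemma cdot0l (b : C) : cdot 0 b = 0 :> R. Proof. by rewrite /cdot !reimE; ring. Qed.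

Lemma rd_cst w g : ana g -> rd (fun=> w) g = cdot w (g 0).
Proof.
move=> hg; rewrite -co0// rdE.
have [|_ ->] := @summ_finite _ (dts (fun=> w) g) 1.
  by case=> // n _; rewrite dtsE co_cst cdot0l.
by rewrite big_ord_recl big_ord0 addr0 dtsE co_cst.
Qed.

Lemma dts_shift f g n : ana f -> ana g ->
  dts (fun z => z * f z) (fun z => z * g z) n = if n is k.+1 then dts f g k else 0.
Proof.
by move=> af ag; case: n => [|n]; rewrite dtsE !co_shift// ?dtsE// cdot0l.
Qed.

Lemma rd_shift f g : hardy f -> hardy g -> rd (fun z => z * f z) (fun z => z * g z) = rd f g.
Proof.
move=> hf hg; have af := H2_analytic hf; have ag := H2_analytic hg; rewrite !rdE.
have [|_ ->] := @summ_recl _ (dts (fun z => z * f z) (fun z => z * g z)).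
  by apply: eq_summ (rd_summ hf hg) => n; rewrite dts_shift.
by rewrite dts_shift// add0r; apply: eq_tot => n; rewrite dts_shift.
Qed.

Lemma sqs_shift f n : ana f ->
  sqs (fun z => z * f z) n = if n is k.+1 then sqs f k else 0.
Proof.
by move=> af; case: n => [|n]; rewrite sqsE !co_shift// ?sqsE// cmod0 expr0n.
Qed.

Lemma H2_shift f : hardy f -> hardy (fun z => z * f z).
Proof.
move=> hf; have af := H2_analytic hf; apply: H2I; first exact: analytic_shift.
have [|//] := @summ_recl _ (sqs (fun z => z * f z)).
by apply: eq_summ (H2_summ hf) => n; rewrite sqs_shift.
Qed.

Lemma sqn_shift f : hardy f -> sqn (fun z => z * f z) = sqn f.
Proof. by move=> hf; rewrite -!rd_sq rd_shift. Qed.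

Lemma co_sq_le f n : hardy f -> cmod (co f n) ^+ 2 <= sqn f.
Proof.
move=> hf; rewrite sqnE; apply: le_trans (le_tot n.+1 (sqs_ge0 f) (H2_summ hf)).
by rewrite big_ord_recr/= sqsE lerDr; apply: sumr_ge0 => k _; exact: sqs_ge0.
Qed.

Lemma sqn_eq0 f : hardy f -> sqn f = 0 -> forall z, disc z -> f z = 0.
Proof.
move=> hf f0 z zD.
have c0 n : co f n = 0.
  apply/cmod_eq0/eqP; have := co_sq_le n hf.
  by rewrite f0 -sqrf_eq0 eq_le sqr_ge0 => ->.
have hE := coP (H2_analytic hf).
have := taylor_cvgE hE zD.
have -> : (fun N => psum (co f) N z) = (fun=> 0).
  by apply/funext => N; rewrite /psum big1// => k _; rewrite c0 mul0r.
by move=> h; apply: (cvgC_unique h); exact: cvg_cst.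
Qed.

Lemma cvg_ord_sum N (u : nat -> nat -> R) (l : nat -> R) :
  (forall n, (fun k => u k n) @ \oo --> l n) ->
  (fun k => \sum_(n < N) u k n) @ \oo --> \sum_(n < N) l n.
Proof.
move=> h; elim: N => [|N ih].
  rewrite big_ord0 (_ : (fun k => _) = fun=> 0); first exact: cvg_cst.
  by apply/funext => k; rewrite big_ord0.
rewrite big_ord_recr (_ : (fun k => _) = fun k => \sum_(n < N) u k n + u k N); first exact: cvgD.
by apply/funext => k; rewrite big_ord_recr.
Qed.

(** Convergence of each coefficient suffices: every finite sum of squares passes to the limit under
    the common bound. *)
Lemma H2_lim (F : nat -> C -> C) f B : (forall k, hardy (F k)) -> (forall k, sqn (F k) <= B) ->
  ana f -> (forall n, (fun k => co (F k) n) @ \oo --> co f n) ->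
  hardy f /\ sqn f <= B.
Proof.
move=> hF FB hf hc.
have key N : \sum_(n < N) sqs f n <= B.
  have cl : (fun k => \sum_(n < N) sqs (F k) n) @ \oo --> \sum_(n < N) sqs f n.
    apply: (@cvg_ord_sum N (fun k n => sqs (F k) n) (sqs f)) => n.
    have c1 : (fun k => cmod (co (F k) n)) @ \oo --> cmod (co f n).
      exact: (cvg_cmod (hc n)).
    rewrite sqsE; have -> : (fun k => sqs (F k) n) = (fun k => cmod (co (F k) n) * cmod (co (F k) n)).
      by apply/funext => k; rewrite sqsE expr2.
    by rewrite expr2; exact: cvgM.
  rewrite -(cvg_lim _ cl)//; apply: limr_le; first by apply/cvg_ex; eexists; exact: cl.
  apply: nearW => k; apply: le_trans (FB k); rewrite sqnE; apply: le_tot; [exact: sqs_ge0|exact: H2_summ].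
have c : summ (sqs f) by apply: summ_nneg key; exact: sqs_ge0.
by split; [exact: H2I|rewrite sqnE; exact: tot_le].
Qed.

(** The inequality 2xy <= x^2 + y^2 on each term is enough, since only a bound in terms of [sqn f]
    and [z] alone is wanted; see [iso_le1]. *)
Lemma eval_bound f z : hardy f -> disc z -> cmod (f z) <= (sqn f + (1 - cmod z ^+ 2)^-1) / 2.
Proof.
move=> hf zD; have hE := coP (H2_analytic hf).
have cl : (fun N => cmod (psum (co f) N z)) @ \oo --> cmod (f z).
  exact: (cvg_cmod (taylor_cvgE hE zD)).
rewrite -(cvg_lim _ cl)//; apply: limr_le; first by apply/cvg_ex; eexists; exact: cl.
have z1 : cmod z < 1 by [].
have q01 : 0 <= cmod z ^+ 2 < 1 by rewrite exprn_ge0//= exprn_ilt1.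
apply: nearW => N.
apply: le_trans (cmod_sum _ (fun k => co f k * z ^+ k)) _.
apply: (@le_trans _ _ (\sum_(k < N) (sqs f k + (cmod z ^+ 2) ^+ k) / 2)).
  apply: ler_sum => k _; rewrite cmodM cmodX exprAC sqsE.
  have := sqr_ge0 (cmod (co f k) - cmod z ^+ k); rewrite sqrrB.
  by move: (_ ^+ 2) (cmod z ^+ k ^+ 2) (_ * _) => u v q; rewrite mulr2n; lra.
rewrite -mulr_suml big_split/= ler_pM2r ?invr_gt0//; apply: lerD; last exact: geo_sum_le.
by rewrite sqnE; apply: le_tot; [exact: sqs_ge0|exact: H2_summ].
Qed.

Definition trunc f N := psum (co f) N.

Lemma H2_trunc f N : hardy (trunc f N). Proof. exact: H2_psum. Qed.

Lemma sqn_trunc_sub f N : hardy f ->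
  sqn (fun z => f z - trunc f N z) = sqn f - sqn (trunc f N).
Proof.
move=> hf; have hN := H2_trunc f N; have af := H2_analytic hf.
suff E : rd f (trunc f N) = sqn (trunc f N).
  by rewrite sqnB// E; move: (sqn f) (sqn _) => *; ring.
rewrite -rd_sq !rdE; apply: eq_tot => n.
rewrite !dtsE /trunc co_psum; case: ifP => // _.
by rewrite cdotC !cdot0l.
Qed.

Lemma trunc_cvg f : hardy f -> (fun N => sqn (fun z => f z - trunc f N z)) @ \oo --> (0 : R).
Proof.
move=> hf; have -> : (fun N => sqn (fun z => f z - trunc f N z)) = (fun N => sqn f - \sum_(k < N) sqs f k).
  apply/funext => N; rewrite sqn_trunc_sub// sqn_psum; congr (_ - _).
  by apply: eq_bigr => k _; rewrite sqsE.
have h := summ_cvg (H2_summ hf); rewrite -sqnE in h.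
by rewrite -[X in _ --> X](subrr (sqn f)); apply: cvgB; [exact: cvg_cst|exact: h].
Qed.

Lemma sqn_trunc_le f N : hardy f -> sqn (trunc f N) <= sqn f.
Proof.
move=> hf; rewrite -subr_ge0 -sqn_trunc_sub//; apply: sqn_ge0.
exact: H2B (H2_trunc f N).
Qed.

Lemma rd_lim0 (F : nat -> C -> C) g : (forall k, hardy (F k)) -> hardy g ->
  (fun k => sqn (F k)) @ \oo --> (0 : R) -> (fun k => rd (F k) g) @ \oo --> (0 : R).
Proof.
move=> hF hg /cvgrPdist_lt h; apply/cvgrPdist_lt => e e0.
have g0 := sqn_ge0 hg.
have e2 : 0 < e ^+ 2 / (sqn g + 1) by rewrite divr_gt0 ?exprn_gt0//; lra.
apply: filterS (h _ e2) => k; rewrite !sub0r !normrN (ger0_norm (sqn_ge0 (hF k))) => hk.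
rewrite -(@ltr_pXn2r _ 2) ?nnegrE ?(ltW e0)// real_normK ?num_real//.
apply: le_lt_trans (cauchy_schwarz (hF k) hg) _.
rewrite ltr_pdivlMr in hk; last by rewrite ltr_wpDl.
move: (sqn_ge0 (hF k)) hk; move: (sqn (F k)) (sqn g) => u v u0 hk.
by apply: le_lt_trans hk; rewrite mulrDr mulr1 lerDl.
Qed.

Lemma rd_lim (F : nat -> C -> C) f g : (forall k, hardy (F k)) -> hardy f -> hardy g ->
  (fun k => sqn (fun z => f z - F k z)) @ \oo --> (0 : R) -> (fun k => rd (F k) g) @ \oo --> rd f g.
Proof.
move=> hF hf hg h.
have h1 := @rd_lim0 (fun k z => f z - F k z) g (fun k => H2B hf (hF k)) hg h.
have -> : (fun k => rd (F k) g) = (fun k => rd f g - rd (fun z => f z - F k z) g).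
  by apply/funext => k; rewrite (rdBl hf (hF k) hg); move: (rd f g) (rd (F k) g) => *; ring.
by rewrite -[X in _ --> X]subr0; apply: cvgB => //; exact: cvg_cst.
Qed.

Lemma sqn_lim (F : nat -> C -> C) f : (forall k, hardy (F k)) -> hardy f ->
  (fun k => sqn (fun z => f z - F k z)) @ \oo --> (0 : R) -> (fun k => sqn (F k)) @ \oo --> sqn f.
Proof.
move=> hF hf h.
have h1 := rd_lim hF hf hf h.
have -> : (fun k => sqn (F k)) = (fun k => sqn (fun z => f z - F k z) + 2 * rd (F k) f - sqn f).
  by apply/funext => k; rewrite (sqnB hf (hF k)) (rdC f); move: (rd (F k) f) (sqn f) (sqn (F k)) => *; ring.
have {2}-> : sqn f = 0 + 2 * rd f f - sqn f by rewrite rd_sq; move: (sqn f) => *; ring.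
apply: cvgB; last exact: cvg_cst.
by apply: cvgD => //; apply: cvgM => //; exact: cvg_cst.
Qed.

(* Equivalent to [inner] by [inner_iso] and [iso_inner]. *)
Definition iso (phi : C -> C) := ana phi /\
  forall f, hardy f -> hardy (fun z => phi z * f z) /\ sqn (fun z => phi z * f z) = sqn f.

Section Iso.
Implicit Type phi : C -> C.

Lemma isoH phi f : iso phi -> hardy f -> hardy (fun z => phi z * f z).
Proof. by move=> [_ h] /h[]. Qed.

Lemma isoN phi f : iso phi -> hardy f -> sqn (fun z => phi z * f z) = sqn f.
Proof. by move=> [_ h] /h[]. Qed.

Lemma iso_H2 phi : iso phi -> hardy phi.
Proof. by move=> /isoH/(_ (H2_cst 1)); apply: H2_ext => z _; rewrite mulr1. Qed.

Lemma iso_sqn phi : iso phi -> sqn phi = 1.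
Proof.
move=> /isoN/(_ (H2_cst 1)); rewrite sqn_cst cmod1 expr1n => <-.
by apply: sqn_ext => z _; rewrite mulr1.
Qed.

Lemma iso_rd phi f g : iso phi -> hardy f -> hardy g ->
  rd (fun z => phi z * f z) (fun z => phi z * g z) = rd f g.
Proof.
move=> hp hf hg.
have h1 := sqnD hf hg; have h2 := sqnD (isoH hp hf) (isoH hp hg).
have h3 := isoN hp (H2D hf hg).
have h4 : sqn (fun z => phi z * f z + phi z * g z) = sqn (fun z => phi z * (f z + g z)).
  by apply: sqn_ext => z _; rewrite mulrDr.
have h5 := isoN hp hf; have h6 := isoN hp hg.
move: h2; rewrite h4 h3 h1 h5 h6.
by move: (rd _ _) (rd f g) (sqn f) (sqn g) => u v p q; lra.
Qed.

Lemma iso_ext phi phi' : (forall z, disc z -> phi z = phi' z) -> iso phi -> iso phi'.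
Proof.
move=> h [h1 h2]; split; first exact: analytic_ext h h1.
move=> f hf; have [k1 k2] := h2 f hf; split.
  by apply: H2_ext k1 => z zD; rewrite h.
by rewrite -k2; apply: sqn_ext => z zD; rewrite h.
Qed.

Lemma isoM phi phi' : iso phi -> iso phi' -> iso (fun z => phi z * phi' z).
Proof.
move=> h1 h2; split; first by apply: analyticM; [case: h1|case: h2].
move=> f hf; have k1 := isoH h2 hf; have k2 := isoH h1 k1; split.
  by apply: H2_ext k2 => z _; rewrite mulrA.
rewrite -(isoN h2 hf) -(isoN h1 k1); apply: sqn_ext => z _; by rewrite mulrA.
Qed.

Lemma iso_cst w : cmod w = 1 -> iso (fun=> w).
Proof.
move=> w1; split; first exact: analytic_cst.
by move=> f hf; split; [exact: H2Z|rewrite sqnZ// w1 expr1n mul1r].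
Qed.

Lemma iso_id : iso id.
Proof.
split; last by move=> f hf; split; [exact: H2_shift|exact: sqn_shift].
by apply: analytic_ext (analytic_shift (analytic_cst 1)) => z _; rewrite mulr1.
Qed.

Lemma isoX phi n : iso phi -> iso (fun z => phi z ^+ n).
Proof.
move=> h; elim: n => [|n ih].
  by under eq_fun do rewrite expr0; apply: iso_cst; exact: cmod1.
by under eq_fun do rewrite exprS; exact: isoM.
Qed.

Lemma expn_unbounded x B : 1 < x -> exists n, B < x ^+ n.
Proof.
move=> x1; have h : 0 < x - 1 by rewrite subr_gt0.
have [n hn] : exists n : nat, B / (x - 1) < n%:R.
  by exists (Num.truncn `|B / (x - 1)|).+1; apply: le_lt_trans (ler_norm _) _; rewrite truncnS_gt.
exists n; rewrite ltr_pdivrMr// in hn; apply: lt_le_trans hn _.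
elim: n {B} => [|n ih]; first by rewrite mul0r expr0.
rewrite -natr1 mulrDl mul1r exprS.
have : 1 <= x ^+ n by rewrite exprn_ege1// ltW.
move: (x ^+ n) (n%:R * (x - 1)) ih => u v; nra.
Qed.

(** All powers of [phi] are isometric multipliers of norm 1, so [eval_bound] bounds phi(z)^n
    independently of n. *)
Lemma iso_le1 phi z : iso phi -> disc z -> cmod (phi z) <= 1.
Proof.
move=> h zD; rewrite leNgt; apply/negP => h1.
have [n] := expn_unbounded ((1 + (1 - cmod z ^+ 2)^-1) / 2) h1.
apply/negP; rewrite -leNgt -cmodX.
have hn := isoX n h.
by have := eval_bound (iso_H2 hn) zD; rewrite (iso_sqn hn).
Qed.

Lemma trunc_lucv f : ana f -> lucv (trunc f) f.
Proof. by move=> h; apply: taylor_lucv; exact: coP. Qed.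

Lemma coM_lim phi f n : ana phi -> ana f ->
  (fun k => co (fun z => phi z * trunc f k z) n) @ \oo --> co (fun z => phi z * f z) n.
Proof.
move=> hp hf.
apply: (@taylor_lim_coef _ (fun k z => phi z * trunc f k z) (fun k => co (fun z => phi z * trunc f k z)) (fun z => phi z * f z)).
- by move=> k; apply: coP; apply: (analyticM hp); exact: analytic_psum.
- by apply: coP; exact: analyticM.
- have := lucvM (trunc_lucv hf) hp => H r r01 e e0; have [N0 HN] := H r r01 e e0.
  by exists N0 => N z NN zr; rewrite ![phi z * _]mulrC; exact: HN.
Qed.

(** Polynomials are dense in H^2, so the isometry need only be checked on them. *)
Lemma iso_psum phi : ana phi -> (forall a N, hardy (fun z => phi z * psum a N z) /\
    sqn (fun z => phi z * psum a N z) = sqn (psum a N)) -> iso phi.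
Proof.
move=> hp h; split=> //.
(* Contractivity comes first, since it is what bounds phi (f - trunc f k) when the equality of norms
   is passed to the limit. *)
have h1 f : hardy f -> hardy (fun z => phi z * f z) /\ sqn (fun z => phi z * f z) <= sqn f.
  move=> hf; have af := H2_analytic hf.
  apply: (@H2_lim (fun k z => phi z * trunc f k z)).
  - by move=> k; have [] := h (co f) k.
  - by move=> k; have [_ ->] := h (co f) k; exact: sqn_trunc_le.
  - exact: analyticM.
  - by move=> n; exact: coM_lim.
move=> f hf; have [k1 k2] := h1 f hf; split=> //.
have c1 : (fun k => sqn (fun z => phi z * f z - phi z * trunc f k z)) @ \oo --> (0 : R).
  apply: (@squeeze_cvgr _ _ _ _ (fun=> 0) (fun k => sqn (fun z => f z - trunc f k z))).
  - apply: nearW => k; have hd := H2B hf (H2_trunc f k).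
    have -> : sqn (fun z => phi z * f z - phi z * trunc f k z) = sqn (fun z => phi z * (f z - trunc f k z)).
      by apply: sqn_ext => z _; rewrite mulrBr.
    by have [q1 q2] := h1 _ hd; rewrite q2 andbT sqn_ge0.
  - exact: cvg_cst.
  - exact: trunc_cvg.
have c2 := sqn_lim (fun k => (h (co f) k).1) k1 c1.
have c3 := sqn_lim (H2_trunc f) hf (trunc_cvg hf).
have E : (fun k => sqn (fun z => phi z * trunc f k z)) = (fun k => sqn (trunc f k)).
  by apply/funext => k; have [_ ->] := h (co f) k.
rewrite E in c2.
exact: (cvg_unique _ c2 c3).
Qed.

End Iso.
End HardySpace.

(** * Reproducing kernels of the Hardy space *)

Section Operators.
Context {R : realType}.
Notation C := (Cplx R).
Implicit Types (f g h x y : C -> C) (a b c : nat -> C) (z w : C) (r t e B : R) (n k N : nat).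
Implicit Types (phi psi theta : C -> C).

Lemma sqnB_le x y : hardy x -> hardy y -> sqn (fun z => x z - y z) <= 2 * sqn x + 2 * sqn y.
Proof.
move=> hx hy; have := sqn_ge0 (H2D hx hy); rewrite sqnB// sqnD//.
by move: (sqn x) (sqn y) (rd x y) => u v q; lra.
Qed.

Lemma sqnD_le x y : hardy x -> hardy y -> sqn (fun z => x z + y z) <= 2 * sqn x + 2 * sqn y.
Proof.
move=> hx hy; have := sqn_ge0 (H2B hx hy); rewrite sqnB// sqnD//.
by move: (sqn x) (sqn y) (rd x y) => u v q; lra.
Qed.

Lemma cjX z n : cj (z ^+ n) = cj z ^+ n.
Proof.
elim: n => [|n ih]; first by rewrite !expr0; apply: cpx_eq; rewrite !reimE ?oppr0.
by rewrite !exprS -ih; apply: cpx_eq; rewrite !reimE; ring.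
Qed.

Lemma geo_psum (q : C) N : (1 - q) * \sum_(k < N) q ^+ k = 1 - q ^+ N.
Proof. by rewrite -[RHS]opprB subrX1 -mulNr opprB. Qed.

Lemma geo_sumR (q : R) N : (1 - q) * \sum_(k < N) q ^+ k = 1 - q ^+ N.
Proof. by rewrite -[RHS]opprB subrX1 -mulNr opprB. Qed.

Lemma cvgC_expr (q : C) : cmod q < 1 -> (fun N => q ^+ N) @ \oo --> (0 : C).
Proof.
move=> q1; have h : (fun N => cmod q ^+ N) @ \oo --> (0 : R).
  by apply: cvg_expr; rewrite ger0_norm.
apply/cvgCP => e e0; have /cvgrPdist_lt/(_ _ e0) := h.
by apply: filterS => k; rewrite !sub0r normrN cmodN cmodX ger0_norm// exprn_ge0.
Qed.

Lemma subr1_neq0 (q : C) : cmod q < 1 -> 1 - q != 0.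
Proof.
by move=> q1; rewrite subr_eq0; apply: contraTneq q1 => <-; rewrite cmod1 ltxx.
Qed.

Lemma taylor_geo w : cmod w <= 1 -> taylor_expansion (fun z => (1 - w * z)^-1) (fun n => w ^+ n).
Proof.
move=> w1 z zD; rewrite -psum_series.
have q1 : cmod (w * z) < 1.
  rewrite cmodM; apply: le_lt_trans (_ : cmod z < 1) => //.
  by rewrite ler_piMl.
have -> : (fun N => psum (fun n => w ^+ n) N z) = (fun N => (1 - (w * z) ^+ N) * (1 - w * z)^-1).
  apply/funext => N; rewrite -geo_psum mulrAC mulfV ?mul1r ?subr1_neq0//.
  by apply: eq_bigr => k _; rewrite exprMn.
rewrite -[X in _ --> X]mul1r; apply: cvgM; last exact: cvg_cst.
rewrite -[X in _ --> X]subr0; apply: cvgB; first exact: cvg_cst.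
exact: cvgC_expr.
Qed.

(** The Szego kernel at [z], as a function of [w]. *)
Definition kernel z w : C := (1 - cj z * w)^-1.

Lemma co_kernel z n : disc z -> co (kernel z) n = cj z ^+ n.
Proof. by move=> zD; rewrite (coE (@taylor_geo (cj z) _))// cmod_cj ltW. Qed.

Lemma H2_kernel z : disc z -> hardy (kernel z).
Proof.
move=> zD; apply: H2I; first by apply: anaI; apply: taylor_geo; rewrite cmod_cj ltW.
apply: (@summ_nneg _ _ (1 - cmod z ^+ 2)^-1) => [n|N]; first exact: sqs_ge0.
under eq_bigr do rewrite sqsE co_kernel// cmodX cmod_cj exprAC.
by apply: geo_sum_le; rewrite exprn_ge0//= exprn_ilt1.
Qed.

(** The reproducing property. The scalar [w] selects a real coordinate of f(z): 1 gives the real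
    part and [ci] the imaginary part. *)
Lemma rd_kernel z f w : disc z -> hardy f -> rd f (fun v => w * kernel z v) = cdot (f z) w.
Proof.
move=> zD hf; have hk := H2_kernel zD.
have h1 := summ_cvg (rd_summ hf (H2Z w hk)); rewrite -rdE in h1.
have E : (fun N => \sum_(k < N) dts f (fun v => w * kernel z v) k) = (fun N => cdot (psum (co f) N z) w).
  apply/funext => N; rewrite /psum (cdot_suml _ (fun k => co f k * z ^+ k)); apply: eq_bigr => k _.
  rewrite dtsE coZ ?co_kernel//; last exact: H2_analytic.
  by rewrite -cjX [RHS]cdotC [co f k * _]mulrC [RHS]cdotC cdotZl mulrC.
rewrite E in h1.
have h2 : (fun N => cdot (psum (co f) N z) w) @ \oo --> cdot (f z) w.
  have c := taylor_cvgE (coP (H2_analytic hf)) zD.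
  rewrite /cdot; apply: cvgD; apply: cvgM; try exact: cvg_cst.
    exact: (cvg_re c).
  exact: (cvg_im c).
exact: (cvg_unique _ h1 h2).
Qed.

Lemma sqn_kernel z : disc z -> sqn (kernel z) = (1 - cmod z ^+ 2)^-1.
Proof.
move=> zD; have hk := H2_kernel zD.
have h := rd_kernel 1 zD hk.
have E : rd (kernel z) (fun v => 1 * kernel z v) = sqn (kernel z).
  by rewrite -rd_sq; apply: rd_ext => // v _; rewrite mul1r.
rewrite -E h /kernel.
have -> : 1 - cj z * z = rc (1 - cmod z ^+ 2).
  by apply: cpx_eq; rewrite !reimE ?cmod_sq; ring.
have -> : (rc (1 - cmod z ^+ 2))^-1 = rc ((1 - cmod z ^+ 2)^-1).
  have nz : 1 - cmod z ^+ 2 != 0 by rewrite gt_eqF// subr_gt0 exprn_ilt1.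
  apply: (mulfI (_ : rc (1 - cmod z ^+ 2) != 0)).
    by apply/eqP => /(congr1 re)/eqP; rewrite re_rc; apply/negP.
  rewrite mulfV; first by rewrite -rcM mulfV.
  by apply/eqP => /(congr1 re)/eqP; rewrite re_rc; apply/negP.
by rewrite cdotC cdot1r re_rc.
Qed.

(** * Composition with an inner function *)

Section SelfMap.
Variable psi : C -> C.
Hypotheses (ipsi : iso psi) (psi01 : cmod (psi 0) < 1).
Let a : C := psi 0.

Let hpsi : hardy psi := iso_H2 ipsi.
Let apsi : ana psi := H2_analytic hpsi.

(** Composed with [psi] it is orthogonal to psi H^2: pairing with psi h, both terms give a multiple
    of conj(h(0)), and with a = psi(0) the two cancel. It is the reproducing kernel of K_psi at
    0. *)
Definition one_sub w : C := 1 - cj a * w.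

Lemma disc0 : disc (0 : C). Proof. by rewrite cmod_lt_disc cmod0. Qed.

Lemma H2_E : hardy (fun z => one_sub (psi z)).
Proof. by apply: H2B; [exact: H2_cst|exact: H2Z]. Qed.

Lemma sqn_E : sqn (fun z => one_sub (psi z)) = 1 - cmod a ^+ 2.
Proof.
rewrite sqnB; [|exact: H2_cst|exact: H2Z].
rewrite sqn_cst cmod1 expr1n sqnZ// iso_sqn// mulr1 cmod_cj rd_cst; last exact: analyticZ.
rewrite cdot1r.
have -> : re (cj a * psi 0) = cmod a ^+ 2 by rewrite !reimE cmod_sq; ring.
by move: (cmod a ^+ 2) => u; ring.
Qed.

(** Cauchy-Schwarz between the reproducing kernels of K_psi at 0 and at [z]. The first has squared
    norm 1 - |a|^2; the second, called [K], has (1 - |psi(z)|^2)/(1 - |z|^2); and the real part of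
    their product is re (1 - conj(a) psi(z)) >= 1 - |a|. *)
Lemma schwarz_pick z : disc z ->
  (1 - cmod a) ^+ 2 * (1 - cmod z ^+ 2) <= (1 - cmod a ^+ 2) * (1 - cmod (psi z) ^+ 2).
Proof.
move=> zD; have hk := H2_kernel zD.
pose p := psi z.
pose pk := fun v => psi v * kernel z v.
have hpk : hardy pk by exact: isoH.
pose K := fun v => kernel z v - cj p * pk v.
have hcpk : hardy (fun v => cj p * pk v) by exact: H2Z.
have hK : hardy K by exact: H2B.
have rdK f : hardy f -> rd f (fun v => cj p * pk v) = rd (fun v => p * f v) pk.
  by move=> hf; rewrite rdZl.
have rk f : hardy f -> rd f (kernel z) = re (f z).
  move=> hf; rewrite -[re _]cdot1r cdotC -(rd_kernel 1 zD hf).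
  by apply: rd_ext => // v _; rewrite mul1r.
have q0 : 0 < 1 - cmod z ^+ 2 by rewrite subr_gt0 exprn_ilt1.
have sK : sqn K * (1 - cmod z ^+ 2) = 1 - cmod p ^+ 2.
  rewrite /K sqnB// sqnZ// cmod_cj (isoN ipsi hk) sqn_kernel//.
  rewrite rdC rk// /pk -/p.
  have -> : kernel z z = rc ((1 - cmod z ^+ 2)^-1).
    rewrite -sqn_kernel// -rd_sq rk//; apply: cpx_eq; rewrite ?reimE//.
    (* Multiplication by i is skew for [rd], so [kernel z z] has no imaginary part. *)
    have : cdot (kernel z z) ci = 0.
      rewrite -(rd_kernel ci zD hk).
      have h2 : rd (kernel z) (fun v => ci * kernel z v) = - rd (kernel z) (fun v => ci * kernel z v).
        rewrite {1}rdC rdZl// -[RHS]mulN1r -rdrr//; last exact: H2Z.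
        apply: rd_ext => // v _; rewrite mulrA; congr (_ * _).
        by apply: cpx_eq; rewrite !reimE; ring.
      by move: h2; move: (rd _ _) => u; lra.
    by rewrite /cdot !reimE mulr0 add0r mulr1.
  have -> : re (cj p * (p * rc ((1 - cmod z ^+ 2)^-1))) = cmod p ^+ 2 / (1 - cmod z ^+ 2).
    by rewrite !reimE (cmod_sq p); ring.
  by move: q0 (cmod p ^+ 2); move: (1 - cmod z ^+ 2) => u u0 v; field; rewrite gt_eqF.
have rE : rd (fun z => one_sub (psi z)) K = re (one_sub p).
  rewrite /K rdBr//; last exact: H2_E.
  rewrite rk; last exact: H2_E.
  rewrite rdK; last exact: H2_E.
  suff -> : rd (fun v => p * one_sub (psi v)) pk = 0 by rewrite subr0.
  have -> : rd (fun v => p * one_sub (psi v)) pk = rd (fun v => p - psi v * (p * cj a)) pk.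
    by apply: rd_ext => // v _; rewrite /one_sub; ring.
  have hc : hardy (fun=> p * cj a) by exact: H2_cst.
  rewrite rdBl//; [|exact: H2_cst|exact: isoH].
  rewrite (iso_rd ipsi hc hk) rk// rd_cst; last exact: H2_analytic.
  rewrite /pk -/a.
  have -> : kernel z 0 = 1 by rewrite /kernel mulr0 subr0 invr1.
  by rewrite /cdot !reimE; ring.
have h1 := cauchy_schwarz H2_E hK.
rewrite rE sqn_E in h1.
have h2 : 1 - cmod a <= re (one_sub p).
  have := abs_re_le (cj a * p); rewrite cmodM cmod_cj => /ler_normlP[_ h3].
  have h4 : cmod a * cmod p <= cmod a by rewrite ler_piMr// iso_le1.
  by rewrite /one_sub reB re1; lra.
have a1 : 0 <= 1 - cmod a by rewrite subr_ge0 ltW.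
rewrite -sK mulrA ler_pM2r//; apply: le_trans h1.
by rewrite ler_sqr ?nnegrE// (le_trans a1).
Qed.

Lemma iso_selfmap : selfmap psi.
Proof.
split=> // r /andP[r0 r1].
pose d := (1 - cmod a) ^+ 2 * (1 - r ^+ 2).
have a0 : 0 <= cmod a by [].
have d0 : 0 < d by rewrite mulr_gt0 ?exprn_gt0 ?subr_gt0// exprn_ilt1.
have key z : cmod z <= r -> d <= 1 - cmod (psi z) ^+ 2.
  move=> zr; have zD := le_disc zr r1.
  have h := schwarz_pick zD.
  have h1 : (1 - cmod a) ^+ 2 * (1 - r ^+ 2) <= (1 - cmod a) ^+ 2 * (1 - cmod z ^+ 2).
    by rewrite ler_wpM2l ?sqr_ge0// lerD2l lerN2 le_expn2.
  apply: (le_trans h1); apply: (le_trans h).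
  rewrite ler_piMl//; last by rewrite lerBlDr lerDl exprn_ge0.
  by rewrite subr_ge0 exprn_ile1// iso_le1.
have d1 : d <= 1 by apply: (le_trans (key 0 _)); rewrite ?cmod0// lerBlDr lerDl exprn_ge0.
(* From |psi(z)|^2 <= 1 - d <= (1 - d/2)^2. *)
exists (1 - d / 2); first by apply/andP; split; move: d d0 d1 {key} => d d0 d1; lra.
move=> z /key; have := cmod_ge0 (psi z); move: (cmod (psi z)) => u u0 h.
have d2 : 0 <= 1 - d / 2 by move: d d0 d1 {key} h => d d0 d1; lra.
rewrite -ler_sqr ?nnegrE//; move: d d0 d1 h d2 {key} => d d0 d1 h d2; nra.
Qed.

Lemma H2_psum_comp c N : hardy (fun z => psum c N (psi z)).
Proof.
elim: N => [|N ih].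
  by apply: H2_ext (H2_cst 0) => z _; rewrite /psum big_ord0.
have h := H2Z (c N) (iso_H2 (isoX N ipsi)).
by apply: H2_ext (H2D ih h) => z _; rewrite /psum big_ord_recr.
Qed.

Lemma H2_Emul x : hardy x -> hardy (fun z => one_sub (psi z) * x z).
Proof.
move=> hx; apply: H2_ext (H2B hx (H2Z (cj a) (isoH ipsi hx))) => z _.
by rewrite /one_sub; ring.
Qed.

Lemma sqn_Emul x : hardy x ->
  sqn (fun z => one_sub (psi z) * x z) = sqn (fun z => x z - cj a * (psi z * x z)).
Proof. by move=> hx; apply: sqn_ext => z _; rewrite /one_sub; ring. Qed.

Lemma E_lower x : hardy x -> (1 - cmod a) ^+ 2 * sqn x <= sqn (fun z => one_sub (psi z) * x z).
Proof.
move=> hx; have hp := isoH ipsi hx; have hap := H2Z (cj a) hp.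
rewrite sqn_Emul// sqnB// sqnZ// (isoN ipsi hx) cmod_cj.
have := cauchy_schwarz hx hap; rewrite sqnZ// (isoN ipsi hx) cmod_cj.
have := sqn_ge0 hx; have := cmod_ge0 a.
move: (sqn x) (rd _ _) (cmod a) => s q u u0 s0 h.
have : q <= u * s.
  apply: le_trans (ler_norm _) _; rewrite -ler_sqr ?nnegrE ?mulr_ge0// real_normK ?num_real//.
  by rewrite exprMn [_ * s ^+ 2]mulrC expr2 -mulrA [s * u ^+ 2]mulrC.
by move=> h2; nra.
Qed.

Lemma E_upper x : hardy x -> sqn (fun z => one_sub (psi z) * x z) <= 4 * sqn x.
Proof.
move=> hx; have hp := isoH ipsi hx; have hap := H2Z (cj a) hp.
rewrite sqn_Emul//; apply: (le_trans (sqnB_le hx hap)).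
rewrite sqnZ// (isoN ipsi hx) cmod_cj.
have : cmod a ^+ 2 <= 1 by rewrite exprn_ile1// ltW.
have := sqn_ge0 hx; move: (sqn x) (cmod a ^+ 2) => s u s0 u1; nra.
Qed.

(* The vectors [(1 - conj a psi) psi^n] are orthogonal, although the powers of [psi] are not. *)
Lemma littlewood_psum_eq c N : sqn (fun z => one_sub (psi z) * psum c N (psi z)) =
  (1 - cmod a ^+ 2) * \sum_(k < N) cmod (c k) ^+ 2.
Proof.
elim: N c => [|N ih] c.
  rewrite big_ord0 mulr0 -[RHS](_ : sqn (fun=> 0) = 0); last first.
    by rewrite sqn_cst cmod0 expr0n.
  by apply: sqn_ext => z _; rewrite /psum big_ord0 mulr0.
pose c' n := c n.+1.
pose W := fun z => one_sub (psi z) * psum c' N (psi z).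
have hW : hardy W by apply: H2_Emul; exact: H2_psum_comp.
have hpW : hardy (fun z => psi z * W z) by exact: isoH.
have hE := H2Z (c 0%N) H2_E.
have -> : sqn (fun z => one_sub (psi z) * psum c N.+1 (psi z)) =
   sqn (fun z => c 0%N * one_sub (psi z) + psi z * W z).
  apply: sqn_ext => z _; rewrite /W /psum big_ord_recl/= expr0 mulr1.
  have -> : \sum_(i < N) c (bump 0 i) * psi z ^+ bump 0 i = psi z * \sum_(i < N) c' i * psi z ^+ i.
    by rewrite mulr_sumr; apply: eq_bigr => i _; rewrite /bump leq0n add1n exprS /c'; ring.
  by ring.
rewrite sqnD// sqnZ; last exact: H2_E.
rewrite (isoN ipsi hW) sqn_E [sqn W]ih big_ord_recl/=.
suff -> : rd (fun z => c 0%N * one_sub (psi z)) (fun z => psi z * W z) = 0.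
  by rewrite mulr0 addr0 [RHS]mulrDr; congr (_ + _); exact: mulrC.
have -> : rd (fun z => c 0%N * one_sub (psi z)) (fun z => psi z * W z) =
    rd (fun z => c 0%N - psi z * (c 0%N * cj a)) (fun z => psi z * W z).
  by apply: rd_ext => // z _; rewrite /one_sub; ring.
have hc : hardy (fun=> c 0%N * cj a) by exact: H2_cst.
rewrite rdBl//; [|exact: H2_cst|exact: isoH].
rewrite (iso_rd ipsi hc hW) !rd_cst; try exact: H2_analytic.
by rewrite -/a /cdot !reimE; ring.
Qed.

(** The ratio of the constants in [littlewood_psum_eq] and [E_lower]; it equals Littlewood's (1 +
    |a|)/(1 - |a|). *)
Let K := (1 - cmod a ^+ 2) / (1 - cmod a) ^+ 2.

Lemma littlewood_const_ge0 : 0 <= K.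
Proof. by rewrite divr_ge0 ?sqr_ge0// subr_ge0 exprn_ile1// ltW. Qed.

Lemma littlewood_psum c N : sqn (fun z => psum c N (psi z)) <= K * sqn (psum c N).
Proof.
have h := E_lower (H2_psum_comp c N).
rewrite littlewood_psum_eq -sqn_psum in h.
by rewrite /K mulrAC ler_pdivlMr ?exprn_gt0 ?subr_gt0// mulrC.
Qed.

Lemma co_comp_lim f n : ana f -> (fun k => co (fun z => trunc f k (psi z)) n) @ \oo --> co (fun z => f (psi z)) n.
Proof.
move=> af.
apply: (@taylor_lim_coef _ (fun k z => trunc f k (psi z)) (fun k => co (fun z => trunc f k (psi z))) (fun z => f (psi z))).
- by move=> k; apply: coP; exact: H2_analytic (H2_psum_comp _ _).
- by apply: coP; exact: (analytic_comp af iso_selfmap).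
- exact: (lucv_comp iso_selfmap (trunc_lucv af)).
Qed.

Lemma littlewood f : hardy f -> hardy (fun z => f (psi z)) /\
  sqn (fun z => f (psi z)) <= K * sqn f.
Proof.
move=> hf; have af := H2_analytic hf.
apply: (@H2_lim _ (fun k z => trunc f k (psi z))).
- by move=> k; exact: H2_psum_comp.
- move=> k; apply: le_trans (littlewood_psum _ _) _.
  by apply: ler_wpM2l; [exact: littlewood_const_ge0|exact: sqn_trunc_le].
- exact: (analytic_comp af iso_selfmap).
- by move=> n; exact: co_comp_lim.
Qed.

Lemma H2_comp f : hardy f -> hardy (fun z => f (psi z)).
Proof. by move=> /littlewood[]. Qed.

(** The polynomial identity [littlewood_psum_eq] extends by density: [littlewood] and [E_upper] make
    both sides continuous in [f]. *)
Lemma littlewood_eq f : hardy f ->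
  sqn (fun z => one_sub (psi z) * f (psi z)) = (1 - cmod a ^+ 2) * sqn f.
Proof.
move=> hf; have hfp := H2_comp hf.
have hk k : hardy (fun z => one_sub (psi z) * trunc f k (psi z)).
  by apply: H2_Emul; exact: H2_psum_comp.
have c1 : (fun k => sqn (fun z => one_sub (psi z) * f (psi z) - one_sub (psi z) * trunc f k (psi z))) @ \oo --> (0 : R).
  have hd k : hardy (fun z => f z - trunc f k z) by apply: H2B => //; exact: H2_trunc.
  apply: (@squeeze_cvgr _ _ _ _ (fun=> 0) (fun k => 4 * (K * sqn (fun z => f z - trunc f k z)))).
  - apply: nearW => k.
    have -> : sqn (fun z => one_sub (psi z) * f (psi z) - one_sub (psi z) * trunc f k (psi z)) =
        sqn (fun z => one_sub (psi z) * (f (psi z) - trunc f k (psi z))).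
      by apply: sqn_ext => z _; rewrite mulrBr.
    have [h1 h2] := littlewood (hd k).
    rewrite (sqn_ge0 (H2_Emul h1))/=; apply: le_trans (E_upper h1) _.
    by rewrite ler_pM2l.
  - exact: cvg_cst.
  - rewrite -[X in _ --> X](_ : 4 * (K * 0) = 0); last by rewrite !mulr0.
    by apply: cvgM; [exact: cvg_cst|apply: cvgM; [exact: cvg_cst|exact: trunc_cvg]].
have c2 := sqn_lim hk (H2_Emul hfp) c1.
have c3 := sqn_lim (H2_trunc f) hf (trunc_cvg hf).
have c4 : (fun k => (1 - cmod a ^+ 2) * sqn (trunc f k)) @ \oo --> (1 - cmod a ^+ 2) * sqn f.
  by apply: cvgM => //; exact: cvg_cst.
have E : (fun k => sqn (fun z => one_sub (psi z) * trunc f k (psi z))) =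
   (fun k => (1 - cmod a ^+ 2) * sqn (trunc f k)).
  by apply/funext => k; rewrite littlewood_psum_eq sqn_psum.
rewrite E in c2; exact: (cvg_unique _ c2 c4).
Qed.

(** To remove the factor 1 - conj(a) psi from [littlewood_eq], the identity is applied to theta
    times the truncated geometric series of 1/(1 - conj(a) w). The left side becomes the squared
    norm of (1 - (conj(a) psi)^N) theta(psi), the right side is 1 - |a|^(2N), and N tends to
    infinity. *)
Lemma sqn_comp_iso theta : iso theta -> sqn (fun z => theta (psi z)) = 1.
Proof.
move=> it; have ht := H2_comp (iso_H2 it).
pose c k := cj a ^+ k.
have Ep N w : one_sub w * psum c N w = 1 - (cj a * w) ^+ N.
  rewrite -geo_psum; congr (_ * _); apply: eq_bigr => k _; by rewrite exprMn.
have hN N : hardy (fun z => cj a ^+ N * (psi z ^+ N * theta (psi z))).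
  by apply: H2Z; exact: isoH (isoX N ipsi) ht.
have s1 N : sqn (fun z => theta (psi z) - cj a ^+ N * (psi z ^+ N * theta (psi z))) =
    1 - (cmod a ^+ 2) ^+ N.
  have htp := isoH it (H2_psum c N).
  transitivity (sqn (fun z => one_sub (psi z) * (theta (psi z) * psum c N (psi z)))).
    by apply: sqn_ext => z _; rewrite [RHS]mulrCA Ep exprMn; ring.
  rewrite (littlewood_eq htp) (isoN it (H2_psum c N)) sqn_psum.
  under eq_bigr do rewrite cmodX cmod_cj exprAC.
  exact: geo_sumR.
have a1 : `|cmod a ^+ 2| < 1 by rewrite ger0_norm ?exprn_ge0// exprn_ilt1.
have c0 : (fun N => (cmod a ^+ 2) ^+ N) @ \oo --> (0 : R) by exact: cvg_expr.
have c1 : (fun N => sqn (fun z => theta (psi z) - (theta (psi z) - cj a ^+ N * (psi z ^+ N * theta (psi z))))) @ \oo --> (0 : R).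
  have -> : (fun N => sqn (fun z => theta (psi z) - (theta (psi z) - cj a ^+ N * (psi z ^+ N * theta (psi z))))) =
     (fun N => (cmod a ^+ 2) ^+ N * sqn (fun z => theta (psi z))).
    apply/funext => N; transitivity (sqn (fun z => cj a ^+ N * (psi z ^+ N * theta (psi z)))).
      by apply: sqn_ext => z _; rewrite opprB addrC subrK.
    rewrite sqnZ; last exact: isoH (isoX N ipsi) ht.
    by rewrite (isoN (isoX N ipsi) ht) cmodX cmod_cj exprAC.
  rewrite -[X in _ --> X](mul0r (sqn (fun z => theta (psi z)))).
  by apply: cvgM => //; exact: cvg_cst.
have c2 := sqn_lim (fun N => H2B ht (hN N)) ht c1.
have E : (fun N => sqn (fun z => theta (psi z) - cj a ^+ N * (psi z ^+ N * theta (psi z)))) = (fun N => 1 - (cmod a ^+ 2) ^+ N).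
  by apply/funext => N; exact: s1.
rewrite E in c2.
have c3 : (fun N => 1 - (cmod a ^+ 2) ^+ N) @ \oo --> (1 - 0 : R).
  by apply: cvgB => //; exact: cvg_cst.
by rewrite subr0 in c3; exact: (cvg_unique _ c2 c3).
Qed.

End SelfMap.
End Operators.

(** * Integral means over circles and the norm of H^2 *)

Section Means.
Context {R : realType}.
Notation C := (Cplx R).
Implicit Types (f g h x y : C -> C) (a b c : nat -> C) (z w : C) (r t e B : R) (n k N : nat).
Implicit Types (phi psi theta : C -> C).

Definition circ_mean f r : R := mean 0 (fun t => cmod (f (rc r * expi t)) ^+ 2).

Lemma bernoulli_le r n : 0 <= r <= 1 -> 1 - n%:R * (1 - r) <= r ^+ n.
Proof.
case/andP=> r0 r1; elim: n => [|n ih]; first by rewrite mul0r subr0 expr0.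
rewrite exprS -natr1 mulrDl mul1r.
have : 0 <= n%:R * (1 - r) by rewrite mulr_ge0// subr_ge0.
by move: (r ^+ n) (n%:R * (1 - r)) ih => u v h v0; nra.
Qed.

Lemma circ_mean_tot f r : ana f -> 0 <= r < 1 ->
  (fun N => \sum_(k < N) sqs f k * r ^+ (2 * k)) @ \oo --> circ_mean f r.
Proof.
move=> af r01; have h := @parseval R f (co f) r 0 (coP af) r01.
have -> : (fun N => \sum_(k < N) sqs f k * r ^+ (2 * k)) = series (fun n => cmod (co f n) ^+ 2 * r ^+ (2 * n)).
  by apply/funext => N; rewrite seriesEnat/= big_mkord; apply: eq_bigr => k _; rewrite sqsE.
exact: h.
Qed.

Lemma circ_mean_ge f r N : ana f -> 0 <= r < 1 ->
  \sum_(k < N) sqs f k * r ^+ (2 * k) <= circ_mean f r.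
Proof.
move=> af r01; have c := circ_mean_tot af r01; rewrite -(cvg_lim _ c)//.
apply: limr_ge; first by apply/cvg_ex; eexists; exact: c.
exists N => // M /= NM.
rewrite -!(big_mkord xpredT (fun k => sqs f k * r ^+ (2 * k))) [leRHS](big_cat_nat (n := N))//= lerDl.
by apply: sumr_ge0 => k _; rewrite mulr_ge0 ?sqs_ge0// exprn_ge0//; case/andP: r01.
Qed.

Lemma circ_mean_le f r : hardy f -> 0 <= r < 1 -> circ_mean f r <= sqn f.
Proof.
move=> hf r01; have c := circ_mean_tot (H2_analytic hf) r01; rewrite -(cvg_lim _ c)//.
apply: limr_le; first by apply/cvg_ex; eexists; exact: c.
apply: nearW => N; rewrite sqnE; apply: le_trans (le_tot N (sqs_ge0 f) (H2_summ hf)).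
apply: ler_sum => k _; rewrite ler_piMr ?sqs_ge0//; case/andP: r01 => r0 r1.
by rewrite exprn_ile1// ltW.
Qed.

(** Bernoulli's inequality makes the loss from r^(2k) explicit, so that suitable radii can be
    written down in the next two lemmas. *)
Lemma circ_mean_trunc f r N : ana f -> 0 <= r < 1 ->
  (1 - (2 * N)%:R * (1 - r)) * \sum_(k < N) sqs f k <= circ_mean f r.
Proof.
move=> af /andP[r0 r1]; apply: le_trans (@circ_mean_ge f r N af _); last by rewrite r0.
rewrite mulr_sumr; apply: ler_sum => k _; rewrite mulrC ler_wpM2l ?sqs_ge0//.
apply: le_trans (@bernoulli_le r (2 * N) _) _; first by rewrite r0 ltW.
by rewrite ler_wiXn2l ?(ltW r1)// leq_mul2l ltnW// ltn_ord.
Qed.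

Lemma hardy_of_means f B : ana f -> (forall r, 0 <= r < 1 -> circ_mean f r <= B) ->
  hardy f /\ sqn f <= B.
Proof.
move=> af h.
have key N : \sum_(k < N) sqs f k <= B.
  have S0 : 0 <= \sum_(k < N) sqs f k by apply: sumr_ge0 => k _; exact: sqs_ge0.
  have hr r : 0 <= r < 1 -> (1 - (2 * N)%:R * (1 - r)) * \sum_(k < N) sqs f k <= B.
    by move=> r01; apply: le_trans (circ_mean_trunc N af r01) (h _ r01).
  move: S0 hr; move: (\sum_(k < N) sqs f k) ((2 * N)%:R : R) (ler0n R (2 * N)) => S m m0 S0 hr.
  rewrite leNgt; apply/negP => BS.
  have mS : 0 < m * S + S + 1 by nra.
  have B0 : 0 <= B \/ B < 0 by case: (leP 0 B) => ?; [left|right].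
  (* At radius r = 1 - d the loss m d S is at most (S - B)/2, which contradicts S - m d S <= B; the
     minimum with 1 keeps r >= 0. *)
  pose d := Num.min 1 ((S - B) / (2 * (m * S + S + 1))).
  have d0 : 0 < d by rewrite lt_min ltr01/= divr_gt0 ?subr_gt0// mulr_gt0.
  have d1 : d <= 1 by rewrite ge_min lexx.
  have d2 : d * (2 * (m * S + S + 1)) <= S - B.
    by rewrite -ler_pdivlMr ?mulr_gt0// ge_min lexx orbT.
  have := hr (1 - d) ltac:(by apply/andP; split; lra).
  move: d d0 d1 d2 => d d0 d1 d2.
  have -> : 1 - (1 - d) = d by ring.
  have h1 : 0 <= d * S by rewrite mulr_ge0// ltW.
  have h2 : d * (2 * (m * S + S + 1)) = 2 * (m * d * S) + 2 * (d * S) + 2 * d by ring.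
  rewrite h2 in d2; rewrite mulrBl mul1r => h3; lra.
have c : summ (sqs f) by apply: summ_nneg key; exact: sqs_ge0.
by split; [exact: H2I|rewrite sqnE; exact: tot_le].
Qed.

Lemma circ_mean_near f e : hardy f -> 0 < e ->
  exists2 r0, 0 <= r0 < 1 & forall r, r0 <= r -> r < 1 -> sqn f - e <= circ_mean f r.
Proof.
move=> hf e0; have e2 : 0 < e / 2 by rewrite divr_gt0.
have /cvgrPdist_lt/(_ _ e2)[N _ /(_ N (leqnn _))/= HN] := summ_cvg (H2_summ hf).
rewrite -sqnE in HN.
have s0 := sqn_ge0 hf.
have m0 : 0 < (2 * N)%:R * sqn f + 1 by apply: ltr_wpDl => //; rewrite mulr_ge0.
(* Half of [e] pays for the tail beyond [N], and this [d] keeps the Bernoulli loss 2N d (sqn f)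
   within the other half. *)
pose d := Num.min 1 (e / 2 / ((2 * N)%:R * sqn f + 1)).
have d0 : 0 < d by rewrite lt_min ltr01/= divr_gt0.
have d1 : d <= 1 by rewrite ge_min lexx.
have d2 : d * ((2 * N)%:R * sqn f + 1) <= e / 2.
  by rewrite -ler_pdivlMr// ge_min lexx orbT.
exists (1 - d); first by apply/andP; split; move: d d0 d1 {d2} => d d0 d1; lra.
move=> r dr r1.
have r01 : 0 <= r < 1 by rewrite r1 andbT; move: d d1 dr {d0 d2} => d d1 dr; lra.
apply: le_trans (circ_mean_trunc N (H2_analytic hf) r01).
have h1 : \sum_(k < N) sqs f k <= sqn f by rewrite sqnE; apply: le_tot; [exact: sqs_ge0|exact: H2_summ].
have h2 : 0 <= \sum_(k < N) sqs f k by apply: sumr_ge0 => k _; exact: sqs_ge0.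
have h3 := ltr_normlW HN.
move: d d0 d1 d2 dr h1 h2 h3 s0 (ler0n R (2 * N)) => d.
move: (\sum_(k < N) sqs f k) (sqn f) ((2 * N)%:R : R) => S s m d0 d1 d2 dr h1 h2 h3 s0 m0'.
have h4 : m * (1 - r) * S <= m * d * s.
  by apply: ler_pM => //; [rewrite mulr_ge0//; lra|rewrite ler_wpM2l//; lra].
by rewrite mulrBl mul1r; lra.
Qed.

Lemma cont_circ f r : ana f -> 0 <= r < 1 -> continuous (fun t => cmod (f (rc r * expi t)) ^+ 2).
Proof. by move=> af r01; exact: taylor_cont_cmod2 (coP af) r01. Qed.

(** For a polynomial [p] with |p|^2 <= P on the disc, the loss |p|^2 (1 - |phi|^2) has mean at most
    P (1 - circ_mean phi r), and this tends to 0 as r tends to 1 because [sqn phi = 1]. *)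
Lemma iso_of_sqn1 phi : ana phi -> (forall z, disc z -> cmod (phi z) <= 1) ->
  hardy phi -> sqn phi = 1 -> iso phi.
Proof.
move=> ap p1 hp sp; apply: iso_psum => // c N.
pose p := psum c N; have ap' : ana p by exact: analytic_psum.
have app : ana (fun z => phi z * p z) by exact: analyticM.
have hpp : hardy p by exact: H2_psum.
have up r : 0 <= r < 1 -> circ_mean (fun z => phi z * p z) r <= circ_mean p r.
  move=> r01; apply: mean_le; [exact: cont_circ app r01|exact: cont_circ ap' r01|].
  move=> t; rewrite cmodM exprMn ler_piMl ?exprn_ge0// exprn_ile1// p1//.
  exact: circ_disc.
have [h1 h2] : hardy (fun z => phi z * p z) /\ sqn (fun z => phi z * p z) <= sqn p.
  by apply: hardy_of_means => // r r01; apply: le_trans (up _ r01) (circ_mean_le hpp r01).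
split=> //; apply/eqP; rewrite eq_le h2/=.
pose P := (\sum_(k < N) cmod (c k)) ^+ 2.
have P0 : 0 <= P by rewrite exprn_ge0// sumr_ge0.
have low r : 0 <= r < 1 -> circ_mean p r - P * (1 - circ_mean phi r) <= circ_mean (fun z => phi z * p z) r.
  move=> r01; rewrite /circ_mean.
  have c1 := cont_circ ap r01; have c2 := cont_circ ap' r01; have c3 := cont_circ app r01.
  have c4 : continuous (fun t => 1 - cmod (phi (rc r * expi t)) ^+ 2) by apply: contB => //; exact: cont_cst.
  have c5 : continuous (fun t => P * (1 - cmod (phi (rc r * expi t)) ^+ 2)) by apply: contM => //; exact: cont_cst.
  rewrite -{1}(mean_cst 0 1) -meanB ?mean_cst//; last exact: cont_cst.
  rewrite -meanZ// -meanB//; apply: mean_le => //; first exact: contB.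
  move=> t; have zD : disc (rc r * expi t) by exact: circ_disc.
  rewrite cmodM exprMn.
  have h3 : cmod (p (rc r * expi t)) ^+ 2 <= P.
    by rewrite le_expn2// psum_bdd// ltW.
  have h4 : cmod (phi (rc r * expi t)) ^+ 2 <= 1 by rewrite exprn_ile1// p1.
  move: (cmod (p _) ^+ 2) (cmod (phi _) ^+ 2) h3 h4 => u v; clear; nra.
change (sqn p <= sqn (fun z => phi z * p z)); apply/ler_addgt0Pl => e e0.
have e3 : 0 < e / (P + 2) by rewrite divr_gt0// ltr_wpDl.
have [r1 r101 H1] := circ_mean_near hpp e3.
have [r2 r201 H2] := circ_mean_near hp e3.
pose r := Num.max r1 r2.
have r01 : 0 <= r < 1.
  have [a1 a2] := andP r101; have [b1 b2] := andP r201.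
  by rewrite /r le_max a1 gt_max a2 b2.
have rl1 : r1 <= r by rewrite le_max lexx.
have rl2 : r2 <= r by rewrite le_max lexx orbT.
have rlt : r < 1 by case/andP: r01.
have k1 := H1 r rl1 rlt; have k2 := H2 r rl2 rlt.
have k3 := circ_mean_le h1 r01; have k4 := low r r01.
rewrite sp in k2.
have k5 : P * (1 - circ_mean phi r) <= P * (e / (P + 2)) by rewrite ler_wpM2l//; lra.
have k6 : P * (e / (P + 2)) + e / (P + 2) <= e.
  rewrite -[X in _ + X]mul1r -mulrDl mulrCA ler_piMr ?(ltW e0)// ler_pdivrMr ?mul1r ?ltr_wpDl//.
  by rewrite lerD2l; lra.
move: k1 k3 k4 k5 k6.
move: (circ_mean p r) (circ_mean (fun z => phi z * p z) r) (sqn p) (sqn (fun z => phi z * p z))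
  (P * (1 - _)) (P * (e / (P + 2))) (e / (P + 2)) => *; lra.
Qed.

End Means.

(** * Orthogonality and divisibility *)

Section Model.
Context {R : realType}.
Notation C := (Cplx R).
Implicit Types (f g h x y : C -> C) (a b c : nat -> C) (z w : C) (r t e B : R) (n k N : nat).
Implicit Types (phi psi theta u v F Y : C -> C).

Lemma iso_Xn n : iso (fun z : C => z ^+ n). Proof. exact: isoX (iso_id). Qed.

Lemma co_shiftn f n N : ana f -> co (fun z => z ^+ n * f z) N = if (n <= N)%N then co f (N - n) else 0.
Proof.
move=> af; elim: n N => [|n ih] N.
  by rewrite subn0; under eq_fun do rewrite expr0 mul1r.
under eq_fun do rewrite exprS -mulrA.
rewrite co_shift; last exact: analytic_shiftn.
by case: N => [|N] //; rewrite ih subSS.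
Qed.

Lemma rd_psum_shiftn c N h : hardy h -> rd (psum c N) (fun z => z ^+ N * h z) = 0.
Proof.
move=> hh; rewrite rdE; have [|_ ->] := @summ_finite _ (dts (psum c N) (fun z => z ^+ N * h z)) 0.
  move=> n _; rewrite dtsE co_psum co_shiftn; last exact: H2_analytic.
  by have [nN|nN] := ltnP n N; [rewrite cdotC|]; rewrite cdot0l.
by rewrite big_ord0.
Qed.

Lemma rd_Xn g n : hardy g -> rd (fun z => z ^+ n) g = re (co g n).
Proof.
move=> hg; rewrite rdE.
have E k : co (fun z : C => z ^+ n) k = if (n == k)%N then 1 else 0.
  have -> : (fun z : C => z ^+ n) = (fun z => z ^+ n * 1) by apply/funext => z; rewrite mulr1.
  rewrite (@co_shiftn (fun=> 1)); last exact: analytic_cst.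
  rewrite co_cst; have [nk|nk|->] := ltngtP n k; rewrite ?subnn//.
  by rewrite -(subnSK nk).
have [|_ ->] := @summ_finite _ (dts (fun z => z ^+ n) g) n.+1.
  by move=> k nk; rewrite dtsE E ltn_eqF// cdot0l.
rewrite big_ord_recr/= big1 ?add0r; first by rewrite dtsE E eqxx cdot1r.
by move=> k _; rewrite dtsE E gtn_eqF ?ltn_ord// cdot0l.
Qed.

Lemma H2_sum N (G : nat -> C -> C) : (forall k, hardy (G k)) ->
  hardy (fun z => \sum_(k < N) G k z).
Proof.
move=> h; elim: N => [|N ih].
  by apply: H2_ext (H2_cst 0) => z _; rewrite big_ord0.
by apply: H2_ext (H2D ih (h N)) => z _; rewrite big_ord_recr.
Qed.

Lemma rd_sumr N (G : nat -> C -> C) f : (forall k, hardy (G k)) -> hardy f ->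
  rd f (fun z => \sum_(k < N) G k z) = \sum_(k < N) rd f (G k).
Proof.
move=> h hf; elim: N => [|N ih].
  rewrite big_ord0 rdC (@rd_ext _ _ (fun=> 0) f f)//; last by move=> z _; rewrite big_ord0.
  by rewrite rd_cst ?cdot0l//; exact: H2_analytic.
rewrite big_ord_recr/= -ih -(rdDr (H2_sum N h) (h N) hf).
by apply: rd_ext => // z _; rewrite big_ord_recr.
Qed.

Lemma H2_unshift f : hardy f -> exists g, [/\ hardy g, forall n, co g n = co f n.+1 &
  forall z, disc z -> f z = f 0 + z * g z].
Proof.
move=> hf; have af := H2_analytic hf.
have [g hg gE] := taylor_unshift (coP af).
have cg n : co g n = co f n.+1 by rewrite (coE hg).
exists g; split=> //; last by move=> z zD; rewrite -co0// gE.
apply: H2I; first exact: anaI hg.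
apply: (@summ_nneg _ _ (sqn f)) => [n|N]; first exact: sqs_ge0.
rewrite sqnE; apply: le_trans (le_tot N.+1 (sqs_ge0 f) (H2_summ hf)).
rewrite big_ord_recl/=; apply: ler_wpDl; first exact: sqs_ge0.
by apply: ler_sum => k _; rewrite !sqsE cg.
Qed.

Lemma split_tail f N : hardy f -> exists g, [/\ hardy g, forall n, co g n = co f (n + N) &
  forall z, disc z -> f z = trunc f N z + z ^+ N * g z].
Proof.
move=> hf; elim: N => [|N [g [hg cg gE]]].
  exists f; split=> // [n|z _]; first by rewrite addn0.
  by rewrite /trunc /psum big_ord0 add0r expr0 mul1r.
have [g' [hg' cg' gE']] := H2_unshift hg.
exists g'; split=> // [n|z zD]; first by rewrite cg' cg addSnnS.
rewrite gE// gE'// /trunc /psum big_ord_recr/= -(co0 (H2_analytic hg)) cg add0n exprSr.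
by ring.
Qed.

(** On the circle [psum c N.+1] is z^N times the conjugate of the truncation of theta, so its
    product with theta should be close to z^N. The squared error is exactly the tail of
    [sqn theta = 1]. *)
Lemma trunc_unimodular theta N : iso theta ->
  let c j := cj (co theta (N - j)) in
  sqn (fun z => z ^+ N - theta z * psum c N.+1 z) = 1 - \sum_(k < N.+1) sqs theta k.
Proof.
move=> it c; have hX := iso_H2 (iso_Xn N); have hp := H2_psum c N.+1.
have ht := iso_H2 it; have htp := isoH it hp.
rewrite sqnB// (isoN it hp) (iso_sqn (iso_Xn N)) sqn_psum.
have rev : \sum_(k < N.+1) cmod (c k) ^+ 2 = \sum_(k < N.+1) sqs theta k.
  rewrite (reindex_inj rev_ord_inj)/=; apply: eq_bigr => k _.
  by rewrite /c cmod_cj sqsE subSS subKn// -ltnS ltn_ord.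
have hk k : hardy (fun z => c k * (z ^+ k * theta z)).
  by apply: H2Z; exact: isoH (iso_Xn k) ht.
have -> : rd (fun z => z ^+ N) (fun z => theta z * psum c N.+1 z) = \sum_(k < N.+1) sqs theta k.
  have -> : rd (fun z => z ^+ N) (fun z => theta z * psum c N.+1 z) =
      rd (fun z => z ^+ N) (fun z => \sum_(k < N.+1) c k * (z ^+ k * theta z)).
    apply: rd_ext => // z _; rewrite /psum mulr_sumr; apply: eq_bigr => k _; by ring.
  rewrite (rd_sumr N.+1 hk hX) -rev; apply: eq_bigr => k _.
  rewrite rd_Xn// coZ; last exact: analytic_shiftn (H2_analytic ht).
  rewrite co_shiftn; last exact: H2_analytic.
  rewrite -ltnS ltn_ord /c.
  by rewrite cmod_cj cmod_sq !reimE; ring.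
by rewrite rev; move: (\sum_(k < _) _) => S; ring.
Qed.

Lemma psum_mul_bound c N : exists2 B, 0 <= B & forall y, hardy y ->
  hardy (fun z => psum c N z * y z) /\ sqn (fun z => psum c N z * y z) <= B * sqn y.
Proof.
elim: N => [|N [B B0 HB]].
  exists 0 => // y hy; have h0 : hardy (fun z => psum c 0 z * y z).
    by apply: H2_ext (H2_cst 0) => z _; rewrite /psum big_ord0 mul0r.
  have -> : sqn (fun z => psum c 0 z * y z) = sqn (fun=> 0).
    by apply: sqn_ext => z _; rewrite /psum big_ord0 mul0r.
  by split=> //; rewrite mul0r sqn_cst cmod0 expr0n.
exists (2 * B + 2 * cmod (c N) ^+ 2).
  by rewrite addr_ge0// mulr_ge0// exprn_ge0.
move=> y hy; have [h1 h2] := HB y hy.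
have h3 := isoH (iso_Xn N) hy; have h4 := H2Z (c N) h3.
have E z : disc z -> psum c N z * y z + c N * (z ^+ N * y z) = psum c N.+1 z * y z.
  by move=> _; rewrite /psum big_ord_recr/=; ring.
split; first exact: H2_ext E (H2D h1 h4).
rewrite -(sqn_ext E); apply: (le_trans (sqnD_le h1 h4)).
rewrite sqnZ// (isoN (iso_Xn N) hy); move: h2; move: (sqn y) (sqn _) (cmod _ ^+ 2) => s s' q h2.
by lra.
Qed.

(* As [n] grows, [z ^+ n * x] approaches the range of multiplication by [theta]. *)
Lemma iso_range_approx theta x e : iso theta -> hardy x -> 0 < e ->
  exists N p, hardy p /\ sqn (fun z => z ^+ N * x z - theta z * p z) <= e.
Proof.
move=> it hx e0; have e4 : 0 < e / 4 by rewrite divr_gt0.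
have /cvgrPdist_lt/(_ _ e4)[M _ /(_ M (leqnn _))/=] := trunc_cvg hx.
have hxM := H2B hx (H2_trunc x M).
rewrite sub0r normrN ger0_norm ?sqn_ge0// => hM.
(* [M] is fixed before [N]: the norm [B] of multiplication by the truncation of [x] depends on it,
   and [N] is then chosen so that the error of [trunc_unimodular], multiplied by [B], is small. *)
have [B B0 HB] := psum_mul_bound (co x) M.
have B1 : 0 < B + 1 by rewrite ltr_wpDl.
have e5 : 0 < e / 4 / (B + 1) by rewrite divr_gt0.
have hs := summ_cvg (H2_summ (iso_H2 it)).
rewrite -sqnE iso_sqn// in hs.
have /cvgrPdist_lt/(_ _ e5)[N _ /(_ N.+1 (leqnSn _))/= /ltr_normlW hN] := hs.
pose c j := cj (co theta (N - j)).
pose d z := z ^+ N - theta z * psum c N.+1 z.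
have hd : hardy d by apply: H2B; [exact: iso_H2 (iso_Xn N)|exact: isoH (H2_psum _ _)].
have sd : sqn d <= e / 4 / (B + 1).
  by rewrite (trunc_unimodular N it) ltW.
have [h1 h2] := HB d hd.
have [hp _] := HB (psum c N.+1) (H2_psum _ _).
exists N, (fun z => psum (co x) M z * psum c N.+1 z); split=> //.
have h3 := isoH (iso_Xn N) hxM.
have -> : sqn (fun z => z ^+ N * x z - theta z * (psum (co x) M z * psum c N.+1 z)) =
    sqn (fun z => z ^+ N * (x z - trunc x M z) + psum (co x) M z * d z).
  by apply: sqn_ext => z _; rewrite /d /trunc; ring.
apply: (le_trans (sqnD_le h3 h1)); rewrite (isoN (iso_Xn N) hxM).
have h4 : B * sqn d <= e / 4.
  apply: (@le_trans _ _ ((B + 1) * (e / 4 / (B + 1)))); last by rewrite mulrC divfK// gt_eqF.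
  by apply: ler_pM => //; [exact: sqn_ge0|rewrite lerDl].
by move: hM h2 h4; move: (sqn _) (sqn _) (B * _) => *; lra.
Qed.

(** A finite form of the statement that conj(theta) g lies in conj(z H^2): the polynomial has degree
    below [N]. It is the truncation of the [p] given by [iso_range_approx]. The discarded part theta
    z^N q is orthogonal to z^N g by hypothesis and to theta times the truncation by degree, so
    dropping it can only shrink the norm. *)
Lemma model_approx theta g e : iso theta -> hardy g ->
  (forall h, hardy h -> rd g (fun z => theta z * h z) = 0) -> 0 < e ->
  exists N c, sqn (fun z => z ^+ N * g z - theta z * psum c N z) <= e.
Proof.
move=> it hg og e0; have [N [p [hp hN]]] := iso_range_approx it hg e0.
exists N, (co p); have [q [hq _ pE]] := split_tail N hp.
apply: le_trans hN.
have hX := isoH (iso_Xn N) hg.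
have ht := isoH it (H2_trunc p N).
have hXq := isoH (iso_Xn N) hq.
have htq := isoH it hXq.
have hA := H2B hX ht.
have -> : sqn (fun z => z ^+ N * g z - theta z * p z) =
   sqn (fun z => (z ^+ N * g z - theta z * trunc p N z) - theta z * (z ^+ N * q z)).
  by apply: sqn_ext => z zD; rewrite pE//; ring.
rewrite (sqnB hA htq) (rdBl hX ht htq) (iso_rd it (H2_trunc p N) hXq) (rd_psum_shiftn _ _ hq).
have -> : rd (fun z => z ^+ N * g z) (fun z => theta z * (z ^+ N * q z)) = 0.
  rewrite -(og _ hq) -(iso_rd (iso_Xn N) hg (isoH it hq)).
  by apply: rd_ext => // z _; ring.
by rewrite subr0 mulr0 subr0 lerDl sqn_ge0.
Qed.

Lemma eq0_of_sq_le (q B : R) : (forall e, 0 < e -> q ^+ 2 <= B * e) -> q = 0.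
Proof.
move=> h; apply/eqP; rewrite -sqrf_eq0 eq_le sqr_ge0 andbT.
have [B0|B0] := leP B 0.
  by apply: le_trans (h 1 ltr01) _; rewrite mulr1.
apply/ler_addgt0Pl => e e0; rewrite addr0.
by have := h (e / B) (divr_gt0 e0 B0); rewrite mulrC divfK// gt_eqF.
Qed.

Lemma iso_comp theta psi : iso theta -> iso psi -> cmod (psi 0) < 1 -> iso (fun z => theta (psi z)).
Proof.
move=> it ip p1; have hs := iso_selfmap ip p1.
apply: iso_of_sqn1.
- exact: (analytic_comp (H2_analytic (iso_H2 it)) hs).
- by move=> z zD; apply: iso_le1 => //; exact: selfmap_disc.
- exact: H2_comp (iso_H2 it).
- exact: sqn_comp_iso.
Qed.

(** Both sides are multiplied by psi^N. Then psi^N g(psi) equals theta(psi) p(psi) up to an error of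
    small norm by [littlewood], and the main term is exactly orthogonal because deg p < N. *)
Lemma model_comp_orth theta psi g G : iso theta -> iso psi -> cmod (psi 0) < 1 -> hardy g ->
  (forall h, hardy h -> rd g (fun z => theta z * h z) = 0) -> hardy G ->
  rd (fun z => psi z * g (psi z)) (fun z => z * (theta (psi z) * G z)) = 0.
Proof.
move=> it ip p1 hg og hG; have itp := iso_comp it ip p1.
pose K := (1 - cmod (psi 0) ^+ 2) / (1 - cmod (psi 0)) ^+ 2.
have hg' := H2_comp ip p1 hg.
have htG := isoH itp hG.
have hztG := H2_shift htG.
apply: (@eq0_of_sq_le _ (K * sqn G)) => e e0.
have [N [c hN]] := model_approx it hg og e0.
pose d z := z ^+ N * g z - theta z * psum c N z.
have hd : hardy d by apply: H2B; [exact: isoH (iso_Xn N) hg|exact: isoH it (H2_psum _ _)].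
have [hd' sd'] := littlewood ip p1 hd.
have hpd := isoH ip hd'.
have hR := isoH (isoX N ip) hztG.
have hp' := H2_psum_comp ip c N.
have hpp' := isoH ip hp'.
have ht' := isoH itp hpp'.
have hL := isoH (isoX N ip) (isoH ip hg').
have -> : rd (fun z => psi z * g (psi z)) (fun z => z * (theta (psi z) * G z)) =
    rd (fun z => psi z * d (psi z)) (fun z => psi z ^+ N * (z * (theta (psi z) * G z))).
  rewrite -(iso_rd (isoX N ip) (isoH ip hg') hztG).
  have -> : rd (fun z => psi z * d (psi z)) (fun z => psi z ^+ N * (z * (theta (psi z) * G z))) =
     rd (fun z => psi z ^+ N * (psi z * g (psi z)) - theta (psi z) * (psi z * psum c N (psi z)))
     (fun z => psi z ^+ N * (z * (theta (psi z) * G z))).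
    by apply: rd_ext => // z _; rewrite /d; ring.
  rewrite (rdBl hL ht' hR).
  suff -> : rd (fun z => theta (psi z) * (psi z * psum c N (psi z)))
      (fun z => psi z ^+ N * (z * (theta (psi z) * G z))) = 0 by rewrite subr0.
  have hzG := H2_shift hG.
  have hXzG := isoH (isoX N ip) hzG.
  have -> : rd (fun z => theta (psi z) * (psi z * psum c N (psi z)))
      (fun z => psi z ^+ N * (z * (theta (psi z) * G z))) =
      rd (fun z => theta (psi z) * (psi z * psum c N (psi z)))
      (fun z => theta (psi z) * (psi z ^+ N * (z * G z))).
    by apply: rd_ext => // z _; ring.
  rewrite (iso_rd itp hpp' hXzG) rdC.
  have hk k : hardy (fun z => c k * psi z ^+ k.+1) by apply: H2Z; exact: iso_H2 (isoX _ ip).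
  have -> : rd (fun z => psi z ^+ N * (z * G z)) (fun z => psi z * psum c N (psi z)) =
     rd (fun z => psi z ^+ N * (z * G z)) (fun z => \sum_(k < N) c k * psi z ^+ k.+1).
    apply: rd_ext => // z _; rewrite /psum mulr_sumr; apply: eq_bigr => k _.
    by rewrite exprS; ring.
  (* As k < N, the power psi^(k+1) divides psi^N; after cancelling it, a multiple of z is paired
     with a constant. *)
  rewrite (rd_sumr N hk hXzG) big1// => k _.
  have hc : hardy (fun=> c k) by exact: H2_cst.
  have hX := isoH (isoX (N - k.+1) ip) hzG.
  have -> : rd (fun z => psi z ^+ N * (z * G z)) (fun z => c k * psi z ^+ k.+1) =
     rd (fun z => psi z ^+ k.+1 * (psi z ^+ (N - k.+1) * (z * G z))) (fun z => psi z ^+ k.+1 * c k).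
    apply: rd_ext => z _; last by rewrite mulrC.
    by rewrite [RHS]mulrA -exprD subnKC// ltn_ord.
  rewrite (iso_rd (isoX k.+1 ip) hX hc) rdC rd_cst; last exact: H2_analytic.
  by rewrite mul0r mulr0 cdotC cdot0l.
apply: le_trans (cauchy_schwarz hpd hR) _.
rewrite (isoN ip hd') (isoN (isoX N ip) hztG) (sqn_shift htG) (isoN itp hG).
rewrite mulrAC; apply: ler_wpM2r; first exact: sqn_ge0.
apply: le_trans sd' _; apply: ler_wpM2l => //; exact: littlewood_const_ge0.
Qed.

(** The approximate preimages form a Cauchy sequence because [phi] is isometric. Their limit is
    built from the limits of the coefficients. *)
Lemma iso_range_closed phi y : iso phi -> hardy y ->
  (forall e, 0 < e -> exists h, hardy h /\ sqn (fun z => y z - phi z * h z) <= e) ->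
  exists2 h, hardy h & forall z, disc z -> y z = phi z * h z.
Proof.
move=> ip hy H.
have ek (k : nat) : 0 < k.+1%:R^-1 :> R by rewrite invr_gt0.
have [hh hP] := @choice _ _ (fun k h => hardy h /\ sqn (fun z => y z - phi z * h z) <= k.+1%:R^-1) (fun k => H _ (ek k)).
have hk k := (hP k).1; have sk k := (hP k).2.
have hph k := isoH ip (hk k).
have hdif k l : hardy (fun z => hh k z - hh l z) by exact: H2B.
have dif k l : sqn (fun z => hh k z - hh l z) <= 2 * k.+1%:R^-1 + 2 * l.+1%:R^-1.
  rewrite -(isoN ip (hdif k l)).
  have -> : sqn (fun z => phi z * (hh k z - hh l z)) =
     sqn (fun z => (y z - phi z * hh l z) - (y z - phi z * hh k z)).
    by apply: sqn_ext => z _; ring.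
  apply: (le_trans (sqnB_le (H2B hy (hph l)) (H2B hy (hph k)))).
  by have := sk k; have := sk l; move: (sqn _) (sqn _) (_ ^-1) (_ ^-1) => p q i j; lra.
have inv_small e : 0 < e -> exists N, forall k, (N <= k)%N -> k.+1%:R^-1 < e.
  move=> e0; have /cvgrPdist_lt/(_ _ e0)[N _ HN] := @cvg_harmonic R.
  exists N => k Nk; have := HN k Nk; rewrite /harmonic/= sub0r normrN.
  by apply: le_lt_trans; exact: ler_norm.
have ex n : exists l : C, (fun k => co (hh k) n) @ \oo --> l.
  apply: cvgC_cauchy => e e0.
  have [N HN] := inv_small (e ^+ 2 / 4) (divr_gt0 (exprn_gt0 _ e0) (ltr0Sn _ _)).
  exists N => k Nk.
  rewrite -(@ltr_pXn2r _ 2) ?nnegrE ?(ltW e0)//.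
  have := co_sq_le n (hdif N k); rewrite coB; [|exact: H2_analytic..].
  move=> h1; apply: (le_lt_trans h1); apply: (le_lt_trans (dif N k)).
  have := HN N (leqnn _); have := HN k Nk; move: (N.+1%:R^-1) (k.+1%:R^-1) (e ^+ 2) => i j q; lra.
have [a ha] := @choice _ _ _ ex.
pose B := 2 * sqn y + 2.
have sB k : sqn (hh k) <= B.
  rewrite -(isoN ip (hk k)).
  have -> : sqn (fun z => phi z * hh k z) = sqn (fun z => y z - (y z - phi z * hh k z)).
    by apply: sqn_ext => z _; ring.
  apply: (le_trans (sqnB_le hy (H2B hy (hph k)))); rewrite /B lerD2l.
  rewrite -[leRHS]mulr1 ler_pM2l//; apply: le_trans (sk k) _.
  by rewrite invf_le1// ler1n.
have B0 : 0 <= B by rewrite addr_ge0// mulr_ge0// sqn_ge0.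
have ra : radc a.
  move=> r /andP[r0 r1]; exists (B + 1) => n.
  have h1 : cmod (a n) <= B + 1.
    have c : (fun k => cmod (co (hh k) n)) @ \oo --> cmod (a n) by exact: (cvg_cmod (ha n)).
    rewrite -(cvg_lim _ c)//.
    apply: limr_le; first by apply/cvg_ex; eexists; exact: c.
    apply: nearW => k /=.
    have := le_trans (co_sq_le n (hk k)) (sB k); have := cmod_ge0 (co (hh k) n).
    by move: (cmod _) (B) B0; clear => u v v0 u0 h; nra.
  apply: le_trans h1; rewrite ler_piMr// exprn_ile1// ltW//.
have [h hE] := radc_taylor ra.
have ah : ana h by exact: anaI hE.
have cE := coE hE.
have [hh' _] : hardy h /\ sqn h <= B.
  by apply: (@H2_lim _ hh h B hk sB ah) => n; rewrite cE; exact: ha.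
exists h; first exact: hh'.
(* Starting at index [l + k] makes the bound 2/(l + k + 1) + 2/(k + 1) at most 4/(k + 1) for all
   [l], as [H2_lim] requires. *)
have lim k : sqn (fun z => h z - hh k z) <= 4 * k.+1%:R^-1.
  have hd l : hardy (fun z => hh (l + k)%N z - hh k z) by [].
  suff [] : hardy (fun z => h z - hh k z) /\ sqn (fun z => h z - hh k z) <= 4 * k.+1%:R^-1 by [].
  apply: (@H2_lim _ (fun l z => hh (l + k)%N z - hh k z) _ _ hd).
  - move=> l; apply: (le_trans (dif _ _)).
    have : (l + k).+1%:R^-1 <= k.+1%:R^-1 :> R by rewrite lef_pV2 ?posrE// ler_nat ltnS leq_addl.
    by move: (_^-1) (_^-1) => i j; lra.
  - by apply: analyticB => //; exact: H2_analytic.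
  - move=> n; rewrite coB ?cE//; last exact: H2_analytic.
    have -> : (fun l => co (fun z => hh (l + k)%N z - hh k z) n) = (fun l => co (hh (l + k)%N) n - co (hh k) n).
      by apply/funext => l; rewrite coB//; exact: H2_analytic.
    apply: cvgB; last exact: cvg_cst.
    by have := ha n; rewrite -(cvg_shiftn k).
have hph' := isoH ip hh'.
have hfin := H2B hy hph'.
suff s0 : sqn (fun z => y z - phi z * h z) = 0.
  by move=> z zD; apply/eqP; rewrite -subr_eq0; apply/eqP; exact: (sqn_eq0 hfin s0).
apply/eqP; rewrite eq_le sqn_ge0// andbT; apply/ler_addgt0Pl => e e0; rewrite addr0.
(* The two errors contribute 2/(k + 1) and 8/(k + 1). *)
have [k /(_ k (leqnn _)) hk'] := inv_small (e / 10) (divr_gt0 e0 (ltr0Sn _ _)).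
have -> : sqn (fun z => y z - phi z * h z) = sqn (fun z => (y z - phi z * hh k z) - phi z * (h z - hh k z)).
  by apply: sqn_ext => z _; ring.
have hd2 := H2B hh' (hk k).
apply: (le_trans (sqnB_le (H2B hy (hph k)) (isoH ip hd2))).
rewrite (isoN ip hd2); have := sk k; have := lim k.
by move: (sqn _) (sqn _) (_^-1) hk' => p q i; lra.
Qed.

(** Orthogonality of F to Y H^2 means that conj(F) Y lies in z H^2 on the circle. Here z^N Y is
    approximated by F p, the low part of [p] is discarded by orthogonality, and after division by
    z^N closedness of the range of z F concludes. *)
Lemma iso_factor F Y : iso F -> iso Y ->
  (forall h, hardy h -> rd F (fun z => Y z * h z) = 0) ->
  exists2 h, hardy h & forall z, disc z -> Y z = z * F z * h z.
Proof.
move=> iF iY o.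
have izF : iso (fun z => z * F z) by apply: isoM => //; exact: iso_id.
apply: iso_range_closed => //; first exact: iso_H2.
move=> e e0; have hY := iso_H2 iY.
have [N [p [hp hN]]] := iso_range_approx iF hY e0.
(* Cutting at N + 1 rather than N produces the additional factor z. It is allowed because z^N Y is
   orthogonal to z^k F for every k <= N, including k = N. *)
have [q [hq _ pE]] := split_tail N.+1 hp.
exists q; split=> //; apply: le_trans hN.
have hzFq := isoH izF hq.
have hXY := isoH (iso_Xn N) hY.
have hX := isoH (iso_Xn N) hzFq.
have ht := isoH iF (H2_trunc p N.+1).
have hA := H2B hXY hX.
rewrite -(isoN (iso_Xn N) (H2B hY hzFq)).
have -> : sqn (fun z => z ^+ N * (Y z - z * F z * q z)) = sqn (fun z => z ^+ N * Y z - z ^+ N * (z * F z * q z)).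
  by apply: sqn_ext => z _; ring.
have -> : sqn (fun z => z ^+ N * Y z - F z * p z) =
   sqn (fun z => (z ^+ N * Y z - z ^+ N * (z * F z * q z)) - F z * trunc p N.+1 z).
  by apply: sqn_ext => z zD; rewrite pE// exprSr; ring.
rewrite (sqnB hA ht) (rdBl hXY hX ht).
have -> : rd (fun z => z ^+ N * (z * F z * q z)) (fun z => F z * trunc p N.+1 z) = 0.
  rewrite -(rd_psum_shiftn (co p) N.+1 hq) -(iso_rd iF (H2_trunc p N.+1) (isoH (iso_Xn N.+1) hq)) rdC.
  by apply: rd_ext => // z _; rewrite exprSr; ring.
suff -> : rd (fun z => z ^+ N * Y z) (fun z => F z * trunc p N.+1 z) = 0.
  by rewrite subr0 mulr0 subr0 lerDl sqn_ge0.
have hk k : hardy (fun z => co p k * (z ^+ k * F z)).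
  by apply: H2Z; exact: isoH (iso_Xn k) (iso_H2 iF).
have -> : rd (fun z => z ^+ N * Y z) (fun z => F z * trunc p N.+1 z) =
   rd (fun z => z ^+ N * Y z) (fun z => \sum_(k < N.+1) co p k * (z ^+ k * F z)).
  by apply: rd_ext => // z _; rewrite /trunc /psum mulr_sumr; apply: eq_bigr => k _; ring.
rewrite (rd_sumr N.+1 hk hXY) big1// => k _.
have hXN := isoH (iso_Xn (N - k)) hY.
have hw : hardy (fun z => cj (co p k) * z ^+ (N - k)) by apply: H2Z; exact: iso_H2 (iso_Xn _).
rewrite rdC rdZl//; last exact: isoH (iso_Xn k) (iso_H2 iF).
have -> : rd (fun z => z ^+ k * F z) (fun z => cj (co p k) * (z ^+ N * Y z)) =
   rd (fun z => z ^+ k * F z) (fun z => z ^+ k * (Y z * (cj (co p k) * z ^+ (N - k)))).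
  apply: rd_ext => // z _.
  have kN : (k <= N)%N by rewrite -ltnS.
  have -> : z ^+ N = z ^+ k * z ^+ (N - k) by rewrite -exprD subnKC.
  by ring.
by rewrite (iso_rd (iso_Xn k) (iso_H2 iF) (isoH iY hw)) o.
Qed.

(* The hypothesis gives [<F, Y h> = <F, Y (cj c * theta h)>] with [F = theta * u];
   the factor [cj c] of modulus below 1 makes the iterates vanish. *)
Lemma orth_absorb theta u Y (c : C) : iso theta -> iso u -> iso Y -> cmod c < 1 ->
  (forall h, hardy h -> rd (fun z => theta z * u z - c * u z) (fun z => Y z * h z) = 0) ->
  forall h, hardy h -> rd (fun z => theta z * u z) (fun z => Y z * h z) = 0.
Proof.
move=> it iu iY c1 o.
have iF := isoM it iu; have hF := iso_H2 iF; have hu := iso_H2 iu.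
have step h : hardy h -> rd (fun z => theta z * u z) (fun z => Y z * h z) =
    rd (fun z => theta z * u z) (fun z => Y z * (cj c * (theta z * h z))).
  move=> hh; have hY := isoH iY hh; have := o h hh.
  rewrite (rdBl hF (H2Z c hu) hY) => /eqP; rewrite subr_eq0 => /eqP ->.
  rewrite -(iso_rd it (H2Z c hu) hY).
  have -> : rd (fun z => theta z * (c * u z)) (fun z => theta z * (Y z * h z)) =
     rd (fun z => c * (theta z * u z)) (fun z => theta z * (Y z * h z)).
    by apply: rd_ext => // z _; ring.
  rewrite rdZl//; last exact: isoH.
  by apply: rd_ext => // z _; ring.
have stepn n h : hardy h -> rd (fun z => theta z * u z) (fun z => Y z * h z) =
    rd (fun z => theta z * u z) (fun z => Y z * (cj c ^+ n * (theta z ^+ n * h z))).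
  elim: n h => [|n ih] h hh.
    by apply: rd_ext => // z _; rewrite !expr0 !mul1r.
  rewrite step// ih; last by apply: H2Z; exact: isoH.
  by apply: rd_ext => // z _; rewrite !exprSr; ring.
move=> h hh; apply: (@eq0_of_sq_le _ (sqn h)) => e e0.
have /cvgCP/(_ (Num.min 1 e)) := cvgC_expr c1.
rewrite lt_min ltr01 e0 => /(_ isT)[n _ /(_ n (leqnn _))/=].
rewrite sub0r cmodN cmodX lt_min => /andP[n1 n2].
have hth := isoH (isoX n it) hh.
have hcth := H2Z (cj c ^+ n) hth.
rewrite (stepn n)//; apply: le_trans (cauchy_schwarz hF (isoH iY hcth)) _.
rewrite (iso_sqn iF) mul1r (isoN iY hcth) sqnZ// (isoN (isoX n it) hh) cmodX cmod_cj mulrC.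
apply: ler_wpM2l; first exact: sqn_ge0.
by rewrite expr2; apply: (le_trans _ (ltW n2)); rewrite ler_piMl ?exprn_ge0// ltW.
Qed.

End Model.

(** * Fatou's theorem *)

Section AlmostEverywhere.
Context {R : realType}.
Notation mu := (@lebesgue_measure R).

Lemma ae_imp (P Q : R -> Prop) : (forall t, P t -> Q t) ->
  {ae mu, forall t, P t} -> {ae mu, forall t, Q t}.
Proof. by move=> PQ; apply: (@filterS _ _ (ae_filter_ringOfSetsType mu)). Qed.

Lemma ae_and (P Q : R -> Prop) : {ae mu, forall t, P t} -> {ae mu, forall t, Q t} ->
  {ae mu, forall t, P t /\ Q t}.
Proof. by move=> p q; apply: (@filterI _ _ (ae_filter_ringOfSetsType mu)). Qed.

Lemma ae_all (P : R -> Prop) : (forall t, P t) -> {ae mu, forall t, P t}.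
Proof.
by move=> p; apply: (@filterS _ _ (ae_filter_ringOfSetsType mu) setT) => //; apply: (@filterT _ _ (ae_filter_ringOfSetsType mu)).
Qed.

End AlmostEverywhere.

(** * Integrable functions on a period and dominated convergence *)

Section Integration.
Context {R : realType}.
Notation C := (Cplx R).
Notation mu := (@lebesgue_measure R).
Implicit Types (g h : R -> R) (c t x B : R).

Definition intg c h := mu.-integrable (arc c) (EFin \o h).

Lemma arcE c t : arc c t = (c <= t <= c + 2 * pi) :> Prop.
Proof. by rewrite /arc /= in_itv. Qed.

Lemma intgD c g h : intg c g -> intg c h -> intg c (fun t => g t + h t).
Proof. by move=> ig ih; exact: (integrableD (measurable_arc c) ig ih). Qed.

Lemma intgZ c x h : intg c h -> intg c (fun t => x * h t).
Proof. by move=> ih; exact: (integrableZl (measurable_arc c) x ih). Qed.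

Lemma intgB c g h : intg c g -> intg c h -> intg c (fun t => g t - h t).
Proof. by move=> ig ih; exact: (integrableB (measurable_arc c) ig ih). Qed.

Lemma intg_cont c h : continuous h -> intg c h.
Proof. exact: cont_integrable. Qed.

Lemma intg_bdd c h B : measurable_fun setT h -> (forall t, arc c t -> `|h t| <= B) -> intg c h.
Proof.
move=> mh hB; apply: measurable_bounded_integrable.
- exact: measurable_arc.
- by have := ltry (2 * pi : R); rewrite -(mu_arc c).
- exact: measurable_funS mh.
- exists B; split; first by rewrite num_real.
  by move=> M BM t /= tA; apply: le_trans (hB _ tA) (ltW BM).
Qed.

Lemma imeanD c g h : intg c g -> intg c h ->
  mean c (fun t => g t + h t) = mean c g + mean c h.
Proof. by move=> ig ih; rewrite /mean (RintegralD (measurable_arc c))// mulrDr. Qed.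

Lemma imeanB c g h : intg c g -> intg c h ->
  mean c (fun t => g t - h t) = mean c g - mean c h.
Proof. by move=> ig ih; rewrite /mean (RintegralB (measurable_arc c))// mulrBr. Qed.

Lemma imeanZ c x h : intg c h -> mean c (fun t => x * h t) = x * mean c h.
Proof. by move=> ih; rewrite /mean (RintegralZl _ (measurable_arc c))// mulrCA. Qed.

Lemma imean_le c g h : intg c g -> intg c h -> (forall t, arc c t -> g t <= h t) ->
  mean c g <= mean c h.
Proof.
move=> ig ih gh; rewrite /mean ler_pM2l ?invr_gt0 ?pi2_gt0//.
exact: (le_Rintegral (measurable_arc c)).
Qed.

Lemma meas_cont h : continuous h -> measurable_fun setT h.
Proof. exact: continuous_measurable_fun. Qed.

Lemma mean_dct c (u : nat -> R -> R) g B :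
  (forall k, measurable_fun setT (u k)) -> measurable_fun setT g ->
  (forall k t, arc c t -> `|u k t| <= B) ->
  {ae mu, forall t, arc c t -> (fun k => u k t) @ \oo --> g t} ->
  intg c g /\ (fun k => mean c (u k)) @ \oo --> mean c g.
Proof.
move=> mu_ mg uB ug.
have mA := measurable_arc c.
have iB : mu.-integrable (arc c) (EFin \o fun=> B) by apply: cont_integrable; exact: cont_cst.
have [||||| ig _ cvgI] := @dominated_convergence _ _ R mu (arc c) mA
    (fun k => EFin \o u k) (EFin \o g) (EFin \o fun=> B).
- move=> k; apply/measurable_EFinP; exact: measurable_funS (mu_ k).
- by apply/measurable_EFinP; exact: measurable_funS mg.
- apply: ae_imp ug => t h At; apply: cvg_EFin; last exact: h.
  by apply: nearW.
- exact: iB.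
- by apply: ae_all => t k At; rewrite /= lee_fin uB.
split; first exact: ig.
have iu k : mu.-integrable (arc c) (EFin \o u k) by apply: (@intg_bdd c _ B) => // t; exact: uB.
apply: cvgM; first exact: cvg_cst.
apply: fine_cvg.
rewrite fineK; last by apply: integrable_fin_num.
exact: cvgI.
Qed.

Definition rk (k : nat) : R := 1 - k.+1%:R^-1.

Lemma rk01 k : 0 <= rk k < 1.
Proof.
by rewrite /rk subr_ge0 invf_le1 ?ler1n//= ltrBlDr ltrDl invr_gt0.
Qed.

Lemma rk_cvg : rk @ \oo --> (1 : R).
Proof.
rewrite -[X in _ --> X]subr0; apply: cvgB; first exact: cvg_cst.
exact: cvg_harmonic.
Qed.

Lemma radial_seq (p : R -> C) (l : C) (u : nat -> R) : p r @[r --> (1 : R)^'-] --> l ->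
  (forall k, u k < 1) -> u @ \oo --> (1 : R) -> (fun k => p (u k)) @ \oo --> l.
Proof.
move=> h u1 cu; apply: cvg_reim.
  exact: (cvg_at_leftP _ _ _).1 (cvg_re h) u (conj u1 cu).
exact: (cvg_at_leftP _ _ _).1 (cvg_im h) u (conj u1 cu).
Qed.

End Integration.

(** * Inner functions are isometric multipliers *)

Section InnerIso.
Context {R : realType}.
Notation C := (Cplx R).
Notation mu := (@lebesgue_measure R).
Implicit Types (f g phi : C -> C) (z w l : C) (c t x B r e : R).

Lemma circ_mean_cvg f (u : nat -> R) : hardy f -> (forall k, 0 <= u k < 1) -> u @ \oo --> (1 : R) ->
  (fun k => circ_mean f (u k)) @ \oo --> sqn f.
Proof.
move=> hf u01 cu; apply/cvgrPdist_le => e e0.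
have [r0 /andP[r00 r01] H] := circ_mean_near hf e0.
have d0 : 0 < 1 - r0 by rewrite subr_gt0.
have /cvgrPdist_lt/(_ _ d0) := cu; apply: filterS => k /ltr_normlW hk.
have := circ_mean_le hf (u01 k); have [u0 u1] := andP (u01 k).
have := H (u k) _ u1; move=> /(_ ltac:(lra)).
by move: (circ_mean _ _) (sqn f) => x y h1 h2; rewrite ler_norml; apply/andP; split; lra.
Qed.

Lemma inner_radial phi : inner phi ->
  {ae mu, forall t, arc 0 t -> exists2 l : C, cmod l = 1 & (fun k => phi (rc (rk k) * expi t)) @ \oo --> l}.
Proof.
case=> _ _; apply: ae_imp => t h; rewrite arcE add0r => /h[l l1 hl].
exists l => //; apply: (radial_seq hl); last exact: rk_cvg.
by move=> k; case/andP: (@rk01 R k).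
Qed.

Lemma expi_cvg t : (fun k => rc (rk k) * expi t) @ \oo --> rc 1 * expi t.
Proof.
apply: cvgM; last exact: cvg_cst.
by apply: cvg_reim; [exact: rk_cvg|exact: cvg_cst].
Qed.

Lemma inner_iso phi : inner phi -> iso phi.
Proof.
move=> iphi; have [aphi [M HM] _] := iphi; rewrite ana_def in aphi.
apply: iso_psum => // c N; pose p := psum c N.
have ap : ana p by exact: analytic_psum.
have app : ana (fun z => phi z * p z) by exact: analyticM.
have M0 : 0 <= M by apply: le_trans (HM 0 _) => //; rewrite cmod_lt_disc cmod0.
pose P := \sum_(k < N) cmod (c k).
have P0 : 0 <= P by exact: sumr_ge0.
have bd z : disc z -> cmod (phi z * p z) ^+ 2 <= (M * P) ^+ 2.
  move=> zD; apply: le_expn2 => //; rewrite cmodM; apply: ler_pM => //; first exact: HM.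
  by apply: psum_bdd; exact: ltW.
have hpp : hardy (fun z => phi z * p z).
  have [] // := @hardy_of_means _ (fun z => phi z * p z) ((M * P) ^+ 2) app.
  move=> r r01; rewrite -(mean_cst 0 ((M * P) ^+ 2)); apply: mean_le.
  - exact: (cont_circ app r01).
  - exact: cont_cst.
  - by move=> t; apply: bd; exact: circ_disc.
split=> //.
have c1 := circ_mean_cvg hpp (@rk01 R) rk_cvg.
have [||||_ c2] := @mean_dct R 0 (fun k t => cmod (phi (rc (rk k) * expi t) * p (rc (rk k) * expi t)) ^+ 2)
   (fun t => cmod (p (rc 1 * expi t)) ^+ 2) ((M * P) ^+ 2).
- by move=> k; apply: meas_cont; exact: cont_circ app (rk01 k).
- by apply: meas_cont; apply: cont_cmod2; [exact: cont_re_psum|exact: cont_im_psum].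
- move=> k t _; rewrite ger0_norm ?exprn_ge0//; apply: bd; apply: circ_disc; exact: rk01.
- apply: ae_imp (inner_radial iphi) => t h /h[l l1 hl].
  have hp : (fun k => p (rc (rk k) * expi t)) @ \oo --> p (rc 1 * expi t).
    apply: (@cvg_comp _ _ _ (fun k => rc (rk k) * expi t) p); first exact: expi_cvg.
    exact: psum_cont.
  have h2 : (fun k => cmod (phi (rc (rk k) * expi t) * p (rc (rk k) * expi t))) @ \oo --> cmod (p (rc 1 * expi t)).
    have -> : cmod (p (rc 1 * expi t)) = cmod (l * p (rc 1 * expi t)) by rewrite cmodM l1 mul1r.
    exact: (cvg_cmod (cvgM hl hp)).
  exact: (cvgM h2 h2).
(* [p] is a polynomial, so Parseval holds on the unit circle itself. *)
have E : mean 0 (fun t => cmod (p (rc 1 * expi t)) ^+ 2) = sqn p.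
  rewrite parseval_psum sqn_psum; apply: eq_bigr => k _.
  by rewrite expr1n mulr1.
rewrite E in c2; exact: (cvg_unique _ c1 c2).
Qed.

End InnerIso.

(** * The Poisson formula *)

Section Poisson.
Context {R : realType}.
Notation C := (Cplx R).
Implicit Types (f g phi : C -> C) (z w l : C) (c t x B r s e rho : R).

(** Dilation turns means over the circle of radius [s] into norms and inner products of H^2. *)
Definition dil f s : C -> C := fun z => f (rc s * z).

Lemma dil_disc s z : 0 <= s <= 1 -> disc z -> disc (rc s * z).
Proof.
move=> /andP[s0 s1]; rewrite !cmod_lt_disc cmodM cmod_rc ger0_norm//.
by move=> h; apply: le_lt_trans h; rewrite ler_piMl.
Qed.

Lemma taylor_dil f (a : nat -> C) s : 0 <= s <= 1 -> taylor_expansion f a ->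
  taylor_expansion (dil f s) (fun n => a n * rc s ^+ n).
Proof.
move=> s01 h z zD; have := h _ (dil_disc s01 zD); rewrite /dil.
have -> : (fun n => a n * (rc s * z) ^+ n) = (fun n => a n * rc s ^+ n * z ^+ n).
  by apply/funext => n; rewrite exprMn mulrA.
exact.
Qed.

Lemma analytic_dil f s : 0 <= s <= 1 -> ana f -> ana (dil f s).
Proof. by move=> s01 /ana_ex[a h]; apply: anaI (taylor_dil s01 h). Qed.

Lemma hardy_dil f s : 0 <= s < 1 -> ana f -> hardy (dil f s) /\
  forall c, mean c (fun t => cmod (f (rc s * expi t)) ^+ 2) = sqn (dil f s).
Proof.
move=> s01 af; have [s0 s1] := andP s01; have s01' : 0 <= s <= 1 by rewrite s0 ltW.
have td := taylor_dil s01' (coP af).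
have E : sqs (dil f s) = (fun n => cmod (co f n) ^+ 2 * s ^+ (2 * n)).
  apply/funext => n; rewrite sqsE (coE td) cmodM exprMn cmodX cmod_rc ger0_norm//.
  by rewrite -exprM mulnC.
have P c := @parseval R f (co f) s c (coP af) s01.
have S : summ (sqs (dil f s)) by rewrite E summE; apply/cvg_ex; eexists; exact: (P 0).
split; first by apply: H2I => //; exact: analytic_dil.
move=> c; rewrite sqnE totE E; apply/esym; apply: cvg_lim => //; exact: P.
Qed.

Lemma cont_circ_re f s : 0 <= s < 1 -> ana f -> continuous (fun t => re (f (rc s * expi t))).
Proof. by move=> s01 af; exact: taylor_cont_re (coP af) s01. Qed.

Lemma cont_circ_im f s : 0 <= s < 1 -> ana f -> continuous (fun t => im (f (rc s * expi t))).
Proof. by move=> s01 af; exact: taylor_cont_im (coP af) s01. Qed.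

Lemma rd_dil f g s c : 0 <= s < 1 -> ana f -> ana g ->
  mean c (fun t => cdot (f (rc s * expi t)) (g (rc s * expi t))) = rd (dil f s) (dil g s).
Proof.
move=> s01 af ag; have [hf mf] := hardy_dil s01 af; have [hg mg] := hardy_dil s01 ag.
have afg := analyticD af ag; have [_ /(_ c) mfg] := hardy_dil s01 afg.
have cd : continuous (fun t => cdot (f (rc s * expi t)) (g (rc s * expi t))).
  by apply: cont_cdot; (exact: cont_circ_re || exact: cont_circ_im).
have E : (fun t => cmod (f (rc s * expi t) + g (rc s * expi t)) ^+ 2) =
  (fun t => cmod (f (rc s * expi t)) ^+ 2 + cmod (g (rc s * expi t)) ^+ 2
    + 2 * cdot (f (rc s * expi t)) (g (rc s * expi t))).
  by apply/funext => t; rewrite cmod_sqD.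
rewrite E meanD in mfg; last 2 first.
- by apply: contD; [exact: (cont_circ af s01)|exact: (cont_circ ag s01)].
- by apply: contM => //; exact: cont_cst.
rewrite meanD in mfg; last 2 first.
- exact: (cont_circ af s01).
- exact: (cont_circ ag s01).
rewrite meanZ// mf mg in mfg.
have := sqnD hf hg; rewrite -/(dil _ _) => E2.
have E3 : sqn (dil (fun z => f z + g z) s) = sqn (fun z => dil f s z + dil g s z) by [].
rewrite E3 E2 in mfg; move: mfg.
by move: (mean _ _) (sqn _) (sqn _) (rd _ _) => p q u v h; lra.
Qed.

(* The Poisson kernel at [w]. *)
Definition pk w t : R := (1 - cmod w ^+ 2) * cmod (kernel w (expi t)) ^+ 2.

Lemma ana_kernel w : disc w -> ana (kernel w).
Proof. by move=> wD; exact: H2_analytic (H2_kernel wD). Qed.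

Lemma kernel_dil s w z : kernel (rc s * w) z = kernel w (rc s * z).
Proof.
rewrite /kernel; congr (_^-1); congr (_ - _).
by apply: cpx_eq; rewrite !reimE; ring.
Qed.

(** The Poisson kernel lives on the unit circle, whereas Parseval for analytic functions is
    available on smaller circles only. Since k_w(z) = k_(w/s)(s z), the kernel can be read on the
    circle of radius s; taking s between max(rho, |w|) and 1 keeps w/s in the disc and rho/s <=
    1. *)
Lemma kernel_rescale w rho : disc w -> 0 <= rho < 1 -> exists2 s, 0 < s < 1 &
  [/\ rho / s <= 1, disc (rc s^-1 * w) &
   forall z, kernel (rc s^-1 * w) (rc s * z) = kernel w z].
Proof.
rewrite !cmod_lt_disc => w1 /andP[r0 r1].
pose s := (1 + Num.max rho (cmod w)) / 2.
have m1 : Num.max rho (cmod w) < 1 by rewrite gt_max r1 w1.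
have mr : rho <= Num.max rho (cmod w) by rewrite le_max lexx.
have mw : cmod w <= Num.max rho (cmod w) by rewrite le_max lexx orbT.
have s0 : 0 < s by rewrite /s; move: (Num.max _ _) m1 mr => u *; lra.
have ws : cmod w < s by rewrite /s; move: (Num.max _ _) m1 mw => u *; lra.
exists s; first by rewrite s0/= /s; move: (Num.max _ _) m1 mw => u *; lra.
split.
- by rewrite ler_pdivrMr// mul1r /s; move: (Num.max _ _) m1 mr => u *; lra.
- by rewrite cmod_lt_disc cmodM cmod_rc ger0_norm ?invr_ge0 ?(ltW s0)// mulrC ltr_pdivrMr// mul1r.
move=> z; rewrite -kernel_dil mulrA -rcM mulfV ?gt_eqF// mul1r//.
Qed.

Lemma cont_pk w : disc w -> continuous (pk w).
Proof.
move=> wD; have [s /andP[s0 s1] [_ wD' E]] := @kernel_rescale w 0 wD ltac:(by rewrite lexx ltr01).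
apply: contM; first exact: cont_cst.
have -> : (fun t => cmod (kernel w (expi t)) ^+ 2) = (fun t => cmod (kernel (rc s^-1 * w) (rc s * expi t)) ^+ 2).
  by apply/funext => t; rewrite E.
by apply: (cont_circ (ana_kernel wD')); rewrite ltW.
Qed.

Lemma pk_ge0 w t : disc w -> 0 <= pk w t.
Proof.
rewrite cmod_lt_disc => w1; rewrite mulr_ge0 ?exprn_ge0// subr_ge0 expr_le1// ltW//.
Qed.

Lemma kernel_diag w : kernel w w = rc (1 - cmod w ^+ 2)^-1.
Proof.
have rcV x : rc x^-1 = (rc x)^-1 :> C by rewrite !rc_real; exact: (fmorphV (real_complex R)).
by rewrite rcV /kernel; congr (_^-1); apply: cpx_eq; rewrite !reimE ?cmod_sq; ring.
Qed.

Lemma cdot_mull z w : cdot (z * w) w = re z * cmod w ^+ 2.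
Proof. by rewrite cmod_sq /cdot reM imM; ring. Qed.

(** The product of f(rho z) k_w with k_w in H^2 is f(rho w) k_w(w) by the reproducing property, and
    k_w(w) = 1/(1 - |w|^2) is the normalisation of [pk]. *)
Lemma poisson f w rho c : ana f -> 0 <= rho < 1 -> disc w ->
  mean c (fun t => re (f (rc rho * expi t)) * pk w t) = re (f (rc rho * w)).
Proof.
move=> af r01 wD; have [s /andP[s0 s1] [rs wD' E]] := kernel_rescale wD r01.
have [r0 r1] := andP r01.
have rs01 : 0 <= rho / s <= 1 by rewrite rs divr_ge0// ltW.
pose k := kernel (rc s^-1 * w).
have ak : ana k by exact: ana_kernel.
have aF := analytic_dil rs01 af.
have ag := analyticM aF ak.
have s01 : 0 <= s < 1 by rewrite ltW.
have := @rd_dil _ _ s c s01 ag ak.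
have -> : dil k s = (fun v => 1 * kernel w v) by apply/funext => z; rewrite /dil /k E mul1r.
have hg := (hardy_dil s01 ag).1.
rewrite rd_kernel// {1}/dil.
have E2 z : rc (rho / s) * (rc s * z) = rc rho * z by rewrite mulrA -rcM divfK ?gt_eqF.
rewrite /k /dil !E E2 kernel_diag// => h.
have w1 : 0 < 1 - cmod w ^+ 2 by rewrite subr_gt0 expr_lt1//; exact: cmod_lt_disc.
have -> : (fun t => re (f (rc rho * expi t)) * pk w t) =
  (fun t => (1 - cmod w ^+ 2) * cdot (f (rc (rho / s) * (rc s * expi t)) * k (rc s * expi t)) (k (rc s * expi t))).
  by apply/funext => t; rewrite /k E E2 /pk cdot_mull mulrCA.
rewrite meanZ; last first.
  apply: cont_cdot.
  - exact: (cont_circ_re s01 ag).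
  - exact: (cont_circ_im s01 ag).
  - exact: (cont_circ_re s01 ak).
  - exact: (cont_circ_im s01 ak).
rewrite h /cdot !reimE.
by move: (re _) (1 - _) w1 => u v v0; field; rewrite gt_eqF.
Qed.

Lemma mean_pk w c : disc w -> mean c (pk w) = 1.
Proof.
move=> wD; have := @poisson (fun=> 1) w 0 c (analytic_cst _) ltac:(by rewrite lexx ltr01) wD.
have -> : (fun t => re (1 : C) * pk w t) = pk w by apply/funext => t; rewrite !reimE mul1r.
by rewrite !reimE.
Qed.

End Poisson.

(** * Bounds on the Poisson kernel *)

Section PoissonKernel.
Context {R : realType}.
Notation C := (Cplx R).
Implicit Types (f g phi : C -> C) (z w l : C) (c t x y B r s e rho : R).

Lemma cos_quarter x : 0 <= x <= pi / 4 -> 1 / 2 <= cos x.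
Proof.
move=> /andP[x0 x1]; have p0 := @pi_gt0 R.
have c0 : 0 <= cos x by apply: cos_ge0_pihalf; apply/andP; split; lra.
have : 0 <= cos (x *+ 2) by apply: cos_ge0_pihalf; rewrite [x *+ 2]mulr2n; apply/andP; split; lra.
by rewrite cos_mulr2n; move: (cos x) c0 => u *; nra.
Qed.

Lemma sin_quarter x : 0 <= x <= pi / 4 -> x / 2 <= sin x.
Proof.
move=> /andP[x0 x1].
have [y yI] := @MVT_segment R (@sin R) (@cos R) 0 x x0 (fun y _ => is_derive_sin y)
   (continuous_subspaceT (@continuous_sin R)).
move: yI; rewrite in_itv/= sin0 !subr0 => /andP[y0 y1] ->.
by rewrite mulrC ler_wpM2r//; have := @cos_quarter y; rewrite y0 (le_trans y1)// => /(_ isT); lra.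
Qed.

(** With x = |s|/4 <= pi/4, 1 - cos(4x) = 8 cos(x)^2 sin(x)^2, and the bounds cos x >= 1/2 and sin x
    >= x/2 give x^2/2 = s^2/32. *)
Lemma cos_gap s : `|s| <= pi -> s ^+ 2 / 32 <= 1 - cos s.
Proof.
move=> sp; have p0 := @pi_gt0 R.
rewrite -[s ^+ 2]real_normK ?num_real// -(cos_norm s).
have [x xE] : exists x, x = `|s| / 4 by exists (`|s| / 4).
have x01 : 0 <= x <= pi / 4 by rewrite xE; apply/andP; split; [rewrite divr_ge0|move: (`|s|) sp => u *; lra].
have h1 := cos_quarter x01; have h2 := sin_quarter x01.
have -> : `|s| = x *+ 2 *+ 2 by rewrite xE -mulrnA -mulr_natr; field.
rewrite !cos_mulr2n.
have := sin2cos2 x; case/andP: x01 => x0 _.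
move: (cos x) (sin x) h1 h2 x0 => p q h1 h2 x0 E.
have E2 : (x *+ 2 *+ 2) ^+ 2 / 32 = x ^+ 2 / 2 by rewrite -mulrnA -mulr_natr; field.
have -> : 1 - ((p ^+ 2 *+ 2 - 1) ^+ 2 *+ 2 - 1) = 8 * (p ^+ 2 * q ^+ 2) by rewrite E; ring.
rewrite E2.
have p2 : 1 / 4 <= p ^+ 2 by nra.
have q2 : x ^+ 2 / 4 <= q ^+ 2 by nra.
by nra.
Qed.

Lemma kernel_norm_ge w t : 1 - cmod w <= cmod (1 - cj w * expi t).
Proof.
have := cmodD (1 - cj w * expi t) (cj w * expi t).
by rewrite subrK cmod1 cmodM cmod_cj cmod_expi mulr1 lerBlDr.
Qed.

Lemma pk_le w t : disc w -> pk w t <= 2 / (1 - cmod w).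
Proof.
rewrite cmod_lt_disc => w1; rewrite /pk /kernel cmodV exprVn.
have := kernel_norm_ge w t; have := cmod_ge0 w.
move: (cmod w) (cmod (1 - _)) w1 => u v u1 u0 uv.
have d0 : 0 < 1 - u by rewrite subr_gt0.
have v0 : 0 < v by exact: lt_le_trans uv.
rewrite ler_pdivrMr ?exprn_gt0// mulrAC ler_pdivlMr//.
have : (1 - u) ^+ 2 <= v ^+ 2 by rewrite ler_sqr ?nnegrE// ltW.
by move=> h; nra.
Qed.

Lemma kernel_norm_sq r t s : cmod (1 - cj (rc r * expi s) * expi t) ^+ 2 =
  (1 - r) ^+ 2 + 2 * r * (1 - cos (t - s)).
Proof.
rewrite cmod_sq !reimE cosB.
have h1 := cos2Dsin2 t; have h2 := cos2Dsin2 s.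
move: (cos t) (cos s) (sin t) (sin s) h1 h2 => ct cs st ss h1 h2.
have -> : (1 - r) ^+ 2 + 2 * r * (1 - (ct * cs + st * ss)) =
    1 + r ^+ 2 * ((ct ^+ 2 + st ^+ 2) * (cs ^+ 2 + ss ^+ 2)) - 2 * r * (ct * cs + st * ss).
  by rewrite h1 h2; ring.
by ring.
Qed.

Lemma cmod_rexpi r t : 0 <= r -> cmod (rc r * expi t) = r.
Proof. by move=> r0; rewrite cmodM cmod_rc cmod_expi mulr1 ger0_norm. Qed.

(** As 2 r >= 1, the denominator is at least 1 - cos(t - s) >= (t - s)^2/32, while the numerator 1 -
    r^2 is at most 2 (1 - r). *)
Lemma pk_far r s t : 1 / 2 <= r < 1 -> `|t - s| <= pi ->
  pk (rc r * expi s) t * (t - s) ^+ 2 <= 64 * (1 - r).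
Proof.
move=> /andP[r0 r1] ts; have g := cos_gap ts.
rewrite /pk cmod_rexpi; last lra.
rewrite /kernel cmodV exprVn kernel_norm_sq.
have [->|x0] := eqVneq (t - s) 0; first by rewrite expr0n/= mulr0; lra.
have x2 : 0 < (t - s) ^+ 2 by rewrite exprn_even_gt0.
move: (cos _) ((t - s) ^+ 2) g x2 => u x g x0'.
have D0 : 0 < (1 - r) ^+ 2 + 2 * r * (1 - u) by nra.
rewrite mulrAC ler_pdivrMr//.
have h : x / 32 <= (1 - r) ^+ 2 + 2 * r * (1 - u) by nra.
have h2 : (1 - r ^+ 2) <= 2 * (1 - r) by nra.
move: (_ + _) D0 h => D D0 h.
apply: (@le_trans _ _ (2 * (1 - r) * x)); first by nra.
by nra.
Qed.

Lemma dyadic_scale e (d : R) : 0 < e -> e <= d -> exists K : nat, 2 ^+ K * e <= d < 2 ^+ K.+1 * e.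
Proof.
move=> e0 ed.
have ex : exists n : nat, d < 2 ^+ n.+1 * e.
  have [N hN] := @expn_unbounded R 2 (d / e) (ltr1n R 2).
  exists N; rewrite -ltr_pdivrMr//; apply: lt_le_trans hN _.
  by rewrite exprS ler_peMl ?exprn_ge0// ler1n.
case: (ex_minnP ex) => -[|K] hK mK; first by exists 0%N; rewrite hK expr0 mul1r ed.
exists K.+1; rewrite hK andbT leNgt; apply/negP => /mK.
by rewrite ltnn.
Qed.

(* Dominates the Poisson kernel, at distance [x] from its pole and with [e = 1 - r],
   by indicators of dyadic neighbourhoods, whose averages a Lebesgue point controls. *)
Lemma dyadic_bound (P x e : R) (K : nat) : 0 <= x -> 0 < e ->
  P <= 2 / e -> P * x ^+ 2 <= 64 * e ->
  P <= \sum_(k < K.+1) 256 / (4 ^+ k * e) * (x <= 2 ^+ k * e)%R%:R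
    + 64 * e / (2 ^+ K * e) ^+ 2.
Proof.
move=> x0 e0 near far.
have p4 k : 0 < 4 ^+ k * e := mulr_gt0 (exprn_gt0 k (ltr0n R 4)) e0.
have p2 k : 0 < 2 ^+ k * e := mulr_gt0 (exprn_gt0 k (ltr0n R 2)) e0.
have T k : 0 <= 256 / (4 ^+ k * e) * (x <= 2 ^+ k * e)%R%:R.
  exact: mulr_ge0 (divr_ge0 (ler0n R 256) (ltW (p4 k))) (ler0n R _).
have T2 : 0 <= 64 * e / (2 ^+ K * e) ^+ 2.
  exact: divr_ge0 (mulr_ge0 (ler0n R 64) (ltW e0)) (sqr_ge0 _).
have [hP|hP] := ltP P 0.
  apply: le_trans (ltW hP) _; apply: addr_ge0 => //.
  by apply: sumr_ge0 => k _; exact: T.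
have A n : x <= 2 ^+ n * e -> P <= \sum_(k < n.+1) 256 / (4 ^+ k * e) * (x <= 2 ^+ k * e)%R%:R.
  elim: n => [|n ih] h.
    rewrite big_ord_recl big_ord0 addr0/= h mulr1 expr0 mul1r; apply: le_trans near _.
    by rewrite ler_pM2r ?invr_gt0// ler_nat.
  rewrite big_ord_recr/=.
  have [xn|xn] := leP x (2 ^+ n * e).
    by apply: le_trans (ih xn) _; rewrite lerDl; exact: T.
  (* Here x > 2^n e, so [far] gives P <= 64 e/(2^n e)^2 = 256/(4^(n+1) e). This is the origin of
     256. *)
  apply: (@le_trans _ _ (256 / (4 ^+ n.+1 * e))); last first.
    by rewrite h mulr1 lerDr; apply: sumr_ge0 => k _; exact: T.
  rewrite ler_pdivlMr//.
  have h2 : (2 ^+ n * e) ^+ 2 <= x ^+ 2 by rewrite ler_sqr ?nnegrE ?(ltW (p2 n))// ltW.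
  have E : 4 ^+ n = 2 ^+ n * 2 ^+ n :> R by rewrite -exprMn; congr (_ ^+ _); ring.
  rewrite exprS E; move: (2 ^+ n) h2 => q h2.
  have : P * (q * e) ^+ 2 <= 64 * e by apply: le_trans far; exact: ler_wpM2l.
  have -> : P * (4 * (q * q) * e) = 4 * (P * (q * e) ^+ 2) / e by field; rewrite gt_eqF.
  by move=> h3; rewrite ler_pdivrMr//; lra.
have [xn|xn] := leP x (2 ^+ K * e).
  by apply: le_trans (A _ xn) _; rewrite lerDl; exact: T2.
apply: (@le_trans _ _ (64 * e / (2 ^+ K * e) ^+ 2)); last first.
  by rewrite lerDr; apply: sumr_ge0 => k _; exact: T.
rewrite ler_pdivlMr ?exprn_gt0//; apply: le_trans far; apply: ler_wpM2l => //.
by rewrite ler_sqr ?nnegrE ?(ltW (p2 K))// ltW.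
Qed.

Lemma pk_dyadic r s t (K : nat) : 1 / 2 <= r < 1 -> `|t - s| <= pi ->
  pk (rc r * expi s) t <=
  \sum_(k < K.+1) 256 / (4 ^+ k * (1 - r)) * (`|t - s| <= 2 ^+ k * (1 - r))%R%:R
  + 64 * (1 - r) / (2 ^+ K * (1 - r)) ^+ 2.
Proof.
move=> r01 ts; have [r0 r1] := andP r01.
apply: dyadic_bound; rewrite ?subr_gt0//.
  have := @pk_le (rc r * expi s) t; rewrite cmod_lt_disc cmod_rexpi; last lra.
  exact.
by rewrite real_normK ?num_real//; exact: pk_far.
Qed.

End PoissonKernel.

(** * Poisson means at Lebesgue points *)

Section LebesguePoint.
Context {R : realType}.
Notation C := (Cplx R).
Notation mu := (@lebesgue_measure R).
Implicit Types (b g h : R -> R) (c t x y B r s e d : R).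

Lemma imean_norm_le c g h : intg c g -> intg c h -> (forall t, arc c t -> `|g t| <= h t) ->
  `|mean c g| <= mean c h.
Proof.
move=> ig ih gh; rewrite ler_norml lerNl -mulN1r -imeanZ//.
apply/andP; split; apply: imean_le => //; first exact: intgZ.
  by move=> t /gh; rewrite ler_norml mulN1r lerNl => /andP[].
by move=> t /gh; rewrite ler_norml => /andP[].
Qed.

Lemma intg_sum c (N : nat) (F : nat -> R -> R) : (forall k, intg c (F k)) ->
  intg c (fun t => \sum_(k < N) F k t).
Proof.
move=> iF; elim: N => [|N ih].
  have -> : (fun t => \sum_(k < 0) F k t) = (fun=> 0) by apply/funext => t; rewrite big_ord0.
  by apply: intg_cont; exact: cont_cst.
have -> : (fun t => \sum_(k < N.+1) F k t) = (fun t => \sum_(k < N) F k t + F N t).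
  by apply/funext => t; rewrite big_ord_recr.
exact: intgD.
Qed.

Lemma imean_sum c (N : nat) (F : nat -> R -> R) : (forall k, intg c (F k)) ->
  mean c (fun t => \sum_(k < N) F k t) = \sum_(k < N) mean c (F k).
Proof.
move=> iF; elim: N => [|N ih].
  have -> : (fun t => \sum_(k < 0) F k t) = (fun=> 0) by apply/funext => t; rewrite big_ord0.
  by rewrite mean_cst big_ord0.
have -> : (fun t => \sum_(k < N.+1) F k t) = (fun t => \sum_(k < N) F k t + F N t).
  by apply/funext => t; rewrite big_ord_recr.
by rewrite imeanD// ?ih ?big_ord_recr//; exact: intg_sum.
Qed.

Lemma near_indicE s d : (fun t => (`|t - s| <= d)%R%:R) = \1_(`[s - d, s + d]%classic : set R) :> (R -> R).
Proof. by apply/funext => t; rewrite indicE mem_setE in_itv/= ler_distl. Qed.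

Lemma meas_near s d : measurable_fun setT (fun t => (`|t - s| <= d)%R%:R : R).
Proof. by rewrite near_indicE; exact: measurable_indic. Qed.

(** The closed interval of radius [d] sits in the open ball of radius 2d, of length 4d, over which
    the average oscillation is below [e]; the normalisation 1/(2 pi) absorbs the 4 since pi >= 2. *)
Lemma lebesgue_pt_mean b s e : measurable_fun setT b -> (forall t, `|b t| <= 1) ->
  lebesgue_pt b s -> 0 < e -> exists2 d0, 0 < d0 & forall d, 0 < d <= d0 ->
  mean (s - pi) (fun t => `|b t - b s| * (`|t - s| <= d)%R%:R) <= e * d.
Proof.
move=> mb b1 lb e0; have p0 := @pi2_gt0 R; have p2 := @pi_ge2 R.
have e0' : (0 < e%:E)%E by rewrite lte_fin.
have [d0 /= d00 H] : \forall r \near (0 : R)^'+, (davg b s r < e%:E)%E.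
  apply: (lb [set y : \bar R | (y < e%:E)%E]); apply: open_nbhs_nbhs; split => //.
  exact: open_ereal_lt_ereal.
exists (d0 / 4); first by rewrite divr_gt0.
move=> d /andP[d1 d2]; have d4 : 0 < 2 * d by rewrite mulr_gt0.
have := H (2 * d) _ d4; rewrite /= sub0r normrN ger0_norm ?(ltW d4)// => /(_ ltac:(lra)).
rewrite /davg /iavg lebesgue_measure_ball ?(ltW d4)//.
set J := (\int[mu]_(y in _) _)%E => HJ.
have mbs : measurable_fun setT (fun t => `|b t - b s|).
  by apply: measurableT_comp => //; apply: measurable_funB.
have JE : J = (\int[mu]_(y in ball s (2 * d)) `|b y - b s|%:E)%E by [].
have J0 : (0 <= J)%E by rewrite JE; apply: integral_ge0 => t _; rewrite lee_fin.
have d4' : 0 < 2 * d *+ 2 by rewrite mulrn_wgt0.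
have HJ2 : (J <= ((2 * d *+ 2) * e)%:E)%E.
  rewrite EFinM -lee_pdivrMl//; apply: ltW.
  by move: HJ; rewrite inver gt_eqF.
have mA := measurable_arc (s - pi).
pose cB : set R := `[s - d, s + d]%classic.
have mcB : measurable (cB : set (measurableTypeR R)) by exact: measurable_itv.
have mbE D : measurable_fun (D : set (measurableTypeR R)) (fun t => `|b t - b s|%:E).
  by apply/measurable_EFinP; exact: measurable_funS mbs.
pose I := (\int[mu]_(t in arc (s - pi)) (`|b t - b s| * (`|t - s| <= d)%R%:R)%:E)%E.
have I0 : (0 <= I)%E by apply: integral_ge0 => t _; rewrite lee_fin mulr_ge0.
have IJ : (I <= J)%E.
  have -> : I = (\int[mu]_(t in arc (s - pi) `&` cB) `|b t - b s|%:E)%E.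
    rewrite integral_mkcondr; apply: eq_integral => t _; rewrite patchE mem_setE in_itv/= -ler_distl.
    by case: ifP => _; rewrite ?mulr1 ?mulr0.
  rewrite JE; apply: ge0_subset_integral.
  - exact: measurableI.
  - exact: measurable_ball.
  - exact: mbE.
  - by move=> t _; rewrite lee_fin.
  - move=> t [_]; rewrite /cB /= in_itv/= -ler_distl ball_itv/= in_itv/= -ltr_distl => h.
    by apply: le_lt_trans h _; lra.
have {}IJ := le_trans IJ HJ2.
have If : I \is a fin_num by rewrite ge0_fin_numE// (le_lt_trans IJ) ?ltry.
have : fine I <= (2 * d *+ 2) * e by rewrite -lee_fin fineK.
rewrite /mean /Rintegral -/I -/mu => h.
rewrite mulrC ler_pdivrMr//; apply: le_trans h _.
have -> : 2 * d *+ 2 * e = e * d * 4 by rewrite -mulr_natr; ring.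
by rewrite ler_pM2l ?mulr_gt0//; lra.
Qed.

Lemma half_geo_sum n : \sum_(k < n) (1 / 2) ^+ k <= 2 :> R.
Proof.
have -> : \sum_(k < n) (1 / 2) ^+ k = 2 - 2 * (1 / 2) ^+ n :> R.
  by elim: n => [|n ih]; rewrite ?big_ord0 ?big_ord_recr/= ?ih ?exprS ?expr0; lra.
by rewrite gerBl mulr_ge0// exprn_ge0.
Qed.

(** By [mean_pk] the difference is the mean of (b - b(s)) [pk]. The dyadic indicators of radius at
    most d0 are handled by [lebesgue_pt_mean], the remaining constant by |b - b(s)| <= 2. *)
Lemma poisson_lebesgue b s e : measurable_fun setT b -> (forall t, `|b t| <= 1) ->
  lebesgue_pt b s -> 0 < e -> exists2 r0, r0 < 1 & forall r, r0 < r < 1 ->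
  `|mean (s - pi) (fun t => b t * pk (rc r * expi s) t) - b s| <= e.
Proof.
move=> mb b1 lb e0; pose c := s - pi.
(* The coefficient 256/(4^k (1 - r)) times (e/1024) 2^k (1 - r) is (e/4) 2^-k, so the dyadic terms
   add up to at most e/2. *)
have e1 : 0 < e / 1024 := divr_gt0 e0 (ltr0n R 1024).
have [d0 d00 H] := lebesgue_pt_mean mb b1 lb e1.
(* The bound 1/2 is for [pk_dyadic], d0 for [dyadic_scale]; the third makes 2 tl at most e/2, given
   2^K (1 - r) > d0/2. *)
pose e2 := Num.min (1 / 2) (Num.min d0 (e * d0 ^+ 2 / 1024)).
have d2 : 0 < e * d0 ^+ 2 / 1024 by exact: divr_gt0 (mulr_gt0 e0 (exprn_gt0 2 d00)) (ltr0n R 1024).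
have e20 : 0 < e2 by rewrite !lt_min d00 d2 andbT divr_gt0.
exists (1 - e2); first by rewrite ltrBlDr ltrDl.
move=> r /andP[r0 r1].
have re : 1 - r < e2 by move: (e2) r0 => u *; lra.
move: re; rewrite !lt_min => /and3P[re1 re2 re3].
have r01 : 1 / 2 <= r < 1 by rewrite r1 andbT; lra.
have ep : 0 < 1 - r by rewrite subr_gt0.
have wD : disc (rc r * expi s) by rewrite cmod_lt_disc cmod_rexpi//; lra.
have cp := cont_pk wD; have mp := meas_cont cp.
have pB t : `|pk (rc r * expi s) t| <= 2 / (1 - r).
  rewrite ger0_norm ?pk_ge0//; have := pk_le t wD; rewrite cmod_rexpi//; lra.
have mbs : measurable_fun setT (fun t => b t - b s) by exact: measurable_funB.
have mabs : measurable_fun setT (fun t => `|b t - b s|) by exact: measurableT_comp.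
have bs2 t : `|b t - b s| <= 2 by apply: le_trans (ler_normB _ _) _; have := b1 t; have := b1 s; lra.
have I1 : intg c (fun t => b t * pk (rc r * expi s) t).
  apply: (@intg_bdd _ _ _ (1 * (2 / (1 - r)))) => [|t _]; first exact: measurable_funM.
  by rewrite normrM ler_pM.
have I2 : intg c (fun t => b s * pk (rc r * expi s) t) by apply: intgZ; exact: intg_cont.
have -> : mean (s - pi) (fun t => b t * pk (rc r * expi s) t) - b s =
    mean c (fun t => b t * pk (rc r * expi s) t - b s * pk (rc r * expi s) t).
  by rewrite imeanB// imeanZ ?mean_pk ?mulr1//; exact: intg_cont.
have [K /andP[K1 K2]] := dyadic_scale ep (ltW re2).
pose cf k := 256 / (4 ^+ k * (1 - r)) : R.
pose F (k : nat) t := cf k * (`|b t - b s| * (`|t - s| <= 2 ^+ k * (1 - r))%R%:R).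
pose tl := 64 * (1 - r) / (2 ^+ K * (1 - r)) ^+ 2.
have cf0 k : 0 <= cf k.
  exact: divr_ge0 (ler0n R 256) (mulr_ge0 (exprn_ge0 k (ler0n R 4)) (ltW ep)).
have iN k : intg c (fun t => `|b t - b s| * (`|t - s| <= 2 ^+ k * (1 - r))%R%:R).
  apply: (@intg_bdd _ _ _ (2 * 1)) => [|t _]; first by apply: measurable_funM => //; exact: meas_near.
  rewrite normrM normr_id; apply: ler_pM => //.
  by rewrite normr_nat lern1 leq_b1.
have iF k : intg c (F k) by apply: intgZ; exact: iN.
have iS := @intg_sum c K.+1 F iF.
have iC x : intg c (fun=> x) by apply: intg_cont; exact: cont_cst.
have tl0 : 0 <= tl by exact: divr_ge0 (mulr_ge0 (ler0n R 64) (ltW ep)) (sqr_ge0 _).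
apply: (@le_trans _ _ (mean c (fun t => \sum_(k < K.+1) F k t + 2 * tl))).
  apply: imean_norm_le; [exact: intgB|exact: intgD|].
  move=> t; rewrite arcE /c => /andP[t1 t2].
  have ts : `|t - s| <= pi by rewrite ler_norml; apply/andP; clear -t1 t2; split; lra.
  rewrite -mulrBl normrM (ger0_norm (pk_ge0 t wD)).
  apply: (@le_trans _ _ (`|b t - b s| * (\sum_(k < K.+1) cf k * (`|t - s| <= 2 ^+ k * (1 - r))%R%:R + tl))).
    by apply: ler_wpM2l => //; exact: pk_dyadic.
  rewrite mulrDr lerD ?ler_wpM2r// mulr_sumr ler_sum// => k _.
  by rewrite /F mulrCA.
rewrite imeanD// imean_sum// mean_cst.
have T k : (k <= K)%N -> mean c (F k) <= e / 4 * (1 / 2) ^+ k.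
  move=> kK; rewrite imeanZ//.
  have q0 : 0 < 2 ^+ k :> R by rewrite exprn_gt0.
  have hd : 0 < 2 ^+ k * (1 - r) <= d0.
    rewrite mulr_gt0//= (le_trans _ K1)// ler_pM2r//.
    by rewrite ler_eXn2l// ltr1n.
  apply: le_trans (ler_wpM2l (cf0 k) (H _ hd)) _.
  have E : 4 ^+ k = 2 ^+ k * 2 ^+ k :> R by rewrite -exprMn; congr (_ ^+ _); ring.
  rewrite /cf E expr_div_n expr1n; move: (2 ^+ k) q0 => q q0.
  rewrite le_eqVlt; apply/orP; left; apply/eqP; field; by rewrite (gt_eqF q0) (gt_eqF ep).
have S1 : \sum_(k < K.+1) mean c (F k) <= e / 4 * 2.
  apply: (@le_trans _ _ (\sum_(k < K.+1) e / 4 * (1 / 2) ^+ k)).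
    by apply: ler_sum => k _; apply: T; rewrite -ltnS.
  by rewrite -mulr_sumr ler_wpM2l ?half_geo_sum// divr_ge0// ltW.
have S2 : 2 * tl <= e / 2.
  rewrite /tl exprS in K2 *; move: (2 ^+ K) K1 K2 => q K1 K2.
  have h1 : d0 / 2 <= q * (1 - r) by lra.
  have h2 : (d0 / 2) ^+ 2 <= (q * (1 - r)) ^+ 2 by rewrite ler_sqr ?nnegrE ?(le_trans _ h1)// divr_ge0// ltW.
  have h3 : 0 < (q * (1 - r)) ^+ 2 by apply: lt_le_trans h2; rewrite exprn_gt0// divr_gt0.
  rewrite mulrA ler_pdivrMr//.
  move: ((q * (1 - r)) ^+ 2) h2 h3 => D h2 _.
  have : e / 2 * (d0 / 2) ^+ 2 <= e / 2 * D by rewrite ler_wpM2l// divr_ge0// ltW.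
  have -> : e / 2 * (d0 / 2) ^+ 2 = 128 * (e * d0 ^+ 2 / 1024) by field.
  by move: (e * d0 ^+ 2 / 1024) (e / 2 * D) re3 => u v *; lra.
by move: (\sum_(k < _) _) S1 => u S1; move: (2 * tl) S2 => v S2; lra.
Qed.

End LebesguePoint.

(** * Radial limits almost everywhere *)

Section Fatou.
Context {R : realType}.
Notation C := (Cplx R).
Notation mu := (@lebesgue_measure R).
Implicit Types (f phi : C -> C) (b h : R -> R) (c t x y B r s e d : R) (z : C).

(** By monotone convergence the sum has a finite integral, hence is finite almost everywhere. *)
Lemma ae_series_cvg c (w : nat -> R -> R) : (forall k, continuous (w k)) ->
  (forall k t, 0 <= w k t) -> (forall k, mean c (w k) <= 2 * (1 / 2) ^+ k) ->
  {ae mu, forall t, arc c t -> summ (fun k => w k t)}.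
Proof.
move=> cw w0 mw; have p0 := @pi2_gt0 R; have mA := measurable_arc c.
have mE k : measurable_fun (arc c : set (measurableTypeR R)) (EFin \o w k).
  by apply/measurable_EFinP; exact: measurable_funS (meas_cont (cw k)).
have w0E k t : arc c t -> (0 <= (w k t)%:E)%E by move=> _; rewrite lee_fin.
have IE k : (\int[mu]_(t in arc c) (w k t)%:E)%E = (2 * pi * mean c (w k))%:E.
  rewrite /mean mulrA mulfV ?gt_eqF// mul1r /Rintegral fineK//.
  by apply: integrable_fin_num => //; exact: intg_cont.
have Sfin : (\int[mu]_(t in arc c) (\sum_(k <oo) (w k t)%:E) < +oo)%E.
  rewrite integral_nneseries//.
  apply: (@le_lt_trans _ _ (2 * pi * (2 * 2))%:E); last exact: ltry.
  apply: lime_le.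
    by apply: is_cvg_nneseries => k _ _; apply: integral_ge0 => t _; rewrite lee_fin.
  apply: nearW => N; rewrite (eq_bigr (fun k => (2 * pi * mean c (w k))%:E)) => [|k _]; last exact: IE.
  rewrite sumEFin lee_fin -mulr_sumr ler_pM2l// big_mkord.
  apply: (@le_trans _ _ (\sum_(k < N) 2 * (1 / 2) ^+ k)); first by apply: ler_sum.
  by rewrite -mulr_sumr ler_pM2l// half_geo_sum.
have mS : measurable_fun (arc c : set (measurableTypeR R)) (fun t => \sum_(k <oo) (w k t)%:E)%E.
  have -> : (fun t => \sum_(k <oo) (w k t)%:E)%E = (fun t => \sum_(k <oo | k \in xpredT) (w k t)%:E)%E.
    by apply/funext => t; apply: eq_eseriesl.
  apply: ge0_emeasurable_sum => [k t At _|k _]; [exact: w0E At|exact: mE].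
have S0 t : (0 <= \sum_(k <oo) (w k t)%:E)%E by apply: nneseries_ge0 => k _ _; rewrite lee_fin.
have iS : mu.-integrable (arc c) (fun t => \sum_(k <oo) (w k t)%:E)%E.
  apply/integrableP; split => //.
  by under eq_integral => t _ do rewrite gee0_abs//.
apply: ae_imp (integrable_ae mA iS) => t h At; have {h} fin := h At.
apply: (@summ_nneg _ _ (fine (\sum_(k <oo) (w k t)%:E)%E)) => // N.
rewrite -lee_fin fineK// -(big_mkord xpredT (fun k => w k t)) -sumEFin.
by apply: nneseries_lim_ge => k _ _; rewrite lee_fin.
Qed.

Lemma rd_dil_ge f r s : ana f -> 0 <= r <= s -> s < 1 -> sqn (dil f r) <= rd (dil f s) (dil f r).
Proof.
move=> af /andP[r0 rs] s1; have s0 := le_trans r0 rs; have r1 := le_lt_trans rs s1.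
have r01 : 0 <= r < 1 by rewrite r0.
have s01 : 0 <= s < 1 by rewrite s0.
have [hr _] := hardy_dil r01 af; have [hs _] := hardy_dil s01 af.
rewrite -[leLHS]rd_sq !rdE; apply: tot_le => [|N]; first exact: rd_summ.
have E u n : 0 <= u < 1 -> co (dil f u) n = co f n * rc u ^+ n.
  by move=> /andP[u0 u1]; rewrite (coE (@taylor_dil _ _ _ u _ (coP af)))// u0 ltW.
have Q u v n : 0 <= u < 1 -> 0 <= v < 1 -> dts (dil f u) (dil f v) n = cmod (co f n) ^+ 2 * (u ^+ n * v ^+ n).
  move=> u01 v01; rewrite dtsE !E//.
  have X x : rc x ^+ n = rc (x ^+ n) :> C.
    by elim: n => [|n ih]; rewrite ?expr0// !exprS ih rcM.
  by rewrite !X cmod_sq /cdot !reimE; ring.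
apply: (@le_trans _ _ (\sum_(k < N) dts (dil f s) (dil f r) k)).
  apply: ler_sum => k _; rewrite !Q//; apply: ler_wpM2l; first exact: exprn_ge0.
  by apply: ler_wpM2r; [exact: exprn_ge0|exact: lerXn2r].
apply: le_tot; last exact: rd_summ.
by move=> n; rewrite Q// mulr_ge0 ?exprn_ge0// mulr_ge0// exprn_ge0.
Qed.

(** Write f_r for [dil f r]. By [rd_dil_ge], |f_s - f_r|^2 <= |f_s|^2 - |f_r|^2 in H^2, and |f_s| <=
    |f|. *)
Lemma mean_dil_diff f r s c : hardy f -> 0 <= r <= s -> s < 1 ->
  mean c (fun t => cmod (f (rc s * expi t) - f (rc r * expi t)) ^+ 2) <= sqn f - circ_mean f r.
Proof.
move=> hf /andP[r0 rs] s1; have s0 := le_trans r0 rs; have r1 := le_lt_trans rs s1.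
have af := H2_analytic hf.
have r01 : 0 <= r < 1 by rewrite r0.
have s01 : 0 <= s < 1 by rewrite s0.
have [hr mr] := hardy_dil r01 af; have [hs ms] := hardy_dil s01 af.
have [s00|sn0] := eqVneq s 0.
  have r00 : r = 0 by apply/eqP; rewrite eq_le r0 andbT -s00.
  have -> : (fun t => cmod (f (rc s * expi t) - f (rc r * expi t)) ^+ 2) = (fun=> 0).
    by apply/funext => t; rewrite s00 r00 subrr cmod0 expr0n.
  by rewrite mean_cst subr_ge0; exact: circ_mean_le.
have sp : 0 < s by rewrite lt_def sn0.
have rs01 : 0 <= r / s <= 1 by rewrite divr_ge0//= ler_pdivrMr// mul1r.
(* Read on the circle of radius [s], f_r is the dilation of f by r/s, so one analytic function
   carries the whole difference. *)
have ag := analyticB af (analytic_dil rs01 af).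
have E z : rc (r / s) * (rc s * z) = rc r * z by rewrite mulrA -rcM divfK.
have [_ /(_ c)] := hardy_dil s01 ag.
have -> : (fun t => cmod (f (rc s * expi t) - dil f (r / s) (rc s * expi t)) ^+ 2) =
  (fun t => cmod (f (rc s * expi t) - f (rc r * expi t)) ^+ 2).
  by apply/funext => t; rewrite /dil E.
move=> ->.
have -> : dil (fun z => f z - dil f (r / s) z) s = (fun z => dil f s z - dil f r z).
  by apply/funext => z; rewrite /dil E.
rewrite sqnB//.
have h1 := @rd_dil_ge f r s af ltac:(by rewrite r0) s1.
have h2 : sqn (dil f s) <= sqn f by rewrite -(ms 0); exact: circ_mean_le.
have h3 : sqn (dil f r) = circ_mean f r by rewrite -(mr 0).
rewrite -h3; move: h1 h2.
by move: (rd _ _) (sqn (dil f s)) (sqn (dil f r)) (sqn f) => p q u v *; lra.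
Qed.

(** Radii approaching 1 so fast that the increments are summable almost everywhere. One sequence
    serves every period [c], because [fatou_re] uses the period centred at each point [s] in
    turn. *)
Lemma ae_radial_subseq f : hardy f -> exists rho : nat -> R,
  [/\ forall k, 0 <= rho k < 1, rho @ \oo --> (1 : R) &
   forall c, {ae mu, forall t, arc c t -> cvgn (fun k => re (f (rc (rho k) * expi t)))}].
Proof.
move=> hf; have af := H2_analytic hf.
(* Weighted by 2^k, mean squares of size 4^-k still leave the summable 2^-k. *)
have q0 k : 0 < (1 / 4 : R) ^+ k by rewrite exprn_gt0.
have [r0 Hr0] := choice (fun k => let: ex_intro2 r h1 h2 := circ_mean_near hf (q0 k) in
   ex_intro (fun r => 0 <= r < 1 /\ forall s, r <= s -> s < 1 -> sqn f - (1 / 4) ^+ k <= circ_mean f s) r (conj h1 h2)).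
pose rho k := Num.max (r0 k) (rk k).
have rho01 k : 0 <= rho k < 1.
  have [/andP[h1 h2] _] := Hr0 k; have /andP[h3 h4] := @rk01 R k.
  by rewrite /rho le_max h1 gt_max h2.
have rhok k s : rho k <= s -> s < 1 -> sqn f - circ_mean f s <= (1 / 4) ^+ k.
  move=> h1 h2; have [_ H] := Hr0 k.
  have := H s _ h2; rewrite (le_trans _ h1) ?le_max ?lexx// => /(_ isT).
  by move: (sqn f) (circ_mean f s) => u v; rewrite lerBlDr lerBlDl addrC.
exists rho; split=> //.
  apply: (@squeeze_cvgr _ _ _ _ rk (fun=> 1)); [|exact: rk_cvg|exact: cvg_cst].
  apply: nearW => k; have /andP[_ /ltW ->] := rho01 k.
  by rewrite /rho le_max lexx orbT.
move=> c; pose d k t := cmod (f (rc (rho k.+1) * expi t) - f (rc (rho k) * expi t)) ^+ 2.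
have cd k : continuous (d k).
  apply: cont_cmod2.
    have -> : re \o (fun t => f (rc (rho k.+1) * expi t) - f (rc (rho k) * expi t)) =
      (fun t => re (f (rc (rho k.+1) * expi t)) - re (f (rc (rho k) * expi t))).
      by apply/funext => t /=; rewrite reB.
    by apply: contB; exact: cont_circ_re.
  have -> : im \o (fun t => f (rc (rho k.+1) * expi t) - f (rc (rho k) * expi t)) =
      (fun t => im (f (rc (rho k.+1) * expi t)) - im (f (rc (rho k) * expi t))).
    by apply/funext => t /=; rewrite imB.
  by apply: contB; exact: cont_circ_im.
have md k : mean c (d k) <= (1 / 4) ^+ k.
  have /andP[h1 h2] := rho01 k; have /andP[h3 h4] := rho01 k.+1.
  (* [rho] need not be monotone, and [mean_dil_diff] wants the smaller radius first. *)
  have [le|lt] := leP (rho k) (rho k.+1).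
    apply: le_trans (@mean_dil_diff f (rho k) (rho k.+1) c hf _ h4) (rhok k _ (lexx _) h2).
    by rewrite h1.
  have -> : d k = (fun t => cmod (f (rc (rho k) * expi t) - f (rc (rho k.+1) * expi t)) ^+ 2).
    by apply/funext => t; rewrite /d cmodBC.
  apply: (@le_trans _ _ ((1 / 4) ^+ k.+1)).
    apply: le_trans (@mean_dil_diff f (rho k.+1) (rho k) c hf _ h2) (rhok _ _ (lexx _) h4).
    by rewrite h3 ltW.
  by rewrite exprS; have := ltW (q0 k); move: (_ ^+ k) => u *; lra.
(* [w k] dominates the increments: [y <= 2^-k + 2^k y^2]. *)
pose w k t := (1 / 2) ^+ k + 2 ^+ k * d k t.
have d0 k t : 0 <= d k t by exact: exprn_ge0.
have cm k : continuous (fun t => 2 ^+ k * d k t) by apply: contM => //; exact: cont_cst.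
have H : {ae mu, forall t, arc c t -> summ (fun k => w k t)}.
  apply: ae_series_cvg => [k|k t|k].
  - by apply: contD => //; exact: cont_cst.
  - by rewrite addr_ge0 ?mulr_ge0 ?exprn_ge0.
  - rewrite /w meanD//; last exact: cont_cst.
    have -> : 2 * (1 / 2) ^+ k = (1 / 2) ^+ k + (1 / 2) ^+ k :> R by rewrite mulr_natl mulr2n.
    rewrite mean_cst meanZ// lerD2l.
    apply: le_trans (ler_wpM2l (exprn_ge0 k (ler0n R 2)) (md k)) _.
    rewrite -exprMn mul1r le_eqVlt; apply/orP; left; apply/eqP; congr (_ ^+ _); by field.
apply: ae_imp H => t H At; have {H At} st := H At.
pose u k := re (f (rc (rho k) * expi t)).
have su : summ (fun k => u k.+1 - u k).
  apply: summ_dom st => k; rewrite /w /d -reB.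
  apply: le_trans (abs_re_le _) _; move: (cmod _) => y.
  have a0 : 0 < 2 ^+ k :> R by exact: exprn_gt0 _ (ltr0n R 2).
  rewrite expr_div_n expr1n; move: (2 ^+ k) a0 => a a0.
  (* Completing the square. *)
  have -> : 1 / a + a * y ^+ 2 = y + ((a * y - 1 / 2) ^+ 2 + 3 / 4) / a by field; rewrite gt_eqF.
  by rewrite lerDl divr_ge0 ?(ltW a0)// addr_ge0 ?sqr_ge0// divr_ge0.
apply/cvg_ex; exists (tot (fun k => u k.+1 - u k) + u 0%N).
have -> : (fun k => re (f (rc (rho k) * expi t))) = (fun N => \sum_(k < N) (u k.+1 - u k) + u 0%N).
  apply/funext => N; rewrite -(big_mkord xpredT (fun k => u k.+1 - u k)) telescope_sumr// subrK//.
by apply: cvgD; [exact: summ_cvg|exact: cvg_cst].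
Qed.

(** The boundary function is the clipped upper limit along the radii of [ae_radial_subseq]. Once [f]
    is known to be its Poisson integral, [poisson_lebesgue] applies at almost every point by
    Lebesgue differentiation. *)
Lemma fatou_re f : hardy f -> (forall z, disc z -> cmod (f z) <= 1) ->
  exists b, [/\ measurable_fun setT b, forall t, `|b t| <= 1 &
    {ae mu, forall t, re (f (rc r * expi t)) @[r --> (1 : R)^'-] --> b t}].
Proof.
move=> hf f1; have af := H2_analytic hf.
have [rho [rho01 crho aer]] := ae_radial_subseq hf.
pose u k t := re (f (rc (rho k) * expi t)).
have cu k : continuous (u k) by exact: cont_circ_re.
have u1 k t : `|u k t| <= 1.
  by apply: le_trans (abs_re_le _) _; apply: f1; exact: circ_disc.
have mls : measurable_fun setT (fun t => limn_sup (u ^~ t)).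
  apply: measurable_fun_limn_sup => [t _|t _|k].
  - by exists 1 => _ [k _ <-]; have := u1 k t; rewrite ler_norml => /andP[].
  - by exists (-1) => _ [k _ <-]; have := u1 k t; rewrite ler_norml => /andP[].
  - exact: meas_cont.
(* Clipping keeps [b] bounded where the sequence diverges. *)
pose b t := Num.max (-1) (Num.min 1 (limn_sup (u ^~ t))).
have mb : measurable_fun setT b.
  apply: measurable_maxr; first exact: measurable_cst.
  by apply: measurable_minr => //; exact: measurable_cst.
have b1 t : `|b t| <= 1.
  by rewrite ler_norml /b le_max lexx/= ge_max ge_min lexx andbT; lra.
have cb c : {ae mu, forall t, arc c t -> (fun k => u k t) @ \oo --> b t}.
  apply: ae_imp (aer c) => t h /h cut.
  have [l ul] := (cvg_ex _).1 cut.
  have [_ El] := cvg_limn_inf_sup ul.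
  have : `|l| <= 1.
    rewrite ler_norml; apply/andP; split.
      rewrite -(cvg_lim _ ul)//; apply: limr_ge => //; apply: nearW => k.
      by have := u1 k t; rewrite ler_norml => /andP[].
    rewrite -(cvg_lim _ ul)//; apply: limr_le => //; apply: nearW => k.
    by have := u1 k t; rewrite ler_norml => /andP[].
  rewrite ler_norml => /andP[l1 l2].
  by rewrite /b El (min_idPr l2) (max_idPr l1).
(* The Poisson formula at radius [rho k], passed to the limit by dominated convergence on the left
   and by continuity of [f] inside the disc on the right. *)
have poi s r : 0 <= r < 1 -> mean (s - pi) (fun t => b t * pk (rc r * expi s) t) = re (f (rc r * expi s)).
  move=> r01; have wD := circ_disc s r01.
  have cp := cont_pk wD.
  have [||||_ c1] := @mean_dct R (s - pi) (fun k t => u k t * pk (rc r * expi s) t)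
      (fun t => b t * pk (rc r * expi s) t) (1 * (2 / (1 - cmod (rc r * expi s)))).
  - by move=> k; apply: meas_cont; exact: contM.
  - by apply: measurable_funM => //; exact: meas_cont.
  - by move=> k t _; rewrite normrM; apply: ler_pM => //; rewrite ger0_norm ?pk_ge0// pk_le.
  - apply: ae_imp (cb (s - pi)) => t h /h ht.
    by apply: cvgM => //; exact: cvg_cst.
  have E k : mean (s - pi) (fun t => u k t * pk (rc r * expi s) t) = re (f (rc (rho k) * (rc r * expi s))).
    exact: poisson.
  have c2 : (fun k => re (f (rc (rho k) * (rc r * expi s)))) @ \oo --> re (f (rc r * expi s)).
    have crc : (fun k => rc (rho k)) @ \oo --> (1 : C).
      by apply: cvg_reim; [exact: crho|exact: cvg_cst].
    have cw (w : C) : (fun k => rc (rho k) * w) @ \oo --> w.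
      by rewrite -[X in _ --> X](mul1r w); exact: (cvgM crc (cvg_cst w)).
    exact: (cvg_re (cvg_comp _ _ (cw _) (analytic_cont af wD))).
  have E2 : (fun k => mean (s - pi) (fun t => u k t * pk (rc r * expi s) t)) = (fun k => re (f (rc (rho k) * (rc r * expi s)))).
    by apply/funext.
  by rewrite E2 in c1; exact: (cvg_unique _ c1 c2).
exists b; split => //.
have lb : locally_integrable setT b.
  split=> //; first exact: openT.
  move=> K _ cK; apply: (@le_lt_trans _ _ (\int[mu]_(x in K) 1%:E)%E).
    apply: ge0_le_integral => //.
    - exact: compact_measurable.
    - by apply/measurable_EFinP; apply: measurableT_comp => //; exact: measurable_funS mb.
    - by move=> t _; rewrite lee_fin.
  rewrite integral_cst//=; last exact: compact_measurable.
  by rewrite mul1e; exact: compact_finite_measure.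
apply: ae_imp (lebesgue_differentiation lb) => s ls.
apply/cvgrPdist_le => e e0.
have [r0 r01 H] := poisson_lebesgue mb b1 ls e0.
near=> r.
have r00 : 0 <= r by near: r; apply: nbhs_left_ge.
have r1 : r < 1 by near: r; exact: nbhs_left_lt.
rewrite distrC -poi ?r00//; apply: H; rewrite r1 andbT.
by near: r; exact: nbhs_left_gt.
Unshelve. all: by end_near. Qed.

Lemma iso_inner phi : iso phi -> inner phi.
Proof.
move=> ip; have hp := iso_H2 ip; have ap := H2_analytic hp.
have p1 z : disc z -> cmod (phi z) <= 1 by exact: iso_le1.
split.
- by rewrite ana_def.
- by exists 1.
(* The real part of -i phi is the imaginary part of phi. *)
have hip : hardy (fun z => - ci * phi z) by exact: H2Z.
have ip1 z : disc z -> cmod (- ci * phi z) <= 1.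
  by move=> zD; rewrite cmodM cmodN cmod_ci mul1r p1.
have [b1 [mb1 b11 c1]] := fatou_re hp p1.
have [b2 [mb2 b21 c2]] := fatou_re hip ip1.
have cl : {ae mu, forall t, phi (rc r * expi t) @[r --> (1 : R)^'-] --> cpx (b1 t) (b2 t)}.
  apply: ae_imp (ae_and c1 c2) => t [h1 h2]; apply: cvg_reim; first exact: h1.
  have -> : im \o (fun r => phi (rc r * expi t)) = (fun r => re (- ci * phi (rc r * expi t))).
    by apply/funext => r; rewrite /= !reimE; ring.
  exact: h2.
pose h t := 1 - (b1 t ^+ 2 + b2 t ^+ 2).
have mh : measurable_fun setT h.
  by apply: measurable_funB => //; apply: measurable_funD; exact: measurable_funX.
have rk1 k : @rk R k < 1 by case/andP: (@rk01 R k).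
(* The absolute value is there because [h] is known to be nonnegative only almost everywhere; on
   circles inside the disc it changes nothing, as |phi| <= 1. *)
have [||||ih c3] := @mean_dct R 0 (fun k t => `|1 - cmod (phi (rc (rk k) * expi t)) ^+ 2|)
  (fun t => `|h t|) 1.
- move=> k; apply: measurableT_comp => //; apply: measurable_funB => //.
  by apply: meas_cont; exact: (cont_circ ap (rk01 k)).
- exact: measurableT_comp.
- move=> k t _; rewrite normr_id.
  have := p1 _ (@circ_disc R _ t (rk01 k)); have := cmod_ge0 (phi (rc (rk k) * expi t)).
  move: (cmod _) => x x0 x1; rewrite ler_norml; apply/andP; split; nra.
- apply: ae_imp cl => t ht _; have hk := radial_seq ht rk1 (@rk_cvg R).
  have hc : (fun k => cmod (phi (rc (rk k) * expi t))) @ \oo --> cmod (cpx (b1 t) (b2 t)) by exact: (cvg_cmod hk).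
  have -> : h t = 1 - cmod (cpx (b1 t) (b2 t)) * cmod (cpx (b1 t) (b2 t)).
    by rewrite -expr2 cmod_sq.
  apply: cvg_norm; apply: cvgB; first exact: cvg_cst.
  exact: (cvgM hc hc).
have m0 : mean 0 (fun t => `|h t|) = 0.
  have E k : mean 0 (fun t => `|1 - cmod (phi (rc (rk k) * expi t)) ^+ 2|) = 1 - circ_mean phi (rk k).
    rewrite /circ_mean -[X in X - _](mean_cst 0) -meanB; last 2 first.
    - exact: cont_cst.
    - exact: (cont_circ ap (rk01 k)).
    congr (mean 0 _); apply/funext => t; rewrite ger0_norm// subr_ge0 expr_le1//.
    by apply: p1; exact: circ_disc (rk01 k).
  have E2 : (fun k => mean 0 (fun t => `|1 - cmod (phi (rc (rk k) * expi t)) ^+ 2|)) = (fun k => 1 - circ_mean phi (rk k)).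
    by apply/funext.
  rewrite E2 in c3.
  have c4 : (fun k => 1 - circ_mean phi (rk k)) @ \oo --> 1 - (1 : R).
    by apply: cvgB; [exact: cvg_cst|rewrite -(iso_sqn ip); exact: (circ_mean_cvg hp (@rk01 R) rk_cvg)].
  by rewrite (cvg_unique _ c3 c4)// subrr.
have mA := measurable_arc (0 : R).
have mhA : measurable_fun (arc 0 : set (measurableTypeR R)) (EFin \o h).
  by apply/measurable_EFinP; exact: measurable_funS mh.
have I0 : (\int[mu]_(t in arc 0) `|(EFin \o h) t| = 0)%E.
  move: m0; rewrite /mean => /eqP; rewrite mulf_eq0 invr_eq0 gt_eqF ?pi2_gt0//= => /eqP h0.
  have fi : (\int[mu]_(t in arc 0) (`|h t|)%:E)%E \is a fin_num by apply: integrable_fin_num.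
  have -> : (\int[mu]_(t in arc 0) `|(EFin \o h) t|)%E = (\int[mu]_(t in arc 0) (`|h t|)%:E)%E by [].
  by rewrite -(fineK fi); congr EFin.
have /(ae_eq_integral_abs mu mA mhA) ae0 := I0.
apply: ae_imp (ae_and cl ae0) => t [h1 h2] t01.
have At : arc 0 t by rewrite arcE add0r.
exists (cpx (b1 t) (b2 t)); last exact: h1.
have := h2 At; rewrite /= => -[] /eqP; rewrite /h subr_eq0 => /eqP E.
apply/eqP; rewrite -(@eqrXn2 _ 2)// expr1n cmod_sq; apply/eqP; exact/esym.
Qed.

End Fatou.

(** * Isolated zeros *)

Section IsolatedZeros.
Context {R : realType}.
Notation C := (Cplx R).
Implicit Types (f g k : C -> C) (z w a : C) (r s : R).

(* The disc automorphism taking [0] to [a]: it moves the Taylor expansion to [a]. *)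
Definition mob a w : C := (w + a) * kernel (- a) w.

Lemma disc_opp a : disc a -> disc (- a).
Proof. by rewrite !cmod_lt_disc cmodN. Qed.

Lemma kernel_neq0 a w : disc a -> disc w -> 1 - cj a * w != 0.
Proof.
move=> aD wD; apply: subr1_neq0; rewrite cmodM cmod_cj.
apply: (@le_lt_trans _ _ (cmod a * 1)); last by rewrite mulr1.
by apply: ler_wpM2l => //; exact: ltW.
Qed.

Lemma mob_def a w : disc a -> disc w ->
  1 - cmod (mob a w) ^+ 2 = (1 - cmod a ^+ 2) * (1 - cmod w ^+ 2) * cmod (kernel (- a) w) ^+ 2.
Proof.
move=> aD wD; have n0 := kernel_neq0 (disc_opp aD) wD.
have : cmod (1 - cj (- a) * w) ^+ 2 * cmod (kernel (- a) w) ^+ 2 = 1.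
  by rewrite -exprMn -cmodM /kernel mulfV// cmod1 expr1n.
have E : cmod (1 - cj (- a) * w) ^+ 2 = cmod (w + a) ^+ 2 + (1 - cmod a ^+ 2) * (1 - cmod w ^+ 2).
  by rewrite !cmod_sq !reimE; ring.
rewrite E /mob cmodM exprMn.
move: (cmod (w + a) ^+ 2) (cmod (kernel _ _) ^+ 2) ((1 - _) * (1 - _)) => x y t h.
by rewrite -h; ring.
Qed.

Lemma ana_mob a : disc a -> ana (mob a).
Proof.
move=> aD; apply: analyticM; last exact: ana_kernel (disc_opp aD).
apply: analyticD; last exact: analytic_cst.
exact: H2_analytic (iso_H2 (@iso_id R)).
Qed.

Lemma mob_selfmap a : disc a -> selfmap (mob a).
Proof.
move=> aD; split; first exact: ana_mob.
move=> r /andP[r0 r1].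
have a1 : 0 < 1 - cmod a ^+ 2 by rewrite subr_gt0 expr_lt1.
have r2 : 0 < 1 - r ^+ 2 by rewrite subr_gt0 expr_lt1.
(* A lower bound of 1 - |mob a z|^2 from [mob_def], the 4 coming from |1 + conj(a) z| <= 2. *)
pose d := (1 - cmod a ^+ 2) * (1 - r ^+ 2) / 4.
have d0 : 0 < d by rewrite divr_gt0// mulr_gt0.
have d1 : d <= 1.
  have : (1 - cmod a ^+ 2) * (1 - r ^+ 2) <= 1 * 1.
    by apply: ler_pM; rewrite ?(ltW a1) ?(ltW r2)// gerBl exprn_ge0.
  by rewrite /d; move: (_ * _) => u *; lra.
exists (Num.sqrt (1 - d)).
  rewrite sqrtr_ge0/= -(ltr_sqr (sqrtr_ge0 _) ler01) sqr_sqrtr ?subr_ge0// expr1n.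
  by rewrite ltrBlDr ltrDl.
move=> z zr; have zD : disc z by exact: le_disc zr r1.
rewrite -(ger0_norm (cmod_ge0 (mob a z))) -sqrtr_sqr ler_wsqrtr// lerBrDr -lerBrDl mob_def//.
have K4 : 1 / 4 <= cmod (kernel (- a) z) ^+ 2.
  have n0 := kernel_neq0 (disc_opp aD) zD.
  rewrite /kernel cmodV exprVn mul1r lef_pV2 ?posrE ?exprn_gt0 ?cmod_gt0//.
  have -> : 4 = 2 ^+ 2 :> R by ring.
  rewrite ler_sqr ?nnegrE//; apply: le_trans (cmodB _ _) _.
  rewrite cmod1 cmodM cmod_cj cmodN.
  have : cmod a * cmod z <= 1 * 1 by apply: ler_pM => //; exact: ltW.
  by rewrite mulr1 => h; lra.
have r3 : 1 - r ^+ 2 <= 1 - cmod z ^+ 2 by rewrite lerB// ler_sqr ?nnegrE.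
rewrite /d -[4^-1]mul1r; apply: ler_pM => //; first by rewrite mulr_ge0 ?ltW.
by apply: ler_wpM2l => //; exact: ltW.
Qed.

Lemma mobK a z : disc a -> disc z -> mob a (mob (- a) z) = z.
Proof.
move=> aD zD; have n0 := kernel_neq0 aD zD.
have aa : 1 - cj a * a != 0 by exact: kernel_neq0.
rewrite /mob /kernel opprK.
have -> : cj (- a) = - cj a by apply: cpx_eq; rewrite !reimE.
rewrite mulNr opprK.
have e1 : (z - a) / (1 - cj a * z) + a = z * (1 - cj a * a) / (1 - cj a * z).
  by field.
have e2 : 1 + cj a * ((z - a) / (1 - cj a * z)) = (1 - cj a * a) / (1 - cj a * z).
  by field.
by rewrite e1 e2; field; rewrite n0.
Qed.

Lemma taylor_unshiftn f (b : nat -> C) n : taylor_expansion f b -> (forall i, (i < n)%N -> b i = 0) ->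
  exists2 g, taylor_expansion g (fun i => b (n + i)%N) & forall z, disc z -> f z = z ^+ n * g z.
Proof.
elim: n => [|n ih] h b0.
  by exists f => // z _; rewrite expr0 mul1r.
have [|g hg gE] := ih h; first by move=> i ni; apply: b0; exact: ltnW.
have [k hk kE] := taylor_unshift hg.
exists k; first by under eq_fun do rewrite addSnnS.
by move=> z zD; rewrite gE// kE// addn0 b0// add0r mulrA -exprSr.
Qed.

Lemma near_disc a : disc a -> \forall z \near a, disc z.
Proof.
move=> aD; have h : cmod z @[z --> a] --> cmod a by exact: (@cvg_cmod R _ (nbhs a) _ id a cvg_id).
exact: (cvgr_lt (cmod a) h 1 aD).
Qed.

(** Composition with [mob a] brings the point to 0, where f o mob a = z^n k with n the first nonzero
    coefficient and k(0) nonzero. Continuity of [k] and injectivity of [mob (- a)] at its zero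
    finish. *)
Lemma isolated_zeros f a : ana f -> disc a -> (exists2 z, disc z & f z != 0) ->
  \forall z \near a^', f z != 0.
Proof.
move=> af aD [z1 z1D fz1].
have ag := analytic_comp af (mob_selfmap aD).
pose g z := f (mob a z).
have aND := disc_opp aD.
have mN := mob_selfmap aND.
(* If all coefficients vanished, [f] would vanish on the whole disc, every point of which is [mob a]
   of another by [mobK]. *)
have ex : exists n, co g n != 0.
  apply: contrapT => /forallNP h.
  move: fz1; rewrite -(mobK aD z1D) => /eqP; apply.
  have /(_ _ (selfmap_disc mN z1D)) := coP ag.
  have -> : co (fun z => f (mob a z)) = (fun=> 0).
    by apply/funext => n; apply/eqP; move: (h n) => /negP; rewrite negbK.
  move=> hs; apply: (cvgC_unique hs).
  have -> : series (fun n => 0 * mob (- a) z1 ^+ n) = (fun=> 0).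
    by apply/funext => n; rewrite seriesEnat/=; apply: big1 => i _; rewrite mul0r.
  exact: cvg_cst.
case: (ex_minnP ex) => n gn mn.
have [|k hk kE] := @taylor_unshiftn g (co g) n (coP ag).
  by move=> i; apply: contraTeq => /mn; rewrite -leqNgt.
have ak : ana k by exact: anaI hk.
have k0 : k 0 != 0 by rewrite (taylor0 hk) addn0.
have m0 : mob (- a) a = 0 by rewrite /mob subrr mul0r.
have akm := analytic_comp ak mN.
have kc := analytic_cont akm aD; rewrite m0 in kc.
have H1 : \forall z \near a, k (mob (- a) z) != 0 by exact: (cvgr_neq0 (k 0) kc k0).
have H2 := near_disc aD.
near=> z.
have za : z != a by near: z; exact: nbhs_dnbhs_neq.
have zD : disc z by near: z; apply: nbhs_dnbhs.
have kz : k (mob (- a) z) != 0 by near: z; apply: nbhs_dnbhs.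
have mz : mob (- a) z != 0.
  by rewrite /mob mulf_neq0 ?subr_eq0// /kernel invr_eq0 opprK kernel_neq0.
rewrite -(mobK aD zD) -/(g _) kE; last exact: selfmap_disc.
by rewrite mulf_neq0// expf_neq0.
Unshelve. all: by end_near. Qed.

End IsolatedZeros.

(** * Model spaces *)

Section ModelSpaces.
Context {R : realType}.
Notation C := (Cplx R).
Implicit Types (f g h k theta u v psi A Y F : C -> C) (z w a : C) (r s : R).

(** The real form [rd] determines the complex inner product: pairing with i g gives its imaginary
    part. *)
Lemma H2dotE f g : hardy f -> hardy g -> H2dot f g = cpx (rd f g) (rd f (fun z => ci * g z)).
Proof.
move=> hf hg; have hig := H2Z ci hg.
have c1 := summ_cvg (rd_summ hf hg); have c2 := summ_cvg (rd_summ hf hig).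
rewrite -rdE in c1; rewrite -rdE in c2.
rewrite /H2dot; apply: cvg_lim; first exact: norm_hausdorff.
apply: cvg_reim.
  have -> : re \o series (fun n => taylor_coef f n * (taylor_coef g n)^*) = (fun N => \sum_(k < N) dts f g k).
    apply/funext => N /=; rewrite seriesEnat/= big_mkord (re_sum _ (fun n => taylor_coef f n * (taylor_coef g n)^*)).
    apply: eq_bigr => k _; rewrite dtsE !co_def /cdot.
    have -> : (co g k)^* = cj (co g k) by case: (co g k).
    by rewrite !reimE; ring.
  exact: c1.
have -> : im \o series (fun n => taylor_coef f n * (taylor_coef g n)^*) = (fun N => \sum_(k < N) dts f (fun z => ci * g z) k).
  apply/funext => N /=; rewrite seriesEnat/= big_mkord (im_sum _ (fun n => taylor_coef f n * (taylor_coef g n)^*)).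
  apply: eq_bigr => k _; rewrite dtsE !co_def (coZ _ _ (H2_analytic hg)) /cdot.
  have -> : (co g k)^* = cj (co g k) by case: (co g k).
  by rewrite !reimE; ring.
exact: c2.
Qed.

(** theta H^2 is stable under multiplication by i, so orthogonality for the real part alone
    suffices. *)
Lemma model_spaceE theta f : iso theta -> model_space theta f <->
  (hardy f /\ forall h, hardy h -> rd f (fun z => theta z * h z) = 0).
Proof.
move=> it; rewrite /model_space /= hardy_def; split=> -[hf o]; split=> // h hh.
  have := o h; rewrite hardy_def => /(_ hh).
  by rewrite H2dotE//; [move=> -[]|exact: isoH].
rewrite hardy_def in hh.
rewrite H2dotE//; last exact: isoH.
rewrite o//; have -> : (fun z => ci * (theta z * h z)) = (fun z => theta z * (ci * h z)).
  by apply/funext => z; rewrite mulrCA.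
by rewrite o//; exact: H2Z.
Qed.

(** An isometric multiplier is injective; this avoids dividing at the zeros of [A]. *)
Lemma iso_cancel A f g : iso A -> hardy f -> hardy g ->
  (forall z, disc z -> A z * f z = A z * g z) -> forall z, disc z -> f z = g z.
Proof.
move=> iA hf hg e z zD; apply/eqP; rewrite -subr_eq0; apply/eqP.
have hfg := H2B hf hg.
apply: (sqn_eq0 hfg) => //; rewrite -(isoN iA hfg).
have -> : sqn (fun z => A z * (f z - g z)) = sqn (fun=> 0).
  by apply: sqn_ext => v vD; rewrite mulrBr e// subrr.
by rewrite sqn_cst cmod0 expr0n.
Qed.

(** For a polynomial p, |k p| = |A k p| = |Y p| = |p| in H^2. *)
Lemma iso_div A Y k : iso A -> iso Y -> hardy k ->
  (forall z, disc z -> Y z = A z * k z) -> iso k.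
Proof.
move=> iA iY hk e; apply: iso_psum; first exact: H2_analytic.
move=> c N; have hp := H2_psum c N.
have hkp : hardy (fun z => k z * psum c N z).
  have hX i : hardy (fun z => c i * (z ^+ i * k z)).
    by apply: H2Z; exact: (isoH (isoX i (@iso_id R)) hk).
  apply: H2_ext (@H2_sum _ N _ hX) => z _.
  rewrite /psum mulr_sumr; apply: eq_bigr => i _.
  by rewrite mulrA mulrC.
split=> //; rewrite -(isoN iA hkp) -(isoN iY hp).
by apply: sqn_ext => z zD; rewrite e// mulrA.
Qed.

(** The squared norm of psi - psi(0) is 1 - |psi(0)|^2. *)
Lemma iso_const psi : iso psi -> cmod (psi 0) = 1 -> forall z, disc z -> psi z = psi 0.
Proof.
move=> ip p1 z zD; have hp := iso_H2 ip; have hc := H2_cst (psi 0).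
apply/eqP; rewrite -subr_eq0; apply/eqP.
apply: (sqn_eq0 (H2B hp hc)) => //; rewrite sqnB// rdC (rd_cst _ (H2_analytic hp)).
by rewrite sqn_cst iso_sqn// cdot_sq p1; ring.
Qed.

Lemma iso_lt1 psi : iso psi -> ~ (exists c, forall z, disc z -> psi z = c) -> cmod (psi 0) < 1.
Proof.
move=> ip nc; rewrite lt_neqAle iso_le1 ?andbT//; last by rewrite cmod_lt_disc cmod0.
by apply/eqP => p1; apply: nc; exists (psi 0); exact: iso_const.
Qed.

(** A constant theta has modulus 1, so theta H^2 = H^2 and the model space is zero. *)
Lemma model_nontrivial_lt1 theta : iso theta -> nontrivial_space (model_space theta) ->
  cmod (theta 0) < 1.
Proof.
move=> it [g /(model_spaceE _ it)[hg o] [z zD gz]]; apply: iso_lt1 => // -[c tc].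
have c1 : cmod c ^+ 2 = 1 by rewrite -sqn_cst -(iso_sqn it); apply: sqn_ext => w wD; rewrite tc.
have := o _ (H2Z (cj c) hg).
have -> : rd g (fun z => theta z * (cj c * g z)) = rd g g.
  apply: rd_ext => // w wD; rewrite tc// mulrA.
  have -> : c * cj c = rc (cmod c ^+ 2) by apply: cpx_eq; rewrite cmod_sq !reimE; ring.
  by rewrite c1 mul1r.
by rewrite rd_sq => /(sqn_eq0 hg)/(_ z zD) g0; rewrite g0 eqxx in gz.
Qed.

(** After multiplication by z, theta - theta(0) is paired with theta z h. The first term becomes the
    pairing of 1 with z h, the second that of a constant with theta z h; both functions vanish at
    0. *)
Lemma model_quotient theta q : iso theta -> hardy q ->
  (forall z, disc z -> theta z = theta 0 + z * q z) ->
  forall h, hardy h -> rd q (fun z => theta z * h z) = 0.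
Proof.
move=> it hq e h hh; have ht := iso_H2 it; have hth := isoH it hh; have hzh := H2_shift hh.
rewrite -rd_shift//.
have -> : rd (fun z => z * q z) (fun z => z * (theta z * h z)) =
    rd (fun z => theta z - theta 0) (fun z => theta z * (z * h z)).
  by apply: rd_ext => z zD; [rewrite e// addrAC subrr add0r|rewrite mulrCA].
have hzt := isoH it hzh.
rewrite rdBl//; last exact: H2_cst.
have -> : rd theta (fun z => theta z * (z * h z)) = rd (fun=> 1) (fun z => z * h z).
  rewrite -(iso_rd it (H2_cst 1) hzh); apply: rd_ext => // z zD; by rewrite mulr1.
rewrite (rd_cst _ (H2_analytic hzh)) (rd_cst _ (H2_analytic hzt)).
by rewrite !mul0r mulr0 /cdot !reimE; ring.
Qed.

End ModelSpaces.

(** * The composition operator and the three cases of eta *)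

Section Composition.
Context {R : realType}.
Notation C := (Cplx R).
Implicit Types (f g h k theta u v psi eta : C -> C) (z w a : C) (r s : R).

(** The inner factor [m] covers the three cases at once: [eta_fun_spec] supplies 1, psi/z or psi. *)
Lemma comp_model_space u theta psi eta m g :
  iso u -> iso theta -> iso psi -> iso eta -> iso m -> cmod (psi 0) < 1 ->
  (forall z, disc z -> psi z * eta z = z * (theta (psi z) * u (psi z)) * m z) ->
  model_space theta g -> model_space eta (fun z => u (psi z) * g (psi z)).
Proof.
move=> iu it ip ie im p1 e /(model_spaceE _ it)[hg o].
have iU := iso_comp iu ip p1; have iT := iso_comp it ip p1.
have hg' := H2_comp ip p1 hg; have hUg := isoH iU hg'.
apply/(model_spaceE _ ie); split=> // h hh.
have hm := isoH im hh; have hTm := isoH iT hm.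
rewrite -(iso_rd ip hUg (isoH ie hh)).
rewrite -(model_comp_orth it ip p1 hg o hm) -(iso_rd iU (isoH ip hg') (H2_shift hTm)).
apply: rd_ext => z zD; first by ring.
by rewrite mulrA e//; ring.
Qed.

Lemma comp_model_factor u theta psi v :
  iso u -> iso theta -> iso psi -> iso v -> cmod (psi 0) < 1 -> cmod (theta 0) < 1 ->
  (forall g, model_space theta g -> model_space v (fun z => u (psi z) * g (psi z))) ->
  exists2 k, iso k & forall z, disc z -> psi z * v z = z * (theta (psi z) * u (psi z)) * k z.
Proof.
move=> iu it ip iv p1 t1 E.
have iU := iso_comp iu ip p1; have iT := iso_comp it ip p1.
have ht := iso_H2 it; have [q [hq _ qE]] := H2_unshift ht.
have mq : model_space theta q by apply/(model_spaceE _ it); split=> //; exact: model_quotient.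
have /(model_spaceE _ iv)[hUq o] := E q mq.
have iY := isoM ip iv; have iF := isoM iT iU.
have sm := iso_selfmap ip p1.
have orth h : hardy h ->
    rd (fun z => theta (psi z) * u (psi z) - theta 0 * u (psi z)) (fun z => psi z * v z * h z) = 0.
  move=> hh; rewrite -(o h hh) -(iso_rd ip hUq (isoH iv hh)).
  apply: rd_ext => z zD; last by rewrite mulrA.
  by rewrite (qE _ (selfmap_disc sm zD)); ring.
have orth2 := orth_absorb iT iU iY t1 orth.
have [k hk kE] := iso_factor iF iY orth2.
exists k => //; apply: (@iso_div _ (fun z => z * (theta (psi z) * u (psi z))) (fun z => psi z * v z)) => //.
by apply: isoM => //; exact: iso_id.
Qed.

(** Since theta u = z h, the quotient (theta u)(psi)/psi is h(psi) off the zeros of [psi]. These are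
    isolated, so the limit in [eta_fun] is the value of the continuous function z h(psi). *)
Lemma eta_fun_vanishing u theta psi h : iso psi -> cmod (psi 0) < 1 -> iso h ->
  nonconstant psi ->
  (theta 0 == 0) || (u 0 == 0) -> (forall z, disc z -> theta z * u z = z * h z) ->
  forall z, disc z -> eta_fun u theta psi z = z * h (psi z).
Proof.
move=> ip p1 ih nc H0 hE z zD; rewrite /eta_fun H0.
have sm := iso_selfmap ip p1; have ap := H2_analytic (iso_H2 ip).
case: eqP => [pz|/eqP pz]; last first.
  by rewrite (hE _ (selfmap_disc sm zD)); field.
have nz : exists2 w, disc w & psi w != 0.
  apply: contrapT => /forall2NP H; apply: nc; exists 0 => w wD.
  by have [//|/negP] := H w; rewrite negbK => /eqP.
have iso0 := isolated_zeros ap zD nz.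
have ac : ana (fun w => w * h (psi w)).
  by apply: analytic_shift; apply: analytic_comp sm; exact: H2_analytic (iso_H2 ih).
have cl : w * h (psi w) @[w --> z^'] --> z * h (psi z).
  by apply: cvg_within_filter; exact: (analytic_cont ac zD).
apply: cvg_lim; first exact: norm_hausdorff.
have H2 := near_disc zD.
apply: cvg_trans cl; apply: near_eq_cvg; near=> w.
have wD : disc w by near: w; apply: nbhs_dnbhs.
have pw : psi w != 0 by near: w.
by rewrite (hE _ (selfmap_disc sm wD)); field.
Unshelve. all: by end_near. Qed.

(** The last two clauses say that psi eta is the least common multiple of psi and z F, with F =
    (theta u) o psi. *)
Lemma eta_fun_spec u theta psi : iso u -> iso theta -> iso psi -> cmod (psi 0) < 1 ->
  nonconstant psi ->
  let eta := eta_fun u theta psi in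
  [/\ iso eta,
      exists2 m, iso m & forall z, disc z -> psi z * eta z = z * (theta (psi z) * u (psi z)) * m z &
      forall v k, iso v -> iso k ->
        (forall z, disc z -> psi z * v z = z * (theta (psi z) * u (psi z)) * k z) ->
        exists2 w, iso w & forall z, disc z -> v z = eta z * w z].
Proof.
move=> iu it ip p1 nc eta; have sm := iso_selfmap ip p1; have iid := @iso_id R.
have iU := iso_comp iu ip p1; have iT := iso_comp it ip p1; have iF := isoM iT iU.
have iH := isoM it iu; have D0 := @disc0 R.
have [H0|Hn0] := boolP ((theta 0 == 0) || (u 0 == 0)).
  have H00 : theta 0 * u 0 = 0 by case/orP: H0 => /eqP ->; rewrite ?mul0r ?mulr0.
  have [h [hh _ hE0]] := H2_unshift (iso_H2 iH).
  have hE z : disc z -> theta z * u z = z * h z by move=> zD; rewrite hE0// H00 add0r.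
  have ih : iso h by exact: (iso_div iid iH hh).
  have etaE := eta_fun_vanishing ip p1 ih nc H0 hE.
  have ie : iso eta.
    by apply: (iso_ext (phi := fun z => z * h (psi z))); [move=> z zD; rewrite -etaE|exact: isoM iid (iso_comp ih ip p1)].
  split=> //.
    exists (fun=> 1); first by apply: iso_cst; rewrite cmod1.
    by move=> z zD; rewrite /eta etaE// (hE _ (selfmap_disc sm zD)); ring.
  move=> v k iv ik e; exists k => //.
  apply: (iso_cancel ip (iso_H2 iv) (isoH ie (iso_H2 ik))) => z zD.
  by rewrite e// /eta etaE// (hE _ (selfmap_disc sm zD)); ring.
have Hc0 : theta 0 * u 0 != 0 by move: Hn0; rewrite negb_or mulf_eq0 negb_or.
have [q [hq _ qE]] := H2_unshift (iso_H2 iH).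
(* Here F = c + psi q(psi) with c = theta(0) u(0) nonzero, so psi and F are coprime. This Bezout
   relation turns psi v = z F k into c z k = psi (v - z k q(psi)), which shows that psi divides z k
   and gives the formula for [w]. *)
have split_w v k : iso v -> iso k ->
    (forall z, disc z -> psi z * v z = z * (theta (psi z) * u (psi z)) * k z) ->
    exists w : C -> C, [/\ iso w, forall z, disc z -> z * k z = psi z * w z &
      forall z, disc z -> v z = theta (psi z) * u (psi z) * w z].
  move=> iv ik e; pose w z := (theta 0 * u 0)^-1 * (v z - z * (k z * q (psi z))).
  have hw : hardy w.
    apply: H2Z; apply: H2B; first exact: iso_H2.
    by apply: H2_shift; apply: isoH => //; exact: H2_comp.
  have wE z : disc z -> z * k z = psi z * w z.
    move=> zD; have := e z zD; rewrite (qE _ (selfmap_disc sm zD)) /w => e1.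
    have -> : psi z * ((theta 0 * u 0)^-1 * (v z - z * (k z * q (psi z)))) =
      (theta 0 * u 0)^-1 * (psi z * v z - psi z * (z * (k z * q (psi z)))) by ring.
    rewrite e1; move: (theta 0 * u 0) Hc0 => c c0; by field.
  have iw : iso w by exact: (iso_div ip (isoM iid ik) hw).
  exists w; split=> //.
  apply: (iso_cancel ip (iso_H2 iv) (isoH iF hw)) => z zD.
  have := e z zD; have := wE z zD; move: (w z) (k z) (theta _) (u _) => x y a b xy ->.
  by rewrite mulrAC xy; ring.
rewrite /eta /eta_fun (negbTE Hn0).
have [p0|p0] := eqVneq (psi 0) 0.
  have [p [hp _ pE0]] := H2_unshift (iso_H2 ip).
  have pE z : disc z -> psi z = z * p z by move=> zD; rewrite pE0// p0 add0r.
  have ipp : iso p by exact: (iso_div iid ip hp).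
  split=> //.
    exists p => // z zD; rewrite {1}pE//; ring.
  by move=> v k iv ik /(split_w _ _ iv ik)[w [iw _ vE]]; exists w.
split.
- exact: isoM.
- by exists psi => // z zD; ring.
move=> v k iv ik /(split_w _ _ iv ik)[w [iw wE vE]].
(* As psi(0) is nonzero, the zero of z k = psi w at 0 belongs to [w]; this is the factor z of
   [eta]. *)
have w0 : w 0 = 0.
  by have /esym/eqP := wE 0 D0; rewrite mul0r mulf_eq0 (negbTE p0) => /eqP.
have [w1 [hw1 _ w1E0]] := H2_unshift (iso_H2 iw).
have w1E z : disc z -> w z = z * w1 z by move=> zD; rewrite w1E0// w0 add0r.
exists w1; first exact: (iso_div iid iw hw1).
by move=> z zD; rewrite vE// w1E//; ring.
Qed.

End Composition.

Theorem theorem3p10 (R : realType) (u theta psi : Cplx R -> Cplx R)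
    (hu : inner u) (htheta : inner theta) (hpsi : inner psi)
    (hpsi_nc : nonconstant psi)
    (hK : nontrivial_space (model_space theta)) :
  let eta := eta_fun u theta psi in
  [/\ inner eta,
      (forall z, disc z -> disc (psi z)) /\
      (forall f, mul_space u (model_space theta) f ->
         model_space eta (comp_op psi f)),
      (exists M : R, forall f, mul_space u (model_space theta) f ->
         H2norm (comp_op psi f) <= M * H2norm f) &
      smallest_model_space eta
        [set comp_op psi f | f in mul_space u (model_space theta)]].
Proof.
move=> eta.
have iu := inner_iso hu; have it := inner_iso htheta; have ip := inner_iso hpsi.
have p1 := iso_lt1 ip hpsi_nc; have t1 := model_nontrivial_lt1 it hK.
have [ie [m im mE] div] := eta_fun_spec iu it ip p1 hpsi_nc.
have inc f : mul_space u (model_space theta) f -> model_space eta (comp_op psi f).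
  by move=> [g mg <-]; exact: (comp_model_space iu it ip ie im p1 mE mg).
split.
- exact: iso_inner.
- by split=> // z zD; exact: selfmap_disc (iso_selfmap ip p1) zD.
- exists (Num.sqrt ((1 - cmod (psi 0) ^+ 2) / (1 - cmod (psi 0)) ^+ 2)) => f [g /(model_spaceE _ it)[hg _] <-].
  have hug := isoH iu hg; have [_ le] := littlewood ip p1 hug.
  rewrite !H2normE -sqrtrM; last exact: littlewood_const_ge0.
  exact: ler_wsqrtr.
split.
- exact: iso_inner.
- by move=> _ [f mf <-]; exact: inc.
move=> v hv E; have iv := inner_iso hv.
have Ev g : model_space theta g -> model_space v (fun z => u (psi z) * g (psi z)).
  by move=> mg; apply: E; exists (fun z => u z * g z) => //; exists g.
have [k ik kE] := comp_model_factor iu it ip iv p1 t1 Ev.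
have [w iw wE] := div v k iv ik kE.
by exists w => //; exact: iso_inner.
Qed.
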